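(* Fix integers $d\geq 2$ and $1\leq q_1\leq \ldots\leq q_d$, and consider the sequence of random vectors $$F^{(n)} = (F^{(n)}_1,\ldots,F^{(n)}_d)^T := \big(Q_{q_1}(f_{1,n}),\ldots,Q_{q_d}(f_{d,n})\big)^T,$$ with kernels $f_{j,n}\in\mathfrak{H}_0^{\odot q_j}$ for each $n\in\mathbb{N}$ and $j\in\{1,\ldots,d\}$. Assume that the covariance matrix $\Sigma_n$ of $F^{(n)}$ converges in Hilbert-Schmidt norm to a nonnegative definite symmetric matrix $\Sigma=(\Sigma_{i,j},1\leq i,j\leq d)$, as $n\to+\infty$. Suppose that $$\lim_{n\to+\infty}\sum_{j=1}^d\mathcal{M}(f_{j,n})=0.$$ If for each $j\in\{1,\ldots,d\}$, $\mathbb{E}\big[(F^{(n)}_j)^4\big]$ converges to $3\Sigma_{j,j}^2$ as $n\to+\infty$, then $F^{(n)}$ converges in distribution to $Z\sim\mathcal{N}(0,\Sigma)$, as $n\to+\infty$.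
   Context: $\mathbb{N}=\{1,2,\ldots\}$. $\mathbf{X}=(X_k,k\in\mathbb{N})$ is a fixed sequence of independent random variables on a probability space $(\Omega,\mathcal{F},\mathbb{P})$ with $\mathbb{P}(X_k=1)=p_k=1-q_k=1-\mathbb{P}(X_k=-1)\in(0,1)$ (the numbers $p_k,q_k$ attached to the sequence $\mathbf{X}$ are unrelated to the integers $q_1,\dots,q_d$ in the claim). Its normalised version is $\mathbf{Y}=(Y_k,k\in\mathbb{N})$ with $Y_k=\frac{X_k-p_k+q_k}{2\sqrt{p_kq_k}}$. $\mathfrak{H}=\ell^2(\mathbb{N})$; $\mathfrak{H}^{\otimes p}$ is its $p$-th tensor product (identified with $\ell^2(\mathbb{N}^p)$), $\mathfrak{H}^{\odot p}$ the subspace of symmetric elements, and $\mathfrak{H}^{\odot p}_0$ the set of those $f\in\mathfrak{H}^{\odot p}$ that vanish outside $\Delta_p=\{(i_1,\ldots,i_p)\in\mathbb{N}^p: i_k\neq i_j \text{ for } k\neq j\}$. For $f\in\mathfrak{H}^{\odot p}_0$, $p\in\mathbb{N}$, the discrete multiple integral is $$Q_p(f)=Q_p(f;\mathbf{Y})=\sum_{i_1,\ldots,i_p\in\mathbb{N}}f(i_1,\ldots,i_p)Y_{i_1}\cdots Y_{i_p}$$ (converging in $L^2(\mathbb{P})$). The maximal influence of $f\in\mathfrak{H}^{\odot p}_0$ is $\mathcal{M}(f)=\sup_{k\in\mathbb{N}}\sum_{i_1,\ldots,i_{p-1}\in\mathbb{N}}f(i_1,\ldots,i_{p-1},k)^2$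 for $p\geq2$, and $\mathcal{M}(f)=\sup_{k\in\mathbb{N}}f(k)^2$ for $p=1$. *)

(* Defs.v *)
From HB Require Import structures.
From mathcomp Require Import all_boot all_order all_algebra perm.
From mathcomp Require Import finmap.
From mathcomp Require Import all_classical all_reals all_analysis.
From mathcomp Require analysis.showcase.summability.

Set Implicit Arguments.
Unset Strict Implicit.
Unset Printing Implicit Defensive.

Import Order.TTheory GRing.Theory Num.Theory.
Import numFieldNormedType.Exports.

Local Open Scope classical_set_scope.
Local Open Scope ring_scope.

(* N = {1, 2, ...} is encoded by nat, starting at 0; N^p by p.-tuple nat. *)

Definition mutually_independent d (T : measurableType d) (R : realType)
    (P : probability T R) (X : nat -> {RV P >-> R}) : Prop :=
  forall (J : {fset nat}) (B : nat -> set R),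
    (forall k, measurable (B k)) ->
    P (\bigcap_(k in [set` J]) (X k @^-1` B k)) =
    (\prod_(k <- J) P (X k @^-1` B k))%E.
Arguments mutually_independent {d T R} P X.

(* The success probabilities p_k of the sequence X; q_k = 1 - p_k. *)
Definition rademacher_seq d (T : measurableType d) (R : realType)
    (P : probability T R) (p : nat -> R) (X : nat -> {RV P >-> R}) : Prop :=
  [/\ mutually_independent P X,
      forall k, 0 < p k < 1,
      forall k, P [set w | X k w = 1] = (p k)%:E &
      forall k, P [set w | X k w = -1] = (1 - p k)%:E].
Arguments rademacher_seq {d T R} P p X.

Definition normalised d (T : measurableType d) (R : realType)
    (P : probability T R) (p : nat -> R) (X : nat -> {RV P >-> R})
    (k : nat) (w : T) : R :=
  (X k w - p k + (1 - p k)) / (2 * Num.sqrt (p k * (1 - p k))).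

Definition square_summable (R : realType) (p : nat)
    (f : p.-tuple nat -> R) : Prop :=
  (\esum_(i in [set: p.-tuple nat]) (f i ^+ 2)%:E < +oo)%E.

Definition symmetric_kernel (R : realType) (p : nat)
    (f : p.-tuple nat -> R) : Prop :=
  forall (s : 'S_p) (i : p.-tuple nat), f [tuple tnth i (s k) | k < p] = f i.

Definition vanishes_on_diagonals (R : realType) (p : nat)
    (f : p.-tuple nat -> R) : Prop :=
  forall i : p.-tuple nat, ~~ uniq i -> f i = 0.

Definition kernel0 (R : realType) (p : nat) (f : p.-tuple nat -> R) : Prop :=
  [/\ square_summable f, symmetric_kernel f & vanishes_on_diagonals f].

(* G is (a version of) Q_p(f; Y): the series over N^p converges to G in L^2(P)
   unconditionally, i.e. along the net of all finite subsets of N^p. *)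
Definition is_multiple_integral d (T : measurableType d) (R : realType)
    (P : probability T R) (Y : nat -> T -> R) (p : nat)
    (f : p.-tuple nat -> R) (G : {RV P >-> R}) : Prop :=
  Lnorm P 2%:E (fun w => (G w -
      \sum_(i <- A) f i * \prod_(k < p) Y (tnth i k) w)%:E)
    @[A --> @summability.totally (p.-tuple nat)] --> 0%E.
Arguments is_multiple_integral {d T R} P Y {p} f G.

(* For 1 <= p, the tuples with last entry k are the (i_1, ..., i_(p-1), k);
   when p = 1 the only one is (k), and the sum is f(k)^2. *)
Definition max_influence (R : realType) (p : nat)
    (f : p.-tuple nat -> R) : \bar R :=
  ereal_sup [set (\esum_(i in [set i : p.-tuple nat | last 0%N i = k])
                   (f i ^+ 2)%:E)%E | k in [set: nat]].

Definition random_vector (T : Type) (R : realType) (m : nat)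
    (F : 'I_m -> T -> R) (w : T) : 'cV[R]_m := \col_j F j w.

Definition covariance_mx d (T : measurableType d) (R : realType)
    (P : probability T R) (m : nat) (F : 'I_m -> {RV P >-> R}) : 'M[R]_m :=
  \matrix_(i, j) fine (covariance P (F i) (F j)).
Arguments covariance_mx {d T R} P {m} F.

Definition hs_norm (R : realType) (m : nat) (A : 'M[R]_m) : R :=
  Num.sqrt (\sum_i \sum_j A i j ^+ 2).

Definition nonneg_definite (R : realType) (m : nat) (S : 'M[R]_m) : Prop :=
  forall v : 'cV[R]_m, 0 <= (v^T *m S *m v) 0 0.

(* N(0, v) on the real line. The library's normal_prob is the uniform
   distribution on [0, 1] when the standard deviation is 0. *)
Definition centered_normal (R : realType) (v : R) (B : set R) : \bar R :=
  if v == 0 then dirac (0 : R) B else normal_prob 0 (Num.sqrt v) B.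

(* Z ~ N(0, S), S possibly singular: every linear combination of the
   components of Z is normal with mean 0 and variance v^T S v. *)
Definition gaussian_vector d (T : measurableType d) (R : realType)
    (P : probability T R) (m : nat) (S : 'M[R]_m)
    (Z : 'I_m -> {RV P >-> R}) : Prop :=
  forall (v : 'cV[R]_m) (B : set R), measurable B ->
    P [set w | B (\sum_j v j 0 * Z j w)] =
    centered_normal ((v^T *m S *m v) 0 0) B.
Arguments gaussian_vector {d T R} P {m} S Z.

Definition cvg_in_distribution d (T : measurableType d)
    d' (T' : measurableType d') (R : realType) (P : probability T R)
    (P' : probability T' R) (m : nat) (F : nat -> 'I_m -> {RV P >-> R})
    (Z : 'I_m -> {RV P' >-> R}) : Prop :=
  forall g : 'cV[R]_m -> R, continuous g -> (exists M, forall x, `|g x| <= M) ->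
    ('E_P[g \o random_vector (F n)])%E @[n --> \oo] -->
    ('E_P'[g \o random_vector Z])%E.
Arguments cvg_in_distribution {d T d' T' R} P P' {m} F Z.

(* Main.v *)
(* After restricting all indices to the first N ones, every F_j becomes a
   function on a finite product of two-point spaces, homogeneous of degree q_j
   in the Walsh expansion, i.e. an eigenfunction of the resampling Laplacian.
   Bounding from below the Walsh coefficients of degree p + q of a product FG of
   two such functions, in terms of second moments and influences, and comparing
   with the fourth moments, shows that the coefficients of FG of degree strictly
   between 0 and p + q are small; hence the carre du champ Gam(F, G) is nearly
   constant and the fourth powers of the resampling increments are small.
   Stein's method of exchangeable pairs then gives E[W phi(W)] close to
   E[W^2] E[phi'(W)] for every linear combination W of the F_j. Applied to
   phi = sin(t . + c), this is an approximate differential equation for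
   t |-> E[cos(t W + c)], whose exact solution is the Gaussian one. Together with
   tightness, the convergence of these integrals gives convergence in
   distribution. All bounds are uniform in N, so that N can be taken to infinity
   first. *)

Require Import Defs.
From HB Require Import structures.
From mathcomp Require Import all_boot all_order all_algebra.
From mathcomp Require Import finmap.
From mathcomp Require Import all_classical all_reals all_analysis.
From mathcomp Require Import perm ring lra measurable_realfun.
From mathcomp Require analysis.showcase.summability.

Set Implicit Arguments.
Unset Strict Implicit.
Unset Printing Implicit Defensive.

Import Order.TTheory GRing.Theory Num.Theory.
Import numFieldNormedType.Exports.

Local Open Scope ring_scope.

(** * Walsh analysis on products of two-point spaces *)

Section TwoPointSpace.
Context {R : realType} {I : finType}.
Variable pr : I -> R.
Hypothesis pr01 : forall k, 0 < pr k < 1.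

Local Notation cube := {ffun I -> bool}.
Implicit Types (F G H : cube -> R) (A B : {set I}) (x : cube) (k : I).

(** In Gaussian chaos, E[F^2 G^2] >= E[F^2] E[G^2] + 2 E[FG]^2, with the energy of the levels
    strictly between 0 and p + q as a lower bound for the gap. Here kernels live off the diagonals,
    so index sets that meet spoil this inequality; the loss is a union bound over common points, and
    this is where the maximal influence enters. For F = G the fourth-moment hypothesis closes the
    inequality. For F and G distinct, an upper bound on E[F^2 G^2] has to be extracted from the two
    separate fourth moments. If p < q, F^2 has no Walsh coefficient at level 2q or above, while G^2
    is already small at the lower nonzero levels. If p = q, a polarisation identity does it. This is
    how assumptions on single components control the whole vector. Restricting the indices amounts
    to taking a conditional expectation, so second moments do not grow and, by Jensen, neither do
    fourth moments. Working with cosines and a free phase instead of complex exponentials keeps all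
    arguments real. *)

Definition wt k (b : bool) : R := if b then pr k else 1 - pr k.

Definition yv k (b : bool) : R :=
  ((if b then 1 else -1) - pr k + (1 - pr k)) /
  (2 * Num.sqrt (pr k * (1 - pr k))).

Lemma wt_gt0 k b : 0 < wt k b.
Proof. by have := pr01 k; rewrite /wt; case: b => /andP[? ?]; lra. Qed.

Lemma wt_ge0 k b : 0 <= wt k b. Proof. exact/ltW/wt_gt0. Qed.

Lemma sum_wt k : \sum_b wt k b = 1.
Proof. by rewrite big_bool /= /wt addrC subrK. Qed.

Lemma sqrt_pq k : exists2 s, Num.sqrt (pr k * (1 - pr k)) = s &
  s ^+ 2 = pr k * (1 - pr k) /\ 0 < s.
Proof.
have /andP[p0 p1] := pr01 k.
have pq0 : 0 < pr k * (1 - pr k) by apply: mulr_gt0 => //; lra.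
eexists; first by []; rewrite sqr_sqrtr ?ltW//; split => //.
by rewrite sqrtr_gt0.
Qed.

Lemma sum_wt_yv k : \sum_b wt k b * yv k b = 0.
Proof.
rewrite big_bool /wt /yv /=; have [s -> [_ s0]] := sqrt_pq k.
have s0' : s != 0 by rewrite gt_eqF.
field; lra.
Qed.

(** A product of two values of [yv k] is rational in [pr k]: the square root disappears, which lets
    [field] conclude below. *)
Lemma yvM k b c : yv k b * yv k c = ((if b then 1 else -1) - pr k + (1 - pr k)) *
   ((if c then 1 else -1) - pr k + (1 - pr k)) / (4 * (pr k * (1 - pr k))).
Proof.
have [s sE [s2 s0]] := sqrt_pq k.
by rewrite -s2 /yv sE; field; rewrite gt_eqF.
Qed.

Lemma pr_neq0 k : pr k != 0 /\ 1 - pr k != 0.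
Proof. by have /andP[p0 p1] := pr01 k; rewrite subr_eq0 !gt_eqF. Qed.

Lemma sum_wt_yv2 k : \sum_b wt k b * yv k b ^+ 2 = 1.
Proof.
have [pn0 qn0] := pr_neq0 k.
by rewrite big_bool /wt !expr2 !yvM /=; field; rewrite pn0 qn0.
Qed.

(** The functions 1 and [yv k] form an orthonormal basis of the functions of one bit; the left side
    is its reproducing kernel. *)
Lemma yv_complete k b c : 1 + yv k b * yv k c = (b == c)%:R / wt k b.
Proof.
have [pn0 qn0] := pr_neq0 k.
rewrite yvM /wt; case: b c => [] [] /=; rewrite ?mulr1n ?mulr0n; field;
  by rewrite ?pn0 ?qn0.
Qed.

Definition Ex F : R := \sum_(x : cube) (\prod_k wt k (x k)) * F x.

Definition setc x k b : cube := [ffun i => if i == k then b else x i].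

Definition chi A x : R := \prod_(k in A) yv k (x k).

Definition cf F A : R := Ex (fun x => F x * chi A x).

Lemma wprod_ge0 x : 0 <= \prod_k wt k (x k).
Proof. by apply: prodr_ge0 => k _; exact: wt_ge0. Qed.

Lemma eq_Ex F G : F =1 G -> Ex F = Ex G.
Proof. by move=> FG; apply: eq_bigr => x _; rewrite FG. Qed.

Lemma ExD F G : Ex (fun x => F x + G x) = Ex F + Ex G.
Proof. by rewrite -big_split; apply: eq_bigr => x _; rewrite mulrDr. Qed.

Lemma ExZ (a : R) F : Ex (fun x => a * F x) = a * Ex F.
Proof. by rewrite /Ex mulr_sumr; apply: eq_bigr => x _; rewrite mulrCA. Qed.

Lemma ExN F : Ex (fun x => - F x) = - Ex F.
Proof. by rewrite /Ex -sumrN; apply: eq_bigr => x _; rewrite mulrN. Qed.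

Lemma ExB F G : Ex (fun x => F x - G x) = Ex F - Ex G.
Proof. by rewrite ExD ExN. Qed.

Lemma Ex_sum (J : finType) (P : pred J) (F : J -> cube -> R) :
  Ex (fun x => \sum_(j | P j) F j x) = \sum_(j | P j) Ex (F j).
Proof.
by rewrite exchange_big; apply: eq_bigr => x _; rewrite mulr_sumr.
Qed.

Lemma ler_Ex F G : (forall x, F x <= G x) -> Ex F <= Ex G.
Proof.
by move=> FG; apply: ler_sum => x _; rewrite ler_wpM2l// wprod_ge0.
Qed.

Lemma Ex_ge0 F : (forall x, 0 <= F x) -> 0 <= Ex F.
Proof. by move=> F0; apply: sumr_ge0 => x _; rewrite mulr_ge0// wprod_ge0. Qed.

Lemma ler_norm_Ex F : `|Ex F| <= Ex (fun x => `|F x|).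
Proof.
apply: le_trans (ler_norm_sum _ _ _) _; apply: ler_sum => x _.
by rewrite normrM ger0_norm// wprod_ge0.
Qed.

Lemma Ex_prod (h : I -> bool -> R) :
  Ex (fun x => \prod_k h k (x k)) = \prod_k \sum_b wt k b * h k b.
Proof. by rewrite bigA_distr_bigA; apply: eq_bigr => x _; rewrite big_split. Qed.

Lemma Ex_cst (a : R) : Ex (fun=> a) = a.
Proof.
have -> : Ex (fun=> a) = a * Ex (fun x => \prod_k (fun=> fun=> 1) k (x k)).
  by rewrite -ExZ; apply: eq_Ex => x; rewrite big1 ?mulr1.
rewrite (Ex_prod (fun=> fun=> 1)) big1 ?mulr1// => k _.
by under eq_bigr do rewrite mulr1; exact: sum_wt.
Qed.

Lemma setcK x k b : setc (setc x k b) k (x k) = x.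
Proof. by apply/ffunP => i; rewrite !ffunE; case: eqP => // ->. Qed.

Lemma setcE x k b : setc x k b k = b.
Proof. by rewrite ffunE eqxx. Qed.

Lemma wprod_setc x k b :
  (\prod_i wt i (x i)) * wt k b = (\prod_i wt i (setc x k b i)) * wt k (x k).
Proof.
rewrite (bigD1 k)//= [in RHS](bigD1 k)//= setcE.
under [in RHS]eq_bigr => i /negPf ik do rewrite ffunE ik.
by rewrite mulrAC [RHS]mulrAC; congr (_ * _); rewrite mulrC.
Qed.

(* Resampling the coordinate [k] yields an exchangeable pair. *)
Lemma Ex_exch k (H : cube -> cube -> R) :
  Ex (fun x => \sum_b wt k b * H x (setc x k b)) =
  Ex (fun x => \sum_b wt k b * H (setc x k b) x).
Proof.
have E (G : cube -> bool -> R) : Ex (fun x => \sum_b wt k b * G x b) =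
    \sum_(u : cube * bool) (\prod_i wt i (u.1 i)) * wt k u.2 * G u.1 u.2.
  rewrite -(pair_bigA _ (fun x b => (\prod_i wt i (x i)) * wt k b * G x b)).
  by apply: eq_bigr => x _; rewrite mulr_sumr; apply: eq_bigr => b _; rewrite mulrA.
rewrite (E (fun x b => H x (setc x k b))) (E (fun x b => H (setc x k b) x)).
(* Swapping the old and the new value of coordinate [k] is an involution that preserves the joint
   weight, by [wprod_setc]. *)
rewrite (reindex_inj (h := fun u : cube * bool => (setc u.1 k u.2, u.1 k)))/=.
  by apply: eq_bigr => -[x b] _ /=; rewrite setcK -wprod_setc.
move=> [x b] [x' b'] /= [E1 E2].
have -> : b = b' by rewrite -(setcE x k b) E1 setcE.
by rewrite -(setcK x k b) E1 E2 setcK.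
Qed.

Lemma Ex_resample k F : Ex (fun x => \sum_b wt k b * F (setc x k b)) = Ex F.
Proof.
rewrite (Ex_exch k (fun _ y => F y)); apply: eq_Ex => x.
by rewrite -mulr_suml sum_wt mul1r.
Qed.

Lemma chi_setc_notin A x k b : k \notin A -> chi A (setc x k b) = chi A x.
Proof.
move=> kA; apply: eq_bigr => i iA; rewrite ffunE.
by case: eqP => // ik; rewrite -ik iA in kA.
Qed.

Lemma resample_chi A x k :
  \sum_b wt k b * chi A (setc x k b) = if k \in A then 0 else chi A x.
Proof.
case: ifPn => kA; last first.
  by under eq_bigr do rewrite chi_setc_notin//; rewrite -mulr_suml sum_wt mul1r.
have E b : chi A (setc x k b) =
    yv k b * \prod_(i in A | i != k) yv i (x i).
  rewrite /chi (bigD1 k)//= setcE; congr (_ * _); apply: eq_bigr => i.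
  by move=> /andP[_ /negPf ik]; rewrite ffunE ik.
by under eq_bigr do rewrite E mulrA; rewrite -mulr_suml sum_wt_yv mul0r.
Qed.

(** Averaging coordinate [k] alone already annihilates [chi A], since [yv k] is centred. *)
Lemma Ex_chi_indep k G A : k \in A -> (forall x b, G (setc x k b) = G x) ->
  Ex (fun x => G x * chi A x) = 0.
Proof.
move=> kA Gk; rewrite -(Ex_resample k) -[RHS](Ex_cst 0); apply: eq_Ex => x.
under eq_bigr do rewrite Gk mulrCA.
by rewrite -mulr_sumr resample_chi kA mulr0.
Qed.

Lemma chi0 x : chi finset.set0 x = 1.
Proof. by rewrite /chi big_set0. Qed.

Lemma Ex_chi2 A B : Ex (fun x => chi A x * chi B x) = (A == B)%:R.
Proof.
have -> : Ex (fun x => chi A x * chi B x) =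
    Ex (fun x => \prod_k (fun k b => (if k \in A then yv k b else 1) *
                            (if k \in B then yv k b else 1)) k (x k)).
  by apply: eq_Ex => x; rewrite big_split/= -!big_mkcond.
rewrite (Ex_prod (fun k b => (if k \in A then yv k b else 1) *
   (if k \in B then yv k b else 1))).
have Ek k : \sum_b wt k b * ((if k \in A then yv k b else 1) *
   (if k \in B then yv k b else 1)) = ((k \in A) == (k \in B))%:R.
  case: (k \in A); case: (k \in B) => /=.
  - by under eq_bigr do rewrite -expr2; rewrite sum_wt_yv2.
  - by under eq_bigr do rewrite mulr1; rewrite sum_wt_yv.
  - by under eq_bigr do rewrite mul1r; rewrite sum_wt_yv.
  - by under eq_bigr do rewrite !mulr1; rewrite sum_wt.
under eq_bigr do rewrite Ek.
have [AB|/eqP AB] := eqVneq A B; first by rewrite big1// => k _; rewrite AB eqxx.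
rewrite ?mulr0n; apply/eqP; rewrite prodf_seq_eq0; apply/hasP.
have [k kAB] : exists k, (k \in A) != (k \in B).
  apply/existsP; rewrite -negb_forall; apply/negP => /forallP e.
  by apply: AB; apply/setP => k; exact/eqP.
by exists k; rewrite ?mem_index_enum//= (negPf kAB) eqxx.
Qed.

(** Expanding the product over [k] of [yv k (x k) * yv k (z k) + 1] gives the sum over subsets;
    [yv_complete] evaluates each factor. *)
Lemma chi_complete x z :
  \sum_A chi A x * chi A z = (x == z)%:R / \prod_k wt k (x k).
Proof.
transitivity (\prod_k (yv k (x k) * yv k (z k) + 1)).
  rewrite bigA_distr; apply: eq_bigr => A _; rewrite -big_mkcond/=.
  by rewrite big_split.
under eq_bigr do rewrite addrC yv_complete.
rewrite big_split/= prodfV; congr (_ * _).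
have [->|/eqP xz] := eqVneq x z; first by rewrite big1// => k _; rewrite eqxx.
rewrite ?mulr0n; apply/eqP; rewrite prodf_seq_eq0; apply/hasP.
have [k kxz] : exists k, x k != z k.
  apply/existsP; rewrite -negb_forall; apply/negP => /forallP e.
  by apply: xz; apply/ffunP => k; exact/eqP.
by exists k; rewrite ?mem_index_enum//= (negPf kxz) eqxx.
Qed.

Lemma wprod_neq0 x : \prod_k wt k (x k) != 0.
Proof. by rewrite gt_eqF//; apply: prodr_gt0 => k _; exact: wt_gt0. Qed.

Lemma chi_expansion F x : F x = \sum_A cf F A * chi A x.
Proof.
rewrite /cf; under eq_bigr do rewrite mulr_suml.
rewrite exchange_big (bigD1 x)//= [X in _ + X]big1 ?addr0.
  under eq_bigr do rewrite -!mulrA.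
  rewrite -!mulr_sumr chi_complete eqxx mul1r mulrCA.
  by rewrite divff ?mulr1// wprod_neq0.
move=> z /negPf zx; under eq_bigr do rewrite -!mulrA.
by rewrite -!mulr_sumr chi_complete zx mul0r !mulr0.
Qed.

Lemma parseval F G : Ex (fun x => F x * G x) = \sum_A cf F A * cf G A.
Proof.
under eq_Ex do rewrite (chi_expansion F) mulr_suml.
rewrite Ex_sum; apply: eq_bigr => A _; rewrite {2}/cf -ExZ.
by apply: eq_Ex => x; rewrite -mulrA [chi A x * _]mulrC.
Qed.

Lemma cf0 F : cf F finset.set0 = Ex F.
Proof. by apply: eq_Ex => x; rewrite chi0 mulr1. Qed.

(* [Lap] is minus the generator of the dynamics that resamples every coordinate
   at rate 1, and [Gam] is its carre du champ. *)
Definition Lap F x : R := \sum_k \sum_b wt k b * (F x - F (setc x k b)).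

Definition Gam F G x : R := 2^-1 *
  \sum_k \sum_b wt k b * ((F x - F (setc x k b)) * (G x - G (setc x k b))).

Lemma GamE F G x : Gam F G x =
  2^-1 * (F x * Lap G x + G x * Lap F x - Lap (fun x => F x * G x) x).
Proof.
rewrite /Gam /Lap; congr (_ * _).
rewrite !mulr_sumr -big_split -sumrB/=; apply: eq_bigr => k _.
rewrite !mulr_sumr -big_split -sumrB/=; apply: eq_bigr => b _; ring.
Qed.

(** In one of the two copies on the left, [x] and its resampled version exchange roles; the copies
    then add up to the product of increments. *)
Lemma Ex_Lap_exch F G : 2 * Ex (fun x => G x * Lap F x) =
  Ex (fun x => \sum_k \sum_b wt k b *
    ((F x - F (setc x k b)) * (G x - G (setc x k b)))).
Proof.
rewrite /Lap; under eq_Ex do rewrite mulr_sumr.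
rewrite !Ex_sum mulr_sumr; apply: eq_bigr => k _.
rewrite mulr2n mulrDl mul1r.
have E : Ex (fun x => G x * (\sum_b wt k b * (F x - F (setc x k b)))) =
         Ex (fun x => \sum_b wt k b * (G x * (F x - F (setc x k b)))).
  by apply: eq_Ex => x; rewrite mulr_sumr; apply: eq_bigr => b _; ring.
rewrite E {2}(Ex_exch k (fun x y => G x * (F x - F y))) -ExD.
apply: eq_Ex => x; rewrite -big_split; apply: eq_bigr => b _ /=; ring.
Qed.

Lemma Ex_Lap_sym F G : Ex (fun x => G x * Lap F x) = Ex (fun x => F x * Lap G x).
Proof.
apply: (mulfI (_ : 2%:R != 0)) => //; rewrite !Ex_Lap_exch.
by apply: eq_Ex => x; do 2!apply: eq_bigr => ? _; rewrite [X in _ * X]mulrC.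
Qed.

Lemma Ex_Gam F G : Ex (Gam F G) = Ex (fun x => G x * Lap F x).
Proof. by rewrite ExZ -Ex_Lap_exch mulrA mulVf ?mul1r. Qed.

Lemma Lap_chi A x : Lap (chi A) x = #|A|%:R * chi A x.
Proof.
have E k : \sum_b wt k b * (chi A x - chi A (setc x k b)) =
    if k \in A then chi A x else 0.
  under eq_bigr do rewrite mulrBr.
  rewrite sumrB -mulr_suml sum_wt mul1r resample_chi; case: ifP; by rewrite ?subr0 ?subrr.
by rewrite /Lap; under eq_bigr do rewrite E; rewrite -big_mkcond sumr_const/= mulr_natl.
Qed.

Lemma cf_Lap F A : cf (Lap F) A = #|A|%:R * cf F A.
Proof.
rewrite {1}/cf; under eq_Ex do rewrite mulrC.
rewrite Ex_Lap_sym /cf -ExZ; apply: eq_Ex => x.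
by rewrite Lap_chi mulrCA.
Qed.

Lemma eq_cf F G : cf F =1 cf G -> F =1 G.
Proof.
by move=> FG x; rewrite (chi_expansion F) (chi_expansion G); under eq_bigr do rewrite FG.
Qed.

Definition homog (q : nat) F := forall A, cf F A != 0 -> #|A| = q.

Lemma Lap_hom q F x : homog q F -> Lap F x = q%:R * F x.
Proof.
move=> Fq; apply: (eq_cf (F := Lap F) (G := fun x => q%:R * F x)) => A.
rewrite cf_Lap.
have -> : cf (fun x => q%:R * F x) A = q%:R * cf F A.
  by rewrite /cf -ExZ; apply: eq_Ex => y; rewrite mulrA.
have [->|/Fq ->//] := eqVneq (cf F A) 0; by rewrite !mulr0.
Qed.

End TwoPointSpace.

(** * Top-degree coefficients of products *)

Section SetKernels.
Context {R : realType} {I : finType}.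
Implicit Types (f g : {set I} -> R) (A B : {set I}).
Local Notation set0 := (@finset.set0 I).

Definition dotk f g : R := \sum_A f A * g A.

Definition supported q f := forall A, f A != 0 -> #|A| = q.

Definition infl_le f m := forall k, \sum_(A : {set I} | k \in A) f A ^+ 2 <= m.

(** The contraction-free part of a product: for homogeneous factors these are the coefficients of
    size [p + q], to which only disjoint splittings of [A] contribute ([cf_mul_top]). *)
Definition topcf f g A : R := \sum_(J : {set I} | J \subset A) f J * g (A :\: J).

Local Notation quad := ({set I} * {set I} * ({set I} * {set I}))%type.

Lemma topcf_sq f g : \sum_A topcf f g A ^+ 2 =
  \sum_(u : quad | [&& u.1.1 :&: u.1.2 == set0, u.2.1 :&: u.2.2 == set0 &
                      u.1.1 :|: u.1.2 == u.2.1 :|: u.2.2])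
     f u.1.1 * g u.1.2 * (f u.2.1 * g u.2.2).
Proof.
have E A : topcf f g A = \sum_(v : {set I} * {set I} |
   (v.1 :&: v.2 == set0) && (v.1 :|: v.2 == A)) f v.1 * g v.2.
  rewrite /topcf (reindex_onto (fun v : {set I} * {set I} => v.1)
     (fun J => (J, A :\: J)))//=.
  apply: eq_big => [[J K]|[J K] /andP[_ /eqP[<-]]//] /=.
  apply/andP/andP => -[].
    move=> JA /eqP[<-]; split; apply/eqP/setP => i; rewrite !inE.
      by case: (i \in J); rewrite ?andbF.
    by have := fintype.subsetP JA i; case: (i \in J) => //= ->.
  move=> /eqP/setP JK /eqP <-; split; first exact: finset.subsetUl.
  apply/eqP; congr (_, _); apply/setP => i; have := JK i; rewrite !inE.
  by case: (i \in J); case: (i \in K).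
under eq_bigr do rewrite E expr2 big_distrlr/=.
rewrite (partition_big (fun u : quad => u.1.1 :|: u.1.2) xpredT)//=.
apply: eq_bigr => A _; rewrite pair_big_dep/=; apply: eq_bigl => -[[J K] [J' K']] /=.
case: eqP => //= _; rewrite ?andbF//.
have [<-|] := eqVneq (J :|: K) A; rewrite ?andbT ?andbF// [_ == _ :|: _]eq_sym.
by rewrite andbCA.
Qed.

(* The overlap pattern of two splittings [J + K = J' + K'] is recorded by
   [a = J & J'], [b = J & K'], [c = K & J'], [e = K & K']. *)
Lemma topcf_sq_blocks f g : \sum_A topcf f g A ^+ 2 =
  \sum_(u : {set I} * {set I} | u.1 :&: u.2 == set0)
   \sum_(v : {set I} * {set I} |
     [&& v.1 :&: v.2 == set0, v.1 :&: (u.1 :|: u.2) == set0 &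
         v.2 :&: (u.1 :|: u.2) == set0])
     (f (u.1 :|: v.1) * g (v.1 :|: u.2)) * (f (u.1 :|: v.2) * g (v.2 :|: u.2)).
Proof.
rewrite topcf_sq pair_big_dep/=.
rewrite (reindex_onto
  (fun w : quad => ((w.1.1 :|: w.2.1, w.2.2 :|: w.1.2),
                    (w.1.1 :|: w.2.2, w.2.1 :|: w.1.2)))
  (fun u : quad => ((u.1.1 :&: u.2.1, u.1.2 :&: u.2.2),
                    (u.1.1 :&: u.2.2, u.1.2 :&: u.2.1))))/=; last first.
  move=> [[J K] [J' K']] /= /and3P[/eqP/setP JK /eqP/setP JK' /eqP/setP U].
  congr (_, _, (_, _)); apply/setP => i; have := JK i; have := JK' i; have := U i;
    rewrite !inE; by case: (i \in J); case: (i \in J'); case: (i \in K); case: (i \in K').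
apply: eq_big => [[[a e] [b c]]|[[a e] [b c]] _ /=]; last by ring.
apply/idP/idP => /=.
  move=> /andP[/and3P[/eqP/setP H1 /eqP/setP H2 /eqP/setP H3] /eqP[/setP E1 /setP E2 /setP E3 /setP E4]].
  apply/and4P; split; apply/eqP/setP => i; have := H1 i; have := H2 i; have := H3 i;
    have := E1 i; have := E2 i; have := E3 i; have := E4 i; rewrite !inE;
  by case: (i \in a); case: (i \in b); case: (i \in c); case: (i \in e).
move=> /and4P[/eqP/setP H1 /eqP/setP H2 /eqP/setP H3 /eqP/setP H4].
apply/andP; split; [apply/and3P; split; apply/eqP|apply/eqP; congr (_, _, (_, _))];
  apply/setP => i; have := H1 i; have := H2 i; have := H3 i;
    have := H4 i; rewrite !inE;
  by case: (i \in a); case: (i \in b); case: (i \in c); case: (i \in e).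
Qed.

(** The ordered splittings of [A] into disjoint parts number [2 ^ #|A|]; this is the source of the
    exponential factor in [ovl]. *)
Lemma sum_disjoint_union (h : {set I} -> R) :
  \sum_(v : {set I} * {set I} | v.1 :&: v.2 == set0) h (v.1 :|: v.2) =
  \sum_(A : {set I}) (2 ^ #|A|)%:R * h A.
Proof.
rewrite (partition_big (fun v : {set I} * {set I} => v.1 :|: v.2) xpredT)//=.
apply: eq_bigr => A _.
rewrite (eq_bigr (fun=> h A)); last by move=> v /andP[_ /eqP->].
rewrite (reindex_onto (fun J => (J, A :\: J)) (fun v : {set I} * {set I} => v.1))/=.
  rewrite (eq_bigl (fun J => J \in powerset A)).
    by rewrite sumr_const card_powerset mulr_natl.
  move=> J; rewrite powersetE eqxx andbT; apply/andP/idP.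
    by move=> [_ /eqP <-]; exact: finset.subsetUl.
  move=> /fintype.subsetP JA; split; apply/eqP/setP => i; rewrite !inE.
    by case: (i \in J).
  by have := JA i; case: (i \in J) => //= ->.
move=> [J K] /andP[/eqP/setP JK /eqP <-] /=; congr (_, _); apply/setP => i.
by have := JK i; rewrite !inE; case: (i \in J); case: (i \in K).
Qed.

(** If [K] meets [J], it contains one of the [p] points of [J], and each point carries influence at
    most [m] in [g]. *)
Lemma sum_overlap p f g m : supported p f -> infl_le g m ->
  \sum_(v : {set I} * {set I} | v.1 :&: v.2 != set0) f v.1 ^+ 2 * g v.2 ^+ 2
  <= p%:R * m * dotk f f.
Proof.
move=> fp gm.
have -> : \sum_(v : {set I} * {set I} | v.1 :&: v.2 != set0) f v.1 ^+ 2 * g v.2 ^+ 2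
   = \sum_J f J ^+ 2 * \sum_(K : {set I} | J :&: K != set0) g K ^+ 2.
  under [RHS]eq_bigr do rewrite mulr_sumr.
  by rewrite pair_big_dep/=.
rewrite /dotk mulr_sumr; apply: ler_sum => J _; rewrite -expr2 [leRHS]mulrC.
have [->|/fp Jp] := eqVneq (f J) 0; first by rewrite expr0n/= !mul0r.
rewrite ler_wpM2l ?sqr_ge0//.
have le1 : \sum_(K : {set I} | J :&: K != set0) g K ^+ 2 <=
    \sum_(k in J) \sum_(K : {set I} | k \in K) g K ^+ 2.
  rewrite (exchange_big_dep xpredT)//= [leLHS]big_mkcond/=.
  apply: ler_sum => K _; case: ifPn => [/finset.set0Pn[k]|_]; last first.
    by apply: sumr_ge0 => *; exact: sqr_ge0.
  rewrite inE => kJK; rewrite (bigD1 k)//= lerDl.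
  by apply: sumr_ge0 => *; exact: sqr_ge0.
apply: le_trans le1 _; rewrite -Jp mulr_natl -sumr_const.
by apply: ler_sum => k _; exact: gm.
Qed.

Lemma subset_set0U A B : #|A :|: B| = #|A| -> A :&: B = set0 -> B = set0.
Proof.
move=> AB AB0; apply/eqP; rewrite -cards_eq0.
by have := cardsUI A B; rewrite AB0 cards0 addn0 AB -[LHS]addn0 => /addnI ->.
Qed.

(** With the blocks of [topcf_sq_blocks], letting [b] and [c] overlap turns the sum for fixed
    [(a, e)] into a square. The pair [(set0, set0)] yields [dotk f g ^+ 2]; the other pairs yield
    the product of the norms, up to sets [a] and [e] that meet. The overlapping [b] and [c] that
    were added form [err]. Both losses are bounded through [sum_overlap]. *)
Lemma topcf_lower p q f g m : (0 < p)%N -> supported p f -> supported q g ->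
  infl_le g m ->
  dotk f f * dotk g g + dotk f g ^+ 2 -
    (1 + 2 ^+ (p + q)) * p%:R * m * dotk f f <= \sum_A topcf f g A ^+ 2.
Proof.
move=> p0 fp gq gm; rewrite topcf_sq_blocks.
pose u (a e b : {set I}) : R := if b :&: (a :|: e) == set0 then
  f (a :|: b) * g (b :|: e) else 0.
pose err := \sum_(w : {set I} * {set I} | w.1 :&: w.2 == set0)
   \sum_(v : {set I} * {set I} | v.1 :&: v.2 != set0)
      u w.1 w.2 v.1 * u w.1 w.2 v.2.
have split_sq (w : {set I} * {set I}) : \sum_(v : {set I} * {set I} |
     [&& v.1 :&: v.2 == set0, v.1 :&: (w.1 :|: w.2) == set0 &
         v.2 :&: (w.1 :|: w.2) == set0])
     (f (w.1 :|: v.1) * g (v.1 :|: w.2)) * (f (w.1 :|: v.2) * g (v.2 :|: w.2))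
  = (\sum_b u w.1 w.2 b) ^+ 2 - \sum_(v : {set I} * {set I} | v.1 :&: v.2 != set0)
      u w.1 w.2 v.1 * u w.1 w.2 v.2.
  rewrite expr2 big_distrlr/= pair_bigA/=.
  rewrite [X in X - _](bigID (fun v : {set I} * {set I} => v.1 :&: v.2 == set0))/= addrK.
  rewrite (eq_bigl (fun v : {set I} * {set I} => (v.1 :&: v.2 == set0) &&
    ((v.1 :&: (w.1 :|: w.2) == set0) && (v.2 :&: (w.1 :|: w.2) == set0))))//.
  rewrite big_mkcondr/=; apply: eq_bigr => v _; rewrite /u.
  by case: eqP; case: eqP => //=; rewrite ?mul0r ?mulr0.
under eq_bigr do rewrite split_sq.
rewrite sumrB -/err.
have main : dotk f f * dotk g g + dotk f g ^+ 2 - p%:R * m * dotk f f <=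
   \sum_(w : {set I} * {set I} | w.1 :&: w.2 == set0) (\sum_b u w.1 w.2 b) ^+ 2.
  rewrite (bigD1 (set0, set0))/= ?finset.setI0//.
  have -> : \sum_b u set0 set0 b = dotk f g.
    by apply: eq_bigr => b _; rewrite /u !finset.set0U !finset.setU0 finset.setI0 eqxx.
  rewrite addrAC [leRHS]addrC lerD2r lerBlDr.
  have -> : dotk f f * dotk g g = \sum_(w : {set I} * {set I}) f w.1 ^+ 2 * g w.2 ^+ 2.
    rewrite /dotk big_distrlr/= pair_bigA/=; apply: eq_bigr => w _; ring.
  rewrite (bigID (fun w : {set I} * {set I} => w.1 :&: w.2 == set0))/=.
  apply: lerD; last exact: sum_overlap.
  rewrite [leRHS]big_mkcondr/=; apply: ler_sum => -[a e] /= /eqP ae.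
  have [->|fa] := eqVneq (f a) 0.
    by rewrite expr0n/= mul0r; case: ifP => // _; exact: sqr_ge0.
  have -> : ((a, e) != (set0, set0)).
    apply/negP => /eqP[a0 _]; have := fp _ fa.
    by rewrite a0 cards0 => p00; rewrite -p00 in p0.
  (* When [f a != 0], a nonempty [b] disjoint from [a] makes [a :|: b] too large for the support of
     [f], so the square reduces to its term [b = set0]. *)
  rewrite (bigD1 set0)//= big1 ?addr0.
    by rewrite /u finset.set0I eqxx finset.setU0 finset.set0U exprMn.
  move=> b b0; rewrite /u; case: ifPn => // /eqP bae.
  have [->|fab] := eqVneq (f (a :|: b)) 0; first by rewrite mul0r.
  case/eqP: b0; apply: (@subset_set0U a); first by rewrite (fp _ fab) (fp _ fa).
  apply/setP => i; have := bae => /setP/(_ i); rewrite !inE.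
  by case: (i \in a); case: (i \in b).
have errb : err <= 2 ^+ (p + q) * p%:R * m * dotk f f.
  pose D (a e b c : {set I}) := [&& a :&: b == set0, c :&: e == set0 & b :&: c != set0].
  pose h (a e b c : {set I}) : R := if D a e b c then f (a :|: b) ^+ 2 * g (c :|: e) ^+ 2 else 0.
  have h0 a e b c : 0 <= h a e b c.
    by rewrite /h; case: ifP => // _; rewrite mulr_ge0// sqr_ge0.
  have step1 : err <= \sum_(w : {set I} * {set I}) \sum_(v : {set I} * {set I})
      2^-1 * (h w.1 w.2 v.1 v.2 + h w.1 w.2 v.2 v.1).
    rewrite /err big_mkcond/=; apply: ler_sum => -[a e] _ /=; case: ifPn => ae; last first.
      by apply: sumr_ge0 => v _; rewrite mulr_ge0// addr_ge0.
    rewrite big_mkcond/=; apply: ler_sum => -[b c] _ /=; case: ifPn => bc; last first.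
      by rewrite mulr_ge0// addr_ge0.
    rewrite /u; case: eqP => [/setP bae|_]; last by rewrite mul0r mulr_ge0// addr_ge0.
    case: eqP => [/setP cae|_]; last by rewrite mulr0 mulr_ge0// addr_ge0.
    rewrite /h /D bc (finset.setIC c b) bc !andbT.
    have -> : a :&: b == set0 by apply/eqP/setP => i; have := bae i; rewrite !inE;
      case: (i \in a); case: (i \in b).
    have -> : c :&: e == set0 by apply/eqP/setP => i; have := cae i; rewrite !inE;
      case: (i \in e); case: (i \in c); rewrite ?orbT.
    have -> : a :&: c == set0 by apply/eqP/setP => i; have := cae i; rewrite !inE;
      case: (i \in a); case: (i \in c).
    have -> /= : b :&: e == set0 by apply/eqP/setP => i; have := bae i; rewrite !inE;
      case: (i \in e); case: (i \in b); rewrite ?orbT.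
    rewrite -!exprMn.
    (* Crosswise pairing of the four factors: as [b] meets [c], the two sets in [x] meet, and so do
       those in [y], as [sum_overlap] requires. *)
    pose x := f (a :|: b) * g (c :|: e); pose y := f (a :|: c) * g (b :|: e).
    have xy := sqr_ge0 (x - y); rewrite sqrrB in xy.
    have -> : f (a :|: b) * g (b :|: e) * (f (a :|: c) * g (c :|: e)) = x * y.
      by rewrite /x /y mulrACA [X in _ * X]mulrC [RHS]mulrACA.
    rewrite -/x -/y.
    lra.
  apply: le_trans step1 _.
  have -> : \sum_(w : {set I} * {set I}) \sum_(v : {set I} * {set I})
      2^-1 * (h w.1 w.2 v.1 v.2 + h w.1 w.2 v.2 v.1) =
      \sum_(w : {set I} * {set I}) \sum_(v : {set I} * {set I}) h w.1 w.2 v.1 v.2.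
    apply: eq_bigr => w _; rewrite -mulr_sumr big_split/=.
    have -> : \sum_(v : {set I} * {set I}) h w.1 w.2 v.2 v.1 =
        \sum_(v : {set I} * {set I}) h w.1 w.2 v.1 v.2.
      rewrite -(pair_bigA _ (fun b c => h w.1 w.2 c b)) exchange_big.
      by rewrite (pair_bigA _ (fun b c => h w.1 w.2 b c)).
    lra.
  pose H (J K : {set I}) : R := if J :&: K != set0 then f J ^+ 2 * g K ^+ 2 else 0.
  have H0 J K : 0 <= H J K by rewrite /H; case: ifP => // _; rewrite mulr_ge0// sqr_ge0.
  (* The term [h] depends on the blocks only through [a :|: b] and [c :|: e]; the sum is relaxed to
     all disjoint splittings of two sets that meet. *)
  have step2 : \sum_(w : {set I} * {set I}) \sum_(v : {set I} * {set I}) h w.1 w.2 v.1 v.2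
    <= \sum_(v : {set I} * {set I} | v.1 :&: v.2 == set0)
        \sum_(w : {set I} * {set I} | w.1 :&: w.2 == set0) H (v.1 :|: v.2) (w.1 :|: w.2).
    rewrite pair_bigA/= [leRHS]pair_big/= [leRHS]big_mkcond/=.
    rewrite (reindex_inj (h := fun u : quad => ((u.1.1, u.2.2), (u.1.2, u.2.1))))/=; last first.
      by move=> [[? ?] [? ?]] [[? ?] [? ?]] /= [-> -> -> ->].
    apply: ler_sum => -[[a b] [c e]] _ /=; rewrite /h /D.
    case: ifPn => [/and3P[-> -> /finset.set0Pn[i]]|_]; last by case: ifP.
    rewrite !inE => /andP[ib ic]; rewrite /H ifT//; apply/finset.set0Pn; exists i.
    by rewrite !inE ib ic orbT.
  apply: le_trans step2 _.
  under eq_bigr do rewrite (sum_disjoint_union (H _)).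
  rewrite (sum_disjoint_union (fun J => \sum_(K : {set I}) (2 ^ #|K|)%:R * H J K)).
  have -> : 2 ^+ (p + q) * p%:R * m * dotk f f = 2 ^+ (p + q) * (p%:R * m * dotk f f) by rewrite !mulrA.
  apply: le_trans (ler_wpM2l _ (sum_overlap fp gm)); last by rewrite exprn_ge0.
  rewrite [leRHS]mulr_sumr [leRHS]big_mkcond/= -(pair_bigA _ (fun J K : {set I} =>
     if J :&: K != set0 then 2 ^+ (p + q) * (f J ^+ 2 * g K ^+ 2) else 0))/=.
  apply: ler_sum => J _; rewrite mulr_sumr; apply: ler_sum => K _; rewrite /H.
  case: ifP => [_|_]; last by rewrite !mulr0.
  have [->|/fp ->] := eqVneq (f J) 0; first by rewrite expr0n/= !mul0r !mulr0.
  have [->|/gq ->] := eqVneq (g K) 0; first by rewrite expr0n/= !mulr0.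
  by rewrite exprD !natrX !mulrA.
lra.
Qed.

End SetKernels.

(** * Walsh levels of products and fourth moments *)

Section FourthMoments.
Context {R : realType} {I : finType}.
Variable pr : I -> R.
Hypothesis pr01 : forall k, 0 < pr k < 1.

Local Notation cube := {ffun I -> bool}.
Local Notation Ex := (Ex pr).
Local Notation cf := (cf pr).
Local Notation chi := (chi pr).
Local Notation wt := (wt pr).
Local Notation homog := (homog pr).
Local Notation Lap := (Lap pr).
Local Notation Gam := (Gam pr).
Local Notation set0 := (@finset.set0 I).
Implicit Types (F G H : cube -> R) (A B : {set I}) (x : cube) (k : I).

Lemma dotk_cf F G : dotk (cf F) (cf G) = Ex (fun x => F x * G x).
Proof. by rewrite (parseval pr01). Qed.

Lemma Ex_sqr F : Ex (fun x => F x ^+ 2) = \sum_A cf F A ^+ 2.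
Proof.
under eq_Ex do rewrite expr2.
by rewrite (parseval pr01); apply: eq_bigr => A _; rewrite expr2.
Qed.

(** Either [A] has an index outside [J :|: K], whose average vanishes, or the cardinalities force
    [A] to be the disjoint union of [J] and [K], and the integrand is the square of [chi A]. *)
Lemma Ex_chi3 (J K A : {set I}) : (#|J| + #|K| <= #|A|)%N ->
  Ex (fun x => chi J x * chi K x * chi A x) =
  ((J \subset A) && (K == A :\: J))%:R.
Proof.
move=> le; have [AJK|] := boolP (A \subset J :|: K); last first.
  case/subsetPn => k kA; rewrite inE negb_or => /andP[kJ kK].
  rewrite (Ex_chi_indep pr01 kA) => [|x b]; last first.
    by rewrite !chi_setc_notin.
  case: andP => // -[JA /eqP KA]; by rewrite KA !inE kA andbT kJ in kK.
have leU : (#|J :|: K| <= #|J| + #|K|)%N by rewrite leq_card_setU.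
have AE : A = J :|: K.
  by apply/eqP; rewrite eqEcard AJK /= (leq_trans leU le).
have JK0 : J :&: K = set0.
  apply/eqP; rewrite -cards_eq0 -leqn0 -(leq_add2l #|J :|: K|) cardsUI addn0.
  by rewrite (leq_trans le)// AE.
have -> : K == A :\: J.
  apply/eqP/setP => i; have := JK0 => /setP/(_ i); rewrite AE !inE.
  by case: (i \in J); case: (i \in K).
have -> : J \subset A by rewrite AE finset.subsetUl.
transitivity (Ex (fun x => chi A x * chi A x)).
  apply: eq_Ex => x; congr (_ * _); rewrite AE /chi [RHS]big_mkcond/=.
  rewrite big_mkcond [X in _ * X]big_mkcond -big_split; apply: eq_bigr => i _ /=.
  have := JK0 => /setP/(_ i); rewrite !inE.
  by case: (i \in J); case: (i \in K); rewrite //= ?mulr1 ?mul1r.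
by rewrite (Ex_chi2 pr01) eqxx.
Qed.

Lemma cf_mul_top p q F G A : homog p F -> homog q G -> (p + q <= #|A|)%N ->
  cf (fun x => F x * G x) A = topcf (cf F) (cf G) A.
Proof.
move=> Fp Gq leA.
transitivity (\sum_J \sum_K cf F J * cf G K *
    Ex (fun x => chi J x * chi K x * chi A x)).
  transitivity (Ex (fun x => \sum_J \sum_K cf F J * cf G K *
      (chi J x * chi K x * chi A x))).
    apply: eq_Ex => x; rewrite {1}(chi_expansion pr01 F) {1}(chi_expansion pr01 G).
    rewrite big_distrlr/= mulr_suml; apply: eq_bigr => J _.
    by rewrite mulr_suml; apply: eq_bigr => K _; ring.
  rewrite Ex_sum; apply: eq_bigr => J _; rewrite Ex_sum; apply: eq_bigr => K _.
  by rewrite ExZ.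
rewrite /topcf [RHS]big_mkcond/=; apply: eq_bigr => J _.
transitivity (\sum_K cf F J * cf G K * ((J \subset A) && (K == A :\: J))%:R).
  apply: eq_bigr => K _.
  have [->|/Fp Jp] := eqVneq (cf F J) 0; first by rewrite !mul0r.
  have [->|/Gq Kq] := eqVneq (cf G K) 0; first by rewrite !(mul0r, mulr0).
  by rewrite Ex_chi3// Jp Kq.
case: ifP => JA /=; last by rewrite big1// => K _; rewrite mulr0.
rewrite (bigD1 (A :\: J))//= eqxx mulr1 big1 ?addr0// => K /negPf ->.
by rewrite mulr0.
Qed.

Lemma topcf_supported p q f g : supported p f -> supported q g ->
  supported (p + q) (topcf f g : {set I} -> R).
Proof.
move=> fp gq A nz; apply/eqP; apply: contraNT nz => Apq.
rewrite /topcf big1// => J JA.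
have [->|/fp Jp] := eqVneq (f J) 0; first by rewrite mul0r.
have [->|/gq Kq] := eqVneq (g (A :\: J)) 0; first by rewrite mulr0.
case/eqP: Apq; have := cardsID J A; rewrite Kq.
by have /finset.setIidPr -> := JA; rewrite Jp => <-.
Qed.

Lemma cf_mul_out p q F G A : homog p F -> homog q G -> (p + q < #|A|)%N ->
  cf (fun x => F x * G x) A = 0.
Proof.
move=> Fp Gq ltA; rewrite (cf_mul_top Fp Gq (ltnW ltA)).
apply/eqP/negP => /negP /(topcf_supported Fp Gq) AE.
by rewrite AE ltnn in ltA.
Qed.

Definition lowcf n F : R := \sum_(A : {set I} | (0 < #|A| < n)%N) cf F A ^+ 2.

Lemma lowcf_ge0 n F : 0 <= lowcf n F.
Proof. by apply: sumr_ge0 => A _; exact: sqr_ge0. Qed.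

Lemma Ex_mul_sqr p q F G : (0 < p + q)%N -> homog p F -> homog q G ->
  Ex (fun x => (F x * G x) ^+ 2) = Ex (fun x => F x * G x) ^+ 2 +
    lowcf (p + q) (fun x => F x * G x) + \sum_A topcf (cf F) (cf G) A ^+ 2.
Proof.
move=> pq0 Fp Gq; set H := fun x => F x * G x.
rewrite (Ex_sqr H) (bigD1 set0)//= cf0 -addrA; congr (_ + _).
rewrite (bigID (fun A : {set I} => (#|A| < p + q)%N))/=; congr (_ + _).
  by apply: eq_bigl => A; rewrite card_gt0.
rewrite [RHS](bigID (fun A : {set I} => (A != set0) && ~~ (#|A| < p + q)%N))/=.
rewrite [X in _ = _ + X]big1 ?addr0.
  by apply: eq_bigr => A /andP[_]; rewrite -leqNgt => /(cf_mul_top Fp Gq) ->.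
move=> A; rewrite negb_and !negbK => AE.
have [->|/(topcf_supported Fp Gq) AC] := eqVneq (topcf (cf F) (cf G) A) 0.
  by rewrite expr0n.
move: AE; rewrite AC ltnn orbF => /eqP A0.
by rewrite -AC A0 cards0 in pq0.
Qed.

(** In [topcf_lower], the summand 1 pays for intersecting sets in the product of norms, and
    [2 ^+ (p + q)] for the splittings counted in [err]. *)
Definition ovl (p q : nat) : R := (1 + 2 ^+ (p + q)) * p%:R.

(** Parseval splits the second moment of the product into level 0, the low levels and the top level,
    and [topcf_lower] bounds the last from below. For [F = G] the right side is the fourth cumulant
    of [F] plus the overlap error. *)
Lemma lowcf_le p q F G m : (0 < p)%N -> homog p F -> homog q G ->
  infl_le (cf G) m ->
  lowcf (p + q) (fun x => F x * G x) <= Ex (fun x => (F x * G x) ^+ 2) -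
    Ex (fun x => F x ^+ 2) * Ex (fun x => G x ^+ 2)
    - 2 * Ex (fun x => F x * G x) ^+ 2 + ovl p q * m * Ex (fun x => F x ^+ 2).
Proof.
move=> p0 Fp Gq Gm; rewrite (Ex_mul_sqr _ Fp Gq) ?addn_gt0 ?p0//.
have := topcf_lower p0 Fp Gq Gm; rewrite !dotk_cf.
have E2 H : Ex (fun x => H x * H x) = Ex (fun x => H x ^+ 2).
  by apply: eq_Ex => x; rewrite expr2.
rewrite !E2 -/(ovl p q); lra.
Qed.

Lemma Ex_diff4 F : Ex (fun x => \sum_k \sum_b wt k b * (F x - F (setc x k b)) ^+ 4) =
  8 * Ex (fun x => F x ^+ 3 * Lap F x) -
  6 * Ex (fun x => F x ^+ 2 * Lap (fun x => F x ^+ 2) x).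
Proof.
rewrite /Lap -ExZ -ExZ -ExB.
transitivity (Ex (fun x => \sum_k (8 * (F x ^+ 3 * (\sum_b wt k b * (F x - F (setc x k b)))) -
   6 * (F x ^+ 2 * (\sum_b wt k b * (F x ^+ 2 - F (setc x k b) ^+ 2)))))); last first.
  by apply: eq_Ex => x; rewrite !mulr_sumr -sumrB.
rewrite !Ex_sum; apply: eq_bigr => k _.
(* With [a = F x] and [b = F y], [(a - b)^4 = 4 (a^3 - b^3)(a - b) - 3 (a^2 - b^2)^2] equals
   [h x y + h y x], and the two terms have the same average by exchangeability. *)
pose h (x y : cube) := 4 * (F x ^+ 3 * (F x - F y)) - 3 * (F x ^+ 2 * (F x ^+ 2 - F y ^+ 2)).
have := Ex_exch pr k h => /(congr1 (fun z => Ex (fun x => \sum_b wt k b * h x (setc x k b)) + z)).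
rewrite -!ExD => H.
transitivity (Ex (fun x => \sum_b wt k b * h x (setc x k b) +
                           \sum_b wt k b * h (setc x k b) x)).
  apply: eq_Ex => x; rewrite -big_split; apply: eq_bigr => b _ /=.
  by rewrite /h; ring.
rewrite -H; apply: eq_Ex => x; rewrite !mulr_sumr -sumrB -big_split.
by apply: eq_bigr => b _ /=; rewrite /h; ring.
Qed.

(** The weight [2 q - #|A|] is zero at the top level of [F^2], so the weighted energy [D] involves
    only the mean and the low levels; the mean contributes the Gaussian value in the fourth
    cumulant. *)
Lemma Ex_diff4_le q F : (0 < q)%N -> homog q F ->
  Ex (fun x => \sum_k \sum_b wt k b * (F x - F (setc x k b)) ^+ 4) <=
  q%:R * (12 * lowcf (q + q) (fun x => F x ^+ 2) -
          4 * (Ex (fun x => F x ^+ 4) - 3 * Ex (fun x => F x ^+ 2) ^+ 2)).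
Proof.
move=> q0 Fq; rewrite Ex_diff4.
have -> : Ex (fun x => F x ^+ 3 * Lap F x) = q%:R * Ex (fun x => F x ^+ 4).
  by rewrite -ExZ; apply: eq_Ex => x; rewrite (Lap_hom pr01 _ Fq); ring.
set F2 := fun x => F x ^+ 2.
have E4 : Ex (fun x => F x ^+ 4) = \sum_A cf F2 A ^+ 2.
  by rewrite -Ex_sqr; apply: eq_Ex => x; rewrite /F2 -exprM.
have -> : Ex (fun x => F x ^+ 2 * Lap F2 x) = \sum_(A : {set I}) #|A|%:R * cf F2 A ^+ 2.
  rewrite (parseval pr01); apply: eq_bigr => A _; rewrite (cf_Lap pr01) /F2; ring.
have cfout A : (q + q < #|A|)%N -> cf F2 A = 0.
  move=> qA; rewrite -(cf_mul_out Fq Fq qA); apply: eq_Ex => x; by rewrite /F2 expr2.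
pose D := \sum_(A : {set I}) (2 * q%:R - #|A|%:R) * cf F2 A ^+ 2.
pose N := \sum_(A : {set I}) #|A|%:R * cf F2 A ^+ 2.
have key : D <=
    2 * q%:R * (Ex F2 ^+ 2 + lowcf (q + q) F2).
  rewrite /D (bigD1 set0)//= cards0 subr0 cf0 mulrDr lerD2l.
  rewrite (bigID (fun A : {set I} => (#|A| < q + q)%N))/= [X in _ + X]big1 ?addr0.
    rewrite /lowcf mulr_sumr (eq_bigl (fun A : {set I} => (0 < #|A| < q + q)%N)).
      by apply: ler_sum => A _; rewrite ler_wpM2r ?sqr_ge0// gerBl.
    by move=> A; rewrite card_gt0.
  move=> A /andP[_]; rewrite -leqNgt leq_eqVlt => /orP[/eqP <-|/cfout ->].
    by rewrite natrD; ring.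
  by rewrite expr0n mulr0.
have DE : D = 2 * q%:R * Ex (fun x => F x ^+ 4) - N.
  by rewrite E4 /D mulr_sumr -sumrB; apply: eq_bigr => A _; rewrite mulrBl.
rewrite -/N; move: (D) (N) key DE => {}D {}N; lra.
Qed.

Lemma Ex_Gam_hom p q F G : homog p F -> homog q G ->
  Ex (Gam F G) = p%:R * Ex (fun x => F x * G x).
Proof.
move=> Fp Gq; rewrite Ex_Gam -ExZ; apply: eq_Ex => x.
by rewrite (Lap_hom pr01 _ Fp); ring.
Qed.

(** By [GamE], passing from [F G] to [Gam F G] multiplies each level by a factor that vanishes at
    the top level [p + q], so fluctuations of [Gam F G] come from the low levels only. *)
Lemma cf_Gam p q F G A : homog p F -> homog q G ->
  cf (Gam F G) A = 2^-1 * ((p + q)%:R - #|A|%:R) * cf (fun x => F x * G x) A.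
Proof.
move=> Fp Gq; set H := fun x => F x * G x.
transitivity (Ex (fun x => 2^-1 * (p + q)%:R * (H x * chi A x) - 2^-1 * (Lap H x * chi A x))).
  apply: eq_Ex => x; rewrite GamE (Lap_hom pr01 _ Fp) (Lap_hom pr01 _ Gq) natrD /H; ring.
by rewrite ExB !ExZ -/(cf H A) -/(cf (Lap H) A) (cf_Lap pr01); ring.
Qed.

Lemma Ex_dev_sqr F : Ex (fun x => (F x - Ex F) ^+ 2) =
  \sum_(A : {set I} | A != set0) cf F A ^+ 2.
Proof.
have := Ex_sqr F; rewrite (bigD1 set0)//= cf0 => E2.
have -> : Ex (fun x => (F x - Ex F) ^+ 2) =
    Ex (fun x => F x ^+ 2 + (- (2 * Ex F) * F x + Ex F ^+ 2)).
  by apply: eq_Ex => x; ring.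
rewrite !ExD ExZ Ex_cst E2; ring.
Qed.

Lemma var_Gam_le p q Q F G : homog p F -> homog q G -> (p <= Q)%N -> (q <= Q)%N ->
  Ex (fun x => (Gam F G x - Ex (Gam F G)) ^+ 2) <=
  Q%:R ^+ 2 * lowcf (p + q) (fun x => F x * G x).
Proof.
move=> Fp Gq pQ qQ; rewrite Ex_dev_sqr /lowcf mulr_sumr.
rewrite (bigID (fun A : {set I} => (#|A| < p + q)%N))/= [X in _ + X]big1 ?addr0.
  rewrite (eq_bigl (fun A : {set I} => (0 < #|A| < p + q)%N)).
    apply: ler_sum => A /andP[_ Apq]; rewrite (cf_Gam _ Fp Gq) exprMn.
    rewrite ler_wpM2r ?sqr_ge0// lerXn2r ?nnegrE ?ler0n//.
      by rewrite mulr_ge0// subr_ge0 ler_nat ltnW.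
    have : (p + q)%:R <= Q%:R + Q%:R :> R by rewrite -natrD ler_nat leq_add.
    have := ler0n R #|A|; lra.
  by move=> A; rewrite card_gt0.
move=> A /andP[_]; rewrite -leqNgt (cf_Gam _ Fp Gq) leq_eqVlt => /orP[/eqP <-|].
  by rewrite subrr mulr0 mul0r expr0n.
by move=> /(cf_mul_out Fp Gq) ->; rewrite mulr0 expr0n.
Qed.

End FourthMoments.

(** * Products controlled by the fourth moments of their factors *)

Section MixedMoments.
Context {R : realType} {I : finType}.
Variable pr : I -> R.
Hypothesis pr01 : forall k, 0 < pr k < 1.

Local Notation cube := {ffun I -> bool}.
Local Notation Ex := (Ex pr).
Local Notation cf := (cf pr).
Local Notation wt := (wt pr).
Local Notation homog := (homog pr).
Local Notation Gam := (Gam pr).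
Local Notation lowcf := (lowcf pr).
Local Notation set0 := (@finset.set0 I).
Implicit Types (F G H : cube -> R) (A B : {set I}) (x : cube) (k : I).

Variables (Q : nat) (S eta : R).
Hypotheses (S0 : 0 <= S) (eta0 : 0 < eta) (eta1 : eta <= 1).

Local Notation o := (ovl Q Q : R).

(** The tolerance is [eta ^+ 4] because two square roots are lost later: low levels of mixed
    products are of order [eta ^+ 2], and mean deviations of [Gam] of order [eta]. *)
Definition fourth_moment_close q F := [/\ (0 < q <= Q)%N, homog q F,
  Ex (fun x => F x ^+ 2) <= S,
  Ex (fun x => F x ^+ 4) <= 3 * Ex (fun x => F x ^+ 2) ^+ 2 + eta ^+ 4 &
  infl_le (cf F) (eta ^+ 4)].

Lemma ovl_ge0 p q : 0 <= ovl p q :> R.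
Proof. by rewrite mulr_ge0// addr_ge0// exprn_ge0. Qed.

Lemma ovl_le p q : (p <= Q)%N -> (q <= Q)%N -> ovl p q <= o.
Proof.
move=> pQ qQ; apply: ler_pM; rewrite ?ler_nat ?addr_ge0 ?exprn_ge0//.
by rewrite lerD2l ler_eXn2l ?leq_add// ltr1n.
Qed.

Let e4 : 0 <= eta ^+ 4. Proof. by rewrite exprn_ge0// ltW. Qed.
Let e2 : 0 <= eta ^+ 2. Proof. by rewrite exprn_ge0// ltW. Qed.
Let oS : 0 <= o * S. Proof. by rewrite mulr_ge0// ovl_ge0. Qed.
Let e42 : eta ^+ 4 <= eta ^+ 2.
Proof. by rewrite ler_wiXn2l// ltW. Qed.

Lemma Ex_sqr_ge0 F : 0 <= Ex (fun x => F x ^+ 2).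
Proof. by apply: (Ex_ge0 pr01) => x; exact: sqr_ge0. Qed.

Lemma ovl_err p q m F : (p <= Q)%N -> (q <= Q)%N -> 0 <= m ->
  Ex (fun x => F x ^+ 2) <= S ->
  ovl p q * m * Ex (fun x => F x ^+ 2) <= o * S * m.
Proof.
move=> pQ qQ m0 FS; have := Ex_sqr_ge0 F => F0.
have -> : o * S * m = o * m * S by ring.
by apply: ler_pM; rewrite ?mulr_ge0 ?ovl_ge0// ler_wpM2r// ovl_le.
Qed.

Lemma mul_self F : (fun x => F x * F x) = (fun x => F x ^+ 2).
Proof. by apply/funext => x; rewrite expr2. Qed.

Lemma sqr_sqr F : (fun x => (F x ^+ 2) ^+ 2) = (fun x => F x ^+ 4).
Proof. by apply/funext => x; rewrite -exprM. Qed.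

Lemma lowcf_sqr_le q F : fourth_moment_close q F ->
  lowcf (q + q) (fun x => F x ^+ 2) <=
  Ex (fun x => F x ^+ 4) - 3 * Ex (fun x => F x ^+ 2) ^+ 2 + o * S * eta ^+ 4.
Proof.
move=> [/andP[q0 qQ] Fq FS F4 Fm].
have := lowcf_le pr01 q0 Fq Fq Fm.
rewrite mul_self sqr_sqr; have := ovl_err qQ qQ e4 FS; lra.
Qed.

Lemma lowcf_sqr_small q F : fourth_moment_close q F ->
  lowcf (q + q) (fun x => F x ^+ 2) <= (1 + o * S) * eta ^+ 4.
Proof. by move=> Fc; have := lowcf_sqr_le Fc; case: Fc => _ _ _ ? _; lra. Qed.

(** Of the bracket, [12 * (1 + o * S)] bounds the low levels of [F^2]. The other [4 * (o * S)] comes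
    from the lower bound [- o * S * eta ^+ 4] on the fourth cumulant, implied by [lowcf_sqr_le]
    since [lowcf] is nonnegative. *)
Definition K2 : R := Q%:R * (12 + 16 * (o * S)).

Lemma diff4_small q F : fourth_moment_close q F ->
  Ex (fun x => \sum_k \sum_b wt k b * (F x - F (setc x k b)) ^+ 4) <=
  K2 * eta ^+ 4.
Proof.
move=> Fc; have [/andP[q0 qQ] Fq FS F4 Fm] := Fc.
apply: le_trans (Ex_diff4_le pr01 q0 Fq) _.
have := lowcf_sqr_small Fc; have := lowcf_sqr_le Fc.
have := lowcf_ge0 pr (q + q) (fun x => F x ^+ 2).
rewrite /K2 -mulrA; set l := lowcf _ _; set a := Ex _; set b := Ex _.
move=> l0 l1 l2; have qQ' : q%:R <= Q%:R :> R by rewrite ler_nat.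
apply: (@le_trans _ _ (q%:R * ((12 + 16 * (o * S)) * eta ^+ 4))).
  by rewrite ler_wpM2l//; lra.
have w0 := oS; rewrite -[leRHS]mulrA ler_wpM2r// mulr_ge0//; lra.
Qed.

Lemma Ex_homog_orth p q F G : homog p F -> homog q G -> p != q ->
  Ex (fun x => F x * G x) = 0.
Proof.
move=> Fp Gq pq; rewrite (parseval pr01) big1// => A _.
have [->|/Fp Ap] := eqVneq (cf F A) 0; first by rewrite mul0r.
have [->|/Gq Aq] := eqVneq (cf G A) 0; first by rewrite mulr0.
by rewrite -Ap -Aq eqxx in pq.
Qed.

(** Parseval for [F^2] against [G^2]: level 0 gives the product of second moments. As [F^2] lives on
    levels at most [2 p < 2 q], the rest involves only the low levels of [G^2], and Young's
    inequality with weight [eta ^+ 2] separates the factors. *)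
Lemma mixed_lt p q F G : (p < q)%N -> homog p F -> homog q G ->
  Ex (fun x => (F x * G x) ^+ 2) <=
  Ex (fun x => F x ^+ 2) * Ex (fun x => G x ^+ 2) +
  2^-1 * (eta ^+ 2 * Ex (fun x => F x ^+ 4) +
          lowcf (q + q) (fun x => G x ^+ 2) / eta ^+ 2).
Proof.
move=> pq Fp Gq.
have -> : Ex (fun x => (F x * G x) ^+ 2) = Ex (fun x => F x ^+ 2 * G x ^+ 2).
  by apply: eq_Ex => x; rewrite exprMn.
rewrite (parseval pr01) (bigD1 set0)//= !cf0 lerD2l.
rewrite -sqr_sqr (Ex_sqr pr01 (fun x => F x ^+ 2)).
set f := cf (fun x => F x ^+ 2); set g := cf (fun x => G x ^+ 2).
rewrite (bigID (fun A : {set I} => (#|A| < q + q)%N))/= [X in _ + X]big1 ?addr0; last first.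
  move=> A /andP[_]; rewrite -leqNgt => qA.
  have -> : f A = 0.
    rewrite /f -mul_self (cf_mul_out pr01 Fp Fp)//.
    by rewrite (leq_trans _ qA)// !addnn ltn_double.
  by rewrite mul0r.
rewrite (eq_bigl (fun A : {set I} => (0 < #|A| < q + q)%N)); last first.
  by move=> A; rewrite card_gt0.
apply: (@le_trans _ _ (\sum_(A : {set I} | (0 < #|A| < q + q)%N)
   (2^-1 * (eta ^+ 2 * f A ^+ 2) + 2^-1 * (g A ^+ 2 / eta ^+ 2)))).
  apply: ler_sum => A _.
  have en0 : eta != 0 by rewrite gt_eqF.
  have -> : f A * g A = (eta * f A) * (g A / eta) by field.
  rewrite -exprMn -expr_div_n.
  have := sqr_ge0 (eta * f A - g A / eta); rewrite sqrrB.
  set u := eta * f A; set v := g A / eta; lra.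
rewrite big_split/= -!mulr_sumr -mulr_suml mulrDr lerD2r.
rewrite !ler_wpM2l ?invr_ge0//.
by rewrite big_mkcond/=; apply: ler_sum => A _; case: ifP => // _; exact: sqr_ge0.
Qed.

Lemma cfD F G A : cf (fun x => F x + G x) A = cf F A + cf G A.
Proof. by rewrite /cf -ExD; apply: eq_Ex => x; rewrite mulrDl. Qed.

Lemma cfB F G A : cf (fun x => F x - G x) A = cf F A - cf G A.
Proof. by rewrite /cf -ExB; apply: eq_Ex => x; rewrite mulrBl. Qed.

Lemma homogD p F G : homog p F -> homog p G -> homog p (fun x => F x + G x).
Proof.
move=> Fp Gp A; rewrite cfD; have [->|/Fp//] := eqVneq (cf F A) 0.
by rewrite add0r; exact: Gp.
Qed.

Lemma homogB p F G : homog p F -> homog p G -> homog p (fun x => F x - G x).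
Proof.
move=> Fp Gp A; rewrite cfB; have [->|/Fp//] := eqVneq (cf F A) 0.
by rewrite add0r oppr_eq0; exact: Gp.
Qed.

(* [F^2 G^2] is bounded from above by bounding [(F + G)^2 (F - G)^2] from below. *)
Lemma mixed_eq p F G : fourth_moment_close p F -> fourth_moment_close p G ->
  Ex (fun x => (F x * G x) ^+ 2) <=
  Ex (fun x => F x ^+ 2) * Ex (fun x => G x ^+ 2) +
  2 * Ex (fun x => F x * G x) ^+ 2 + (1 + 8 * (o * S)) * eta ^+ 4.
Proof.
move=> [/andP[p0 pQ] Fp FS F4 Fm] [_ Gp GS G4 Gm].
pose U x := F x + G x; pose V x := F x - G x.
(* The bound [(u - v)^2 <= 2 u^2 + 2 v^2] on coefficients accounts for the factor 4. *)
have Vm : infl_le (cf V) (4 * eta ^+ 4).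
  move=> k; have := Fm k; have := Gm k => Gk Fk.
  apply: (@le_trans _ _ (\sum_(A : {set I} | k \in A) (2 * cf F A ^+ 2 + 2 * cf G A ^+ 2))).
    apply: ler_sum => A _; rewrite cfB.
    have := sqr_ge0 (cf F A + cf G A); rewrite sqrrD sqrrB; lra.
  by rewrite big_split/= -!mulr_sumr; lra.
have := lowcf_le pr01 p0 (homogD Fp Gp) (homogB Fp Gp) Vm.
set a := Ex (fun x => F x ^+ 2) in FS F4 *; set b := Ex (fun x => G x ^+ 2) in GS G4 *.
set c := Ex (fun x => F x * G x).
have EU : Ex (fun x => (F x + G x) ^+ 2) = a + b + 2 * c.
  by rewrite /a /b /c -ExZ -!ExD; apply: eq_Ex => x; ring.
have EV : Ex (fun x => (F x - G x) ^+ 2) = a + b - 2 * c.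
  by rewrite /a /b /c -ExZ -!ExD -ExB; apply: eq_Ex => x; ring.
have EUV : Ex (fun x => (F x + G x) * (F x - G x)) = a - b.
  by rewrite /a /b -ExB; apply: eq_Ex => x; ring.
have E4 : Ex (fun x => ((F x + G x) * (F x - G x)) ^+ 2) =
   Ex (fun x => F x ^+ 4) + Ex (fun x => G x ^+ 4) - 2 * Ex (fun x => (F x * G x) ^+ 2).
  by rewrite -ExZ -ExD -ExB; apply: eq_Ex => x; ring.
rewrite EU EV EUV E4.
have := lowcf_ge0 pr (p + p) (fun x => (F x + G x) * (F x - G x)).
have V0 : 0 <= a + b - 2 * c by rewrite -EV Ex_sqr_ge0.
have U0 : 0 <= a + b + 2 * c by rewrite -EU Ex_sqr_ge0.
have err : ovl p p * (4 * eta ^+ 4) * (a + b + 2 * c) <= o * (4 * eta ^+ 4) * (4 * S).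
  apply: ler_pM => //; [exact: (mulr_ge0 (ovl_ge0 p p) (mulr_ge0 _ e4))| |lra].
  by rewrite ler_wpM2r ?ovl_le// mulr_ge0.
have oE : o * (4 * eta ^+ 4) * (4 * S) = 16 * (o * S) * eta ^+ 4 by ring.
move: err; rewrite {}oE; set er := ovl _ _ * _ * _ => err.
set w := o * S; set f4 := Ex (fun x => F x ^+ 4) in F4 *.
set g4 := Ex (fun x => G x ^+ 4) in G4 *; set z := Ex _; set l := lowcf _ _.
move=> h1 h2; rewrite -/w in err; clearbody er w f4 g4 z l a b c.
have : (a + b + 2 * c) * (a + b - 2 * c) + 2 * (a - b) ^+ 2 <=
   f4 + g4 - 2 * z + 16 * w * eta ^+ 4 by lra.
(* The terms [3 * a ^+ 2 + 3 * b ^+ 2] cancel against the fourth-moment bounds for [f4] and [g4],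
   which leaves twice the claim. *)
have -> : (a + b + 2 * c) * (a + b - 2 * c) + 2 * (a - b) ^+ 2 =
  3 * a ^+ 2 + 3 * b ^+ 2 - 2 * (a * b) - 4 * c ^+ 2 by ring.
lra.
Qed.

(** Dominates both cases of [mixed_lowcf]: different degrees produce [3/2 S^2 + 1 + 3/2 o S], equal
    degrees produce [1 + 9 o S]. *)
Definition K3 : R := 3 * S ^+ 2 + 2 + 9 * (o * S).

Lemma Ex4_le q F : fourth_moment_close q F -> Ex (fun x => F x ^+ 4) <= 3 * S ^+ 2 + 1.
Proof.
move=> [_ _ FS F4 _]; apply: le_trans F4 _; apply: lerD.
  by rewrite ler_wpM2l// lerXn2r ?nnegrE// ?Ex_sqr_ge0.
by rewrite exprn_ile1// ltW.
Qed.

Lemma mixed_lowcf_lt p q F G : (p < q)%N -> fourth_moment_close p F ->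
  fourth_moment_close q G ->
  lowcf (p + q) (fun x => F x * G x) <= K3 * eta ^+ 2.
Proof.
move=> pq Fc Gc; have [/andP[p0 pQ] Fp FS F4 Fm] := Fc.
have [/andP[q0 qQ] Gq GS G4 Gm] := Gc.
have := lowcf_le pr01 p0 Fp Gq Gm; have := mixed_lt pq Fp Gq.
rewrite (Ex_homog_orth Fp Gq) ?neq_ltn ?pq// expr0n/= mulr0 subr0.
have := ovl_err pQ qQ e4 FS.
have : lowcf (q + q) (fun x => G x ^+ 2) / eta ^+ 2 <= (1 + o * S) * eta ^+ 2.
  rewrite ler_pdivrMr ?exprn_gt0// -mulrA -exprD; exact: lowcf_sqr_small.
have : eta ^+ 2 * Ex (fun x => F x ^+ 4) <= (3 * S ^+ 2 + 1) * eta ^+ 2.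
  by rewrite mulrC ler_wpM2r//; exact: Ex4_le Fc.
have : o * S * eta ^+ 4 <= o * S * eta ^+ 2 by rewrite ler_wpM2l.
have : 0 <= S ^+ 2 * eta ^+ 2 by rewrite mulr_ge0// sqr_ge0.
have : 0 <= o * S * eta ^+ 2 by rewrite mulr_ge0.
by have := e2; have := e42; rewrite /K3; lra.
Qed.

Lemma mixed_lowcf p q F G : fourth_moment_close p F -> fourth_moment_close q G ->
  lowcf (p + q) (fun x => F x * G x) <= K3 * eta ^+ 2.
Proof.
have [pq|qp|<-] := ltngtP p q; first exact: mixed_lowcf_lt.
  move=> Fc Gc; have := mixed_lowcf_lt qp Gc Fc; rewrite addnC.
  by under eq_fun do rewrite mulrC.
move=> Fc Gc; have [/andP[p0 pQ] Fp FS F4 Fm] := Fc.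
have [_ Gp GS G4 Gm] := Gc.
have := lowcf_le pr01 p0 Fp Gp Gm; have := mixed_eq Fc Gc.
have := ovl_err pQ pQ e4 FS.
have : o * S * eta ^+ 4 <= o * S * eta ^+ 2 by rewrite ler_wpM2l.
have : 0 <= S ^+ 2 * eta ^+ 2 by rewrite mulr_ge0// sqr_ge0.
by have := e2; have := e42; rewrite /K3; lra.
Qed.

Definition K4 : R := 2^-1 * (1 + Q%:R ^+ 2 * K3).

(** The variance of [Gam F G] is of order [eta ^+ 2], and [|D| <= eta / 2 + D^2 / (2 eta)] turns
    this into a first-moment bound; the two summands are those of [K4]. *)
Lemma Gam_dev p q F G : fourth_moment_close p F -> fourth_moment_close q G ->
  Ex (fun x => `|Gam F G x - Ex (Gam F G)|) <= K4 * eta.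
Proof.
move=> Fc Gc; have [/andP[p0 pQ] Fp _ _ _] := Fc.
have [/andP[q0 qQ] Gq _ _ _] := Gc.
set D := fun x => Gam F G x - Ex (Gam F G).
have en0 : eta != 0 by rewrite gt_eqF.
apply: (@le_trans _ _ (Ex (fun x => 2^-1 * eta + 2^-1 / eta * D x ^+ 2))).
  apply: (ler_Ex pr01) => x; rewrite -/(D x) -(real_normK (num_real (D x))).
  rewrite -(ler_pM2r eta0).
  have -> : (2^-1 * eta + 2^-1 / eta * `|D x| ^+ 2) * eta =
     2^-1 * (eta ^+ 2 + `|D x| ^+ 2) by field.
  have := sqr_ge0 (`|D x| - eta); rewrite sqrrB; lra.
have -> : K4 * eta = 2^-1 * eta + 2^-1 * (Q%:R ^+ 2 * K3 * eta) by rewrite /K4; ring.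
rewrite ExD Ex_cst ExZ lerD2l -[leLHS]mulrA ler_wpM2l ?invr_ge0// ler_pdivrMl//.
apply: le_trans (var_Gam_le pr01 Fp Gq pQ qQ) _.
have -> : eta * (Q%:R ^+ 2 * K3 * eta) = Q%:R ^+ 2 * (K3 * eta ^+ 2) by ring.
by rewrite ler_wpM2l ?sqr_ge0// mixed_lowcf.
Qed.

End MixedMoments.

Lemma sqr_sum_le (R : realDomainType) (J : finType) (P : pred J) (a : J -> R) :
  (\sum_(i | P i) a i) ^+ 2 <= #|P|%:R * \sum_(i | P i) a i ^+ 2.
Proof.
(* Lagrange's identity: this double sum is twice the gap in the Cauchy-Schwarz inequality. *)
have H : 0 <= \sum_(i | P i) \sum_(j | P j) (a i - a j) ^+ 2.
  by apply: sumr_ge0 => i _; apply: sumr_ge0 => j _; exact: sqr_ge0.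
have E : \sum_(i | P i) \sum_(j | P j) (a i - a j) ^+ 2 =
    2 * (#|P|%:R * \sum_(i | P i) a i ^+ 2) - 2 * (\sum_(i | P i) a i) ^+ 2.
  transitivity (\sum_(i | P i) (\sum_(j | P j) (a i ^+ 2 + a j ^+ 2)
       - 2 * (\sum_(j | P j) a i * a j))).
    apply: eq_bigr => i _; rewrite mulr_sumr -sumrB.
    by apply: eq_bigr => j _; ring.
  rewrite sumrB -mulr_sumr [X in _ - 2 * X](_ : _ = (\sum_(i | P i) a i) ^+ 2).
    congr (_ - _).
    transitivity (\sum_(i | P i) (#|P|%:R * a i ^+ 2 + \sum_(j | P j) a j ^+ 2)).
      by apply: eq_bigr => i _; rewrite big_split/= sumr_const mulr_natl.
    by rewrite big_split/= sumr_const -mulr_sumr -[X in _ + X]mulr_natl; ring.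
  by rewrite expr2 big_distrlr.
by move: H; rewrite E subr_ge0 ler_pM2l.
Qed.

Lemma sum_pow4_le (R : realDomainType) (J : finType) (a : J -> R) :
  (\sum_i a i) ^+ 4 <= #|J|%:R ^+ 3 * \sum_i a i ^+ 4.
Proof.
have -> : (\sum_i a i) ^+ 4 = ((\sum_i a i) ^+ 2) ^+ 2 by rewrite -exprM.
have h := sqr_sum_le xpredT a.
apply: (@le_trans _ _ ((#|J|%:R * \sum_i a i ^+ 2) ^+ 2)).
  rewrite lerXn2r ?nnegrE ?sqr_ge0// mulr_ge0//.
  by apply: sumr_ge0 => i _; exact: sqr_ge0.
rewrite exprMn [_ ^+ 3]exprS mulrC [leRHS]mulrAC mulrC [leLHS]mulrC.
have -> : #|J|%:R * (\sum_i a i ^+ 4) * #|J|%:R ^+ 2 =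
  #|J|%:R ^+ 2 * (#|J|%:R * \sum_i (a i ^+ 2) ^+ 2) :> R.
  rewrite mulrC; congr (_ * (_ * _)); by apply: eq_bigr => i _; rewrite -exprM.
by rewrite mulrC ler_wpM2l ?sqr_ge0// sqr_sum_le.
Qed.

(** * Exchangeable pairs *)

Section ExchangeablePairs.
Context {R : realType} {I : finType}.
Variable pr : I -> R.
Hypothesis pr01 : forall k, 0 < pr k < 1.

Local Notation cube := {ffun I -> bool}.
Local Notation Ex := (Ex pr).
Local Notation wt := (wt pr).
Local Notation Lap := (Lap pr).
Local Notation Gam := (Gam pr).
Implicit Types (F G H : cube -> R) (A B : {set I}) (x : cube) (k : I).

Variables (Q : nat) (S eta : R).
Hypotheses (S0 : 0 <= S) (eta0 : 0 < eta) (eta1 : eta <= 1).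
Local Notation fourth_moment_close := (fourth_moment_close pr Q S eta).
Local Notation K2 := (K2 Q S).
Local Notation K4 := (K4 Q S).

Variables (d : nat) (q : 'I_d -> nat) (F : 'I_d -> cube -> R) (v : 'I_d -> R).
Hypothesis Fc : forall j, fourth_moment_close (q j) (F j).
Variables (phi phi' : R -> R).
Hypothesis phi'1 : forall x : R, `|phi' x| <= 1.
Hypothesis phi_taylor : forall x y : R, `|phi y - phi x - phi' x * (y - x)| <= (y - x) ^+ 2.

Let W x := \sum_j v j * F j x.

(** The first summand comes from squared increments of one component, the second from fourth powers
    of increments of [W], with the weights used in [rem_bound]. *)
Definition Krem : R := 2^-1 * Q%:R * S + 4^-1 * d%:R ^+ 3 * (\sum_j v j ^+ 4) * K2.

Definition Kst : R := \sum_j `|v j| * (Krem + \sum_i `|v i| * K4).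

Lemma Ex_sumI (P : 'I_d -> cube -> R) : Ex (fun x => \sum_j P j x) = \sum_j Ex (P j).
Proof. exact: Ex_sum. Qed.

Lemma W_diff4 :
  Ex (fun x => \sum_k \sum_b wt k b * (W x - W (setc x k b)) ^+ 4) <=
  d%:R ^+ 3 * (\sum_j v j ^+ 4) * K2 * eta ^+ 4.
Proof.
apply: (@le_trans _ _ (Ex (fun x => \sum_j d%:R ^+ 3 * v j ^+ 4 *
   \sum_k \sum_b wt k b * (F j x - F j (setc x k b)) ^+ 4))).
  apply: (ler_Ex pr01) => x.
  under [leRHS]eq_bigr do rewrite mulr_sumr.
  rewrite [leRHS]exchange_big/=; apply: ler_sum => k _.
  under [leRHS]eq_bigr do rewrite mulr_sumr.
  rewrite [leRHS]exchange_big/=; apply: ler_sum => b _ /=.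
  have -> : \sum_(i < d) d%:R ^+ 3 * v i ^+ 4 * (wt k b * (F i x - F i (setc x k b)) ^+ 4)
     = wt k b * (d%:R ^+ 3 * \sum_(i < d) (v i * (F i x - F i (setc x k b))) ^+ 4).
    by rewrite !mulr_sumr; apply: eq_bigr => i _; rewrite exprMn; ring.
  rewrite ler_wpM2l ?wt_ge0//.
  have -> : W x - W (setc x k b) = \sum_(i < d) v i * (F i x - F i (setc x k b)).
    by rewrite -sumrB; apply: eq_bigr => i _; rewrite mulrBr.
  by have := sum_pow4_le (fun i => v i * (F i x - F i (setc x k b))); rewrite card_ord.
rewrite Ex_sumI mulr_sumr -mulrA mulr_suml; apply: ler_sum => j _.
rewrite ExZ ler_wpM2l//; last exact: (diff4_small pr01 S0 eta0 (Fc j)).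
exact: (mulr_ge0 (exprn_ge0 _ (ler0n _ _)) (exprn_even_ge0 _ _)).
Qed.

(** The Taylor remainder is at most the squared increment [w^2] of [W], and
    [|D| w^2 <= (eta^2 D^2 + w^4 / eta^2) / 2]. The increments [D] have bounded energy, and the
    fourth powers [w^4] are of order [eta ^+ 4]. *)
Lemma rem_bound j : `|Ex (fun x => \sum_k \sum_b wt k b *
     ((F j x - F j (setc x k b)) *
     (phi (W x) - phi (W (setc x k b)) - phi' (W x) * (W x - W (setc x k b)))))|
  <= 2 * (Krem * eta ^+ 2).
Proof.
have [/andP[q0 qQ] Fq FS _ _] := Fc j.
pose D x k b := F j x - F j (setc x k b).
pose w x k b := W x - W (setc x k b).
apply: le_trans (ler_norm_Ex pr01 _) _.
apply: (@le_trans _ _ (Ex (fun x =>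
    2^-1 * eta ^+ 2 * (\sum_k \sum_b wt k b * (D x k b * D x k b)) +
    2^-1 / eta ^+ 2 * (\sum_k \sum_b wt k b * w x k b ^+ 4)))).
  apply: (ler_Ex pr01) => x; apply: le_trans (ler_norm_sum _ _ _) _.
  rewrite !mulr_sumr -big_split/=; apply: ler_sum => k _.
  apply: le_trans (ler_norm_sum _ _ _) _.
  rewrite !mulr_sumr -big_split/=; apply: ler_sum => b _ /=.
  rewrite normrM ger0_norm ?wt_ge0// normrM -/(D x k b) -/(w x k b).
  have -> : 2^-1 * eta ^+ 2 * (wt k b * (D x k b * D x k b)) +
    2^-1 / eta ^+ 2 * (wt k b * w x k b ^+ 4) =
    wt k b * (2^-1 * ((eta * `|D x k b|) ^+ 2 + (w x k b ^+ 2 / eta) ^+ 2)).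
    by rewrite exprMn (real_normK (num_real _)); field; rewrite gt_eqF.
  rewrite ler_wpM2l ?wt_ge0//.
  apply: (@le_trans _ _ (`|D x k b| * w x k b ^+ 2)).
    rewrite ler_wpM2l//.
    have := phi_taylor (W x) (W (setc x k b)); rewrite -normrN.
    rewrite -[(W _ - W _) ^+ 2]sqrrN !opprB -/(w x k b); apply: le_trans.
    by rewrite le_eqVlt; apply/orP; left; apply/eqP; congr (`|_|); rewrite /w; ring.
  have -> : `|D x k b| * w x k b ^+ 2 = (eta * `|D x k b|) * (w x k b ^+ 2 / eta).
    by field; rewrite gt_eqF.
  have := sqr_ge0 (eta * `|D x k b| - (w x k b ^+ 2 / eta)).
  by rewrite sqrrB; lra.
rewrite ExD !ExZ.
have -> : Ex (fun x => \sum_k \sum_b wt k b * (D x k b * D x k b)) =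
   2 * (q j)%:R * Ex (fun x => F j x ^+ 2).
  rewrite -Ex_Lap_exch -[RHS]mulrA -[X in _ = _ * X]ExZ; congr (_ * _); apply: eq_Ex => x.
  by rewrite (Lap_hom pr01 _ Fq); ring.
have -> : 2 * (Krem * eta ^+ 2) = 2^-1 * eta ^+ 2 * (2 * Q%:R * S) +
   2^-1 / eta ^+ 2 * (d%:R ^+ 3 * (\sum_j v j ^+ 4) * K2 * eta ^+ 4).
  by rewrite /Krem; field; rewrite gt_eqF.
apply: lerD.
  apply: ler_wpM2l; first by rewrite mulr_ge0 ?invr_ge0// exprn_ge0// ltW.
  apply: ler_pM => //; first exact: Ex_sqr_ge0.
  by rewrite ler_pM2l// ler_nat.
by rewrite ler_wpM2l ?W_diff4// mulr_ge0// invr_ge0 exprn_ge0// ltW.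
Qed.

Lemma Gam_sumr j x : Gam (F j) W x = \sum_i v i * Gam (F j) (F i) x.
Proof.
rewrite /Gam; under [RHS]eq_bigr do rewrite mulrCA.
rewrite -mulr_sumr; congr (_ * _).
under [RHS]eq_bigr do rewrite mulr_sumr.
rewrite [RHS]exchange_big; apply: eq_bigr => k _.
under [RHS]eq_bigr do rewrite mulr_sumr.
rewrite [RHS]exchange_big; apply: eq_bigr => b _ /=.
rewrite /W -sumrB !mulr_sumr; apply: eq_bigr => i _; ring.
Qed.

Lemma Krem_ge0 : 0 <= Krem.
Proof.
have K20 : 0 <= K2 by rewrite mulr_ge0// addr_ge0// !mulr_ge0// addr_ge0// exprn_ge0.
apply: addr_ge0; first by rewrite !mulr_ge0 ?invr_ge0.
apply: mulr_ge0 => //; apply: mulr_ge0; first by rewrite mulr_ge0 ?invr_ge0// exprn_ge0.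
by apply: sumr_ge0 => i _; exact: exprn_even_ge0.
Qed.

(** [W] mixes degrees and need not be an eigenfunction, so Stein's method is run for each [F j]
    against [phi (W x)]. Since [Lap (F j)] is [q j] times [F j], exchangeability produces
    [phi' (W x) * Gam (F j) W x] plus a Taylor remainder, and each [Gam (F j) (F i)] is then
    replaced by its mean, which is [q j] times the covariance. *)
Lemma stein_component j :
  `|Ex (fun x => F j x * phi (W x)) -
    (\sum_i v i * Ex (fun x => F j x * F i x)) * Ex (fun x => phi' (W x))| <=
  (Krem + \sum_i `|v i| * K4) * eta.
Proof.
have [/andP[q0 qQ] Fq FS _ _] := Fc j.
have qR : 1 <= (q j)%:R :> R by rewrite ler1n.
have qR0 : 0 < (q j)%:R :> R by rewrite ltr0n.
rewrite -(ler_pM2l qR0) -[X in X * `|_| <= _](gtr0_norm qR0) -normrM.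
pose r := Ex (fun x => \sum_k \sum_b wt k b *
     ((F j x - F j (setc x k b)) *
     (phi (W x) - phi (W (setc x k b)) - phi' (W x) * (W x - W (setc x k b))))).
have E1 : (q j)%:R * Ex (fun x => F j x * phi (W x)) =
   \sum_i v i * Ex (fun x => phi' (W x) * Gam (F j) (F i) x) + 2^-1 * r.
  have -> : (q j)%:R * Ex (fun x => F j x * phi (W x)) =
      2^-1 * (2 * Ex (fun x => phi (W x) * Lap (F j) x)).
    rewrite mulKf// -ExZ; apply: eq_Ex => x; rewrite (Lap_hom pr01 _ Fq); ring.
  rewrite (Ex_Lap_exch pr (F j) (fun x => phi (W x))).
  have -> : \sum_i v i * Ex (fun x => phi' (W x) * Gam (F j) (F i) x) =
     2^-1 * Ex (fun x => 2 * (phi' (W x) * Gam (F j) W x)).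
    rewrite ExZ mulKf//; transitivity (Ex (fun x => \sum_i v i * (phi' (W x) * Gam (F j) (F i) x))).
      by rewrite Ex_sumI; apply: eq_bigr => i _; rewrite ExZ.
    by apply: eq_Ex => x; rewrite Gam_sumr mulr_sumr; apply: eq_bigr => i _; ring.
  rewrite -mulrDr; congr (_ * _); rewrite -ExD; apply: eq_Ex => x.
  rewrite /Gam [2 * _]mulrCA mulVKf// mulr_sumr -big_split; apply: eq_bigr => k _.
  by rewrite mulr_sumr -big_split; apply: eq_bigr => b _ /=; ring.
have E2 : (q j)%:R * (Ex (fun x => F j x * phi (W x)) -
     (\sum_i v i * Ex (fun x => F j x * F i x)) * Ex (fun x => phi' (W x))) =
   \sum_i v i * Ex (fun x => phi' (W x) * (Gam (F j) (F i) x - Ex (Gam (F j) (F i))))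
   + 2^-1 * r.
  rewrite mulrBr E1 addrAC; congr (_ + _).
  rewrite mulr_suml mulr_sumr -sumrB; apply: eq_bigr => i _.
  have [_ Fqi _ _ _] := Fc i.
  rewrite (Ex_Gam_hom pr01 Fq Fqi).
  transitivity (v i * (Ex (fun x => phi' (W x) * Gam (F j) (F i) x) -
    (q j)%:R * Ex (fun x => F j x * F i x) * Ex (fun x => phi' (W x)))); first by ring.
  by congr (_ * _); rewrite -ExZ -ExB; apply: eq_Ex => x; ring.
rewrite E2; apply: (@le_trans _ _ ((Krem + \sum_i `|v i| * K4) * eta)).
  rewrite mulrDl addrC; apply: le_trans (ler_normD _ _) _; apply: lerD.
    rewrite normrM ger0_norm ?invr_ge0// ler_pdivrMl//.
    apply: le_trans (rem_bound j) _; rewrite ler_wpM2l// ler_wpM2l ?Krem_ge0//.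
    by rewrite expr2 ler_piMr// ltW.
  rewrite mulr_suml; apply: le_trans (ler_norm_sum _ _ _) _; apply: ler_sum => i _.
  rewrite normrM -mulrA ler_wpM2l//; apply: le_trans (ler_norm_Ex pr01 _) _.
  apply: le_trans (Gam_dev pr01 S0 eta0 eta1 (Fc j) (Fc i)).
  by apply: (ler_Ex pr01) => x; rewrite normrM ler_piMl.
(* Here [1 <= q j] absorbs the factor by which both sides were multiplied at the start. *)
apply: ler_peMl => //; apply: mulr_ge0; last exact: ltW.
apply: addr_ge0; first exact: Krem_ge0.
apply: sumr_ge0 => i _; apply: mulr_ge0 => //.
apply: mulr_ge0 => //; apply: addr_ge0 => //; apply: mulr_ge0; first exact: sqr_ge0.
apply: addr_ge0; first by rewrite addr_ge0// mulr_ge0// sqr_ge0.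
by rewrite mulr_ge0// mulr_ge0// ovl_ge0.
Qed.

Lemma stein_bound :
  `|Ex (fun x => W x * phi (W x)) -
    Ex (fun x => W x ^+ 2) * Ex (fun x => phi' (W x))| <= Kst * eta.
Proof.
have -> : Ex (fun x => W x * phi (W x)) = \sum_j v j * Ex (fun x => F j x * phi (W x)).
  transitivity (Ex (fun x => \sum_j v j * (F j x * phi (W x)))).
    by apply: eq_Ex => x; rewrite mulr_suml; apply: eq_bigr => j _; rewrite mulrA.
  by rewrite Ex_sumI; apply: eq_bigr => j _; rewrite ExZ.
have -> : Ex (fun x => W x ^+ 2) = \sum_j v j * \sum_i v i * Ex (fun x => F j x * F i x).
  transitivity (Ex (fun x => \sum_j v j * (\sum_i v i * (F j x * F i x)))).
    apply: eq_Ex => x; rewrite expr2 mulr_suml; apply: eq_bigr => j _.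
    rewrite -mulrA; congr (_ * _); rewrite mulr_sumr; apply: eq_bigr => i _; ring.
  rewrite Ex_sumI; apply: eq_bigr => j _; rewrite ExZ; congr (_ * _).
  by rewrite Ex_sumI; apply: eq_bigr => i _; rewrite ExZ.
rewrite mulr_suml -sumrB /Kst mulr_suml; apply: le_trans (ler_norm_sum _ _ _) _.
apply: ler_sum => j _; rewrite -mulrA -mulrBr normrM -mulrA ler_wpM2l//.
exact: stein_component.
Qed.

End ExchangeablePairs.

(** * Kernels restricted to finitely many indices *)

Definition prN (R : realType) (p : nat -> R) N (k : 'I_N) : R := p k.

Section Kernels.
Context {R : realType}.
Variables (p : nat -> R) (q : nat) (f : q.-tuple nat -> R).
Hypothesis q0 : (0 < q)%N.
Hypothesis fK : kernel0 f.
Variable N : nat.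
Hypothesis p01 : forall k, 0 < p k < 1.
Local Notation pr := (@prN R p N).
Implicit Types (i : q.-tuple 'I_N) (x : {ffun 'I_N -> bool}) (A : {set 'I_N}).

Lemma pr01 (k : 'I_N) : 0 < pr k < 1. Proof. exact: p01. Qed.

Definition natt (i : q.-tuple 'I_N) : q.-tuple nat := [tuple of map val i].

Lemma tnth_natt i l : tnth (natt i) l = tnth i l :> nat.
Proof. by rewrite tnth_map. Qed.

Lemma natt_inj : injective natt.
Proof.
move=> i j ij; apply: eq_from_tnth => l; apply: val_inj.
by rewrite /= -!tnth_natt ij.
Qed.

Lemma uniq_natt i : uniq (natt i) = uniq i.
Proof. by rewrite map_inj_uniq//; exact: val_inj. Qed.

Definition QN (x : {ffun 'I_N -> bool}) : R :=
  \sum_(i : q.-tuple 'I_N) f (natt i) * \prod_(l < q) yv pr (tnth i l) (x (tnth i l)).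

Definition tset (i : q.-tuple 'I_N) : {set 'I_N} := [set k in i]%SET.

Lemma prod_chi i x : uniq i ->
  \prod_(l < q) yv pr (tnth i l) (x (tnth i l)) = chi pr (tset i) x.
Proof.
move=> ui; rewrite -(big_tuple _ _ i xpredT (fun k => yv pr k (x k))).
by rewrite big_uniq//; apply: eq_bigl => k; rewrite inE.
Qed.

Lemma QNE x : QN x = \sum_(i : q.-tuple 'I_N) f (natt i) * chi pr (tset i) x.
Proof.
apply: eq_bigr => i _; have [ui|nui] := boolP (uniq i); first by rewrite prod_chi.
by have [_ _ ->] := fK; rewrite ?uniq_natt// !mul0r.
Qed.

Lemma cf_QN A : cf pr QN A = \sum_(i : q.-tuple 'I_N | uniq i && (tset i == A)) f (natt i).
Proof.
transitivity (Ex pr (fun x => \sum_(i : q.-tuple 'I_N) f (natt i) * (chi pr (tset i) x * chi pr A x))).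
  by apply: eq_Ex => x; rewrite QNE mulr_suml; apply: eq_bigr => i _; rewrite mulrA.
rewrite Ex_sum [RHS]big_mkcond/=; apply: eq_bigr => i _.
rewrite ExZ (Ex_chi2 pr01).
have [ui|nui] := boolP (uniq i); last by have [_ _ ->] := fK; rewrite ?uniq_natt// mul0r.
by case: eqP => _ /=; rewrite ?mulr1 ?mulr0.
Qed.

Lemma card_tset i : uniq i -> #|tset i| = q.
Proof. by move=> ui; rewrite cardsE (card_uniqP ui) size_tuple. Qed.

Lemma homog_QN : homog pr q QN.
Proof.
move=> A; rewrite cf_QN => nz; apply/eqP; apply: contraNT nz => qA.
rewrite big1// => i /andP[ui /eqP iA].
by rewrite -iA card_tset ?eqxx in qA.
Qed.

(** Cauchy-Schwarz over the tuples that enumerate [A], of which there are at most [q!]. *)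
Lemma cf_QN_sqr A : cf pr QN A ^+ 2 <=
  q`!%:R * \sum_(i : q.-tuple 'I_N | uniq i && (tset i == A)) f (natt i) ^+ 2.
Proof.
have [->|nz] := eqVneq (cf pr QN A) 0.
  by rewrite expr0n mulr_ge0//; apply: sumr_ge0 => i _; exact: sqr_ge0.
have Aq := homog_QN nz.
rewrite cf_QN; apply: le_trans (sqr_sum_le _ _) _.
rewrite ler_wpM2r ?ler_nat//; first by apply: sumr_ge0 => i _; exact: sqr_ge0.
have -> : q`! = #|[set t : q.-tuple 'I_N | all (mem A) t & uniq t]%SET|.
  by rewrite card_uniq_tuples Aq ffactnn.
apply: subset_leq_card; apply/fintype.subsetP => i; rewrite !inE => /andP[-> /eqP iA].
rewrite ?andbT; apply/allP => k ki /=; rewrite -iA inE; exact: ki.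
Qed.

Variable M : R.
Hypothesis fM : (max_influence f <= M%:E)%E.

Lemma sum_last_le k :
  \sum_(i : q.-tuple 'I_N | last 0%N (natt i) == k) f (natt i) ^+ 2 <= M.
Proof.
rewrite -lee_fin; apply: le_trans fM; apply: (@le_trans _ _
   (\esum_(i in [set i : q.-tuple nat | last 0%N i = k]%classic) (f i ^+ 2)%:E)%E); last first.
  by apply: ereal_sup_ubound; exists k.
pose r := [seq natt i | i <- enum [pred i : q.-tuple 'I_N | last 0%N (natt i) == k]].
apply: esum_ge; exists [set` r]%classic.
  split; first exact: finite_seq.
  by move=> i /mapP[j]; rewrite mem_enum inE => /eqP jk ->.
rewrite -fsbig_seq; last by rewrite map_inj_uniq ?enum_uniq//; exact: natt_inj.
by rewrite /r big_map big_enum/= sumEFin.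
Qed.

(** [max_influence] freezes the last position; by symmetry of the kernel, a transposition moves
    position [l] there. *)
Lemma sum_coord_le (l : 'I_q) (k : 'I_N) :
  \sum_(i : q.-tuple 'I_N | tnth i l == k) f (natt i) ^+ 2 <= M.
Proof.
have lq : (q.-1 < q)%N by rewrite prednK.
pose L := Ordinal lq; pose s := tperm l L.
have [_ fs _] := fK.
pose h (i : q.-tuple 'I_N) := [tuple tnth i (s m) | m < q].
have hh : cancel h h.
  by move=> i; apply: eq_from_tnth => m; rewrite !tnth_mktuple tpermK.
have fh i : f (natt (h i)) = f (natt i).
  rewrite -[RHS](fs s); congr f; apply: eq_from_tnth => m.
  by rewrite tnth_natt !tnth_mktuple tnth_natt.
rewrite (reindex_inj (can_inj hh)).
apply: le_trans (sum_last_le k); rewrite le_eqVlt; apply/orP; left; apply/eqP.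
apply: eq_big => [i|i _]; last by rewrite fh.
rewrite tnth_mktuple /s tpermL.
have -> : last 0%N (natt i) = tnth i L.
  by rewrite -nth_last size_tuple -tnth_natt (tnth_nth 0%N).
by [].
Qed.

(** The factor [q!] comes from [cf_QN_sqr], the factor [q] from a union bound over the positions
    that [k] can occupy in a tuple. *)
Lemma infl_QN : infl_le (cf pr QN) (q`!%:R * q%:R * M).
Proof.
move=> k; apply: (@le_trans _ _ (\sum_(A : {set 'I_N} | k \in A)
   q`!%:R * \sum_(i : q.-tuple 'I_N | uniq i && (tset i == A)) f (natt i) ^+ 2)).
  by apply: ler_sum => A _; exact: cf_QN_sqr.
rewrite -mulr_sumr -mulrA ler_wpM2l//.
apply: (@le_trans _ _ (\sum_(i : q.-tuple 'I_N | k \in i) f (natt i) ^+ 2)).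
  rewrite (exchange_big_dep (fun i : q.-tuple 'I_N => k \in i))/=; last first.
    by move=> A i kA /andP[_ /eqP iA]; rewrite -iA inE in kA.
  apply: ler_sum => i ki; have [ui|nui] := boolP (uniq i); last first.
    by rewrite big_pred0 ?sqr_ge0// => A; rewrite andbF.
  rewrite (bigD1 (tset i))//=; last by rewrite inE ki eqxx.
  by rewrite big1 ?addr0// => A /andP[/andP[_ /eqP ->]]; rewrite eqxx.
apply: (@le_trans _ _ (\sum_(l < q) \sum_(i : q.-tuple 'I_N | tnth i l == k) f (natt i) ^+ 2)).
  rewrite (exchange_big_dep xpredT)//= [leLHS]big_mkcond/=.
  apply: ler_sum => i _; case: ifPn => [/tnthP[l kl]|_]; last first.
    by apply: sumr_ge0 => l _; exact: sqr_ge0.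
  rewrite (bigD1 l)/= ?kl// lerDl.
  by apply: sumr_ge0 => l' _; exact: sqr_ge0.
apply: le_trans (ler_sum _ (fun l _ => sum_coord_le l k)) _.
by rewrite sumr_const card_ord mulr_natl.
Qed.

(** The sum over the smaller box, viewed on the larger cube, so that approximants of two sizes can
    be compared on one space ([Qw_trunc]). *)
Definition QN_trunc n (x : {ffun 'I_N -> bool}) : R :=
  \sum_(i : q.-tuple 'I_N | [forall l, (tnth i l < n)%N])
    f (natt i) * \prod_(l < q) yv pr (tnth i l) (x (tnth i l)).

Lemma QN_trunc_setc n x (k : 'I_N) b : (n <= k)%N ->
  QN_trunc n (setc x k b) = QN_trunc n x.
Proof.
move=> nk; apply: eq_bigr => i /forallP hi; congr (_ * _).
apply: eq_bigr => l _; rewrite ffunE; case: eqP => // E.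
by have := hi l; rewrite E ltnNge nk.
Qed.

(* The discarded terms are orthogonal to every function of the first [n]
   coordinates. *)
Lemma Ex_QN_trunc n a : Ex pr (fun x => QN_trunc n x ^+ a * QN x) =
  Ex pr (fun x => QN_trunc n x ^+ a.+1).
Proof.
transitivity (Ex pr (fun x => QN_trunc n x ^+ a.+1) +
  \sum_(i : q.-tuple 'I_N | ~~ [forall l, (tnth i l < n)%N])
     f (natt i) * Ex pr (fun x => QN_trunc n x ^+ a * chi pr (tset i) x)).
  rewrite -[X in _ + X](eq_bigr _ (fun i _ => ExZ _ _ _)) -Ex_sum -ExD.
  apply: eq_Ex => x; rewrite exprSr /QN (bigID (fun i : q.-tuple 'I_N => [forall l, (tnth i l < n)%N]))/=.
  rewrite mulrDr; congr (_ + _); rewrite mulr_sumr; apply: eq_bigr => i _.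
  have [ui|nui] := boolP (uniq i); first by rewrite prod_chi// mulrCA.
  by have [_ _ ->] := fK; rewrite ?uniq_natt// !mul0r mulr0.
rewrite big1 ?addr0// => i; rewrite negb_forall => /existsP[l]; rewrite -leqNgt => nl.
rewrite (Ex_chi_indep pr01 (k := tnth i l)) ?mulr0//.
  by rewrite inE mem_tnth.
by move=> x b; rewrite QN_trunc_setc.
Qed.

End Kernels.

Local Open Scope classical_set_scope.

(** The integrating factor [e t = expR (a / 2 * t ^+ 2)] gives [e * u] the derivative
    [e t * (u' t + a * t * u t)]. The mean value theorem on [[0, 1]] and [e c <= e 1] then leave
    exactly [delta]. *)
Lemma ode_bound (R : realType) (u u' : R -> R) (a delta : R) : 0 <= a ->
  (forall t : R, is_derive t (1 : R) u (u' t)) ->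
  (forall t : R, 0 < t < 1 -> `|u' t + a * t * u t| <= delta) ->
  `|u 1 - expR (- (a / 2)) * u 0| <= delta.
Proof.
move=> a0 du bu.
pose e (t : R) := expR (a / 2 * t ^+ 2).
have de t : is_derive t (1 : R) e (a * t * e t).
  have di : is_derive t (1 : R) (fun x : R => a / 2 * x ^+ 2) (a * t).
    have -> : (fun x : R => a / 2 * x ^+ 2) = (a / 2) *: ((@id R) ^+ 2).
      by apply/funext => x.
    apply: is_derive_eq; rewrite /GRing.scale/= expr1 mulr1.
    by field.
  have := @is_derive1_comp R expR (fun x : R => a / 2 * x ^+ 2) t _ _ (is_derive_expR (a / 2 * t ^+ 2)) di.
  by move=> h; apply: (is_derive_eq h); rewrite mulrC.
have dh t : is_derive t (1 : R) (e * u) (e t * (u' t + a * t * u t)).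
  have h := @is_deriveM _ _ e u t 1 _ _ (de t) (du t).
  by apply: (is_derive_eq h); rewrite /GRing.scale/=; ring.
have [c c01] : exists2 c, c \in `]0, 1[%R &
    (e * u) 1 - (e * u) 0 = e c * (u' c + a * c * u c) * (1 - 0).
  apply: (@MVT R (e * u)) => //.
    by apply: derivable_within_continuous => t _; have [] := dh t.
rewrite /= !fctE subr0 mulr1 => E.
have e1 : 0 < e 1 by exact: expR_gt0.
have e0 : e 0 = 1 by rewrite /e expr0n/= mulr0 expR0.
rewrite -(ler_pM2l e1) -{1}(gtr0_norm e1) -normrM.
have -> : e 1 * (u 1 - expR (- (a / 2)) * u 0) = e c * (u' c + a * c * u c).
  rewrite -E e0 mul1r mulrBr mulrA /e expr1n mulr1 -expRD subrr expR0.
  by rewrite mul1r.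
rewrite normrM gtr0_norm ?expR_gt0//.
move: c01; rewrite in_itv/= => c01; have /andP[c0 c1] := c01.
apply: ler_pM => //; rewrite ?expR_ge0// ?bu//.
rewrite ler_expR ler_wpM2l ?divr_ge0// expr1n.
by rewrite expr_le1// ltW.
Qed.

Lemma integrable_bddM d (T : measurableType d) (R : realType)
    (mu : {measure set T -> \bar R}) (h g : T -> R) (M : R) :
  measurable_fun setT h -> (forall x, `|h x| <= M) ->
  mu.-integrable setT (EFin \o g) ->
  mu.-integrable setT (EFin \o (fun x => h x * g x)).
Proof.
move=> mh hM ig.
apply: (@le_integrable _ _ _ mu setT measurableT _ (EFin \o (fun x => M * g x))).
- apply/measurable_EFinP/measurable_funM => //.
  exact/measurable_EFinP/(measurable_int mu).
- move=> x _ /=; rewrite lee_fin !normrM ler_wpM2r//.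
  by rewrite (le_trans (hM x))// ler_norm.
- have -> : (EFin \o (fun x => M * g x)) = (fun x => M%:E * (EFin \o g) x)%E.
    by apply/funext => x; rewrite /= EFinM.
  exact: integrableZl.
Qed.

(** * The Gaussian characteristic function *)

Section NormalDensity.
Context {R : realType}.
Variable s : R.
Hypothesis s0 : 0 < s.
Local Notation mu := (@lebesgue_measure R).
Local Notation phi := (normal_pdf 0 s).

Let sn0 : s != 0. Proof. by rewrite gt_eqF. Qed.

Lemma normal_pdf0E (x : R) : phi x = normal_peak s * expR (- (x ^+ 2 / (2 * s ^+ 2))).
Proof. by rewrite normal_pdfE// /normal_fun subr0 mulNr mulr_natl. Qed.

Lemma is_derive_normal_pdf (x : R) : is_derive x (1 : R) phi (- (x / s ^+ 2) * phi x).
Proof.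
have -> : phi = normal_peak s \o* (expR \o (fun x => - (x ^+ 2 / (2 * s ^+ 2)))).
  by apply/funext => y; rewrite normal_pdf0E /= mulrC.
have di : is_derive x (1 : R) (fun x : R => - (x ^+ 2 / (2 * s ^+ 2))) (- (x / s ^+ 2)).
  have -> : (fun x : R => - (x ^+ 2 / (2 * s ^+ 2))) = (- (2 * s ^+ 2)^-1) *: ((@id R) ^+ 2).
    by apply/funext => y; rewrite /= !fctE /GRing.scale/= mulNr mulrC.
  by apply: is_derive_eq; rewrite /GRing.scale/= expr1 mulr1; field.
have h := @is_derive1_comp R expR _ x _ _ (is_derive_expR _) di.
have h2 := @is_deriveZ _ _ _ _ (normal_peak s) _ _ _ h.
have -> : normal_peak s \o* (expR \o (fun x => - (x ^+ 2 / (2 * s ^+ 2)))) =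
  normal_peak s *: (expR \o (fun x => - (x ^+ 2 / (2 * s ^+ 2)))).
  by apply/funext => y; rewrite /= !fctE /GRing.scale/= mulrC.
by apply: (is_derive_eq h2); rewrite /= !fctE /GRing.scale/=; ring.
Qed.

(** Ratio needed to dominate [(1 + x ^+ 2)] times the density by the density with deviation [2 * s].
    The exponentials differ by [expR (3 x^2 / (8 s^2)) >= 1 + 3 x^2 / (8 s^2)], which [1 + 8 s^2]
    lifts above [1 + x ^+ 2]; the peaks correct the normalisations. *)
Definition normal_decay_cst : R := (1 + 8 * s ^+ 2) * normal_peak s / normal_peak (2 * s).

Lemma normal_pdf_moment (x : R) :
  (1 + x ^+ 2) * phi x <= normal_decay_cst * normal_pdf 0 (2 * s) x.
Proof.
have s2n0 : 2 * s != 0 by rewrite mulf_neq0.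
rewrite normal_pdf0E normal_pdfE// /normal_fun subr0 /normal_decay_cst.
rewrite [leRHS]mulrA mulfVK ?gt_eqF ?normal_peak_gt0//.
rewrite mulrCA [leRHS]mulrAC [leRHS]mulrC ler_wpM2l ?normal_peak_ge0//.
have -> : - x ^+ 2 / ((2 * s) ^+ 2 *+ 2) =
   - (x ^+ 2 / (2 * s ^+ 2)) + 3 * x ^+ 2 / (8 * s ^+ 2) by field.
rewrite expRD [leLHS]mulrC [leRHS]mulrCA ler_wpM2l ?expR_ge0//.
have := expR_ge1Dx (3 * x ^+ 2 / (8 * s ^+ 2)) => h.
apply: (@le_trans _ _ ((1 + 8 * s ^+ 2) * (1 + 3 * x ^+ 2 / (8 * s ^+ 2)))); last first.
  by rewrite ler_wpM2l// addr_ge0// mulr_ge0// sqr_ge0.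
have -> : (1 + 8 * s ^+ 2) * (1 + 3 * x ^+ 2 / (8 * s ^+ 2)) =
   1 + 8 * s ^+ 2 + 3 * x ^+ 2 / (8 * s ^+ 2) + 3 * x ^+ 2 by field.
have : 0 <= 3 * x ^+ 2 / (8 * s ^+ 2).
  by rewrite divr_ge0// mulr_ge0// sqr_ge0.
have := sqr_ge0 s; have := sqr_ge0 x; lra.
Qed.

Lemma normal_pdf_decay (x : R) : `|x| * phi x <= normal_decay_cst * normal_pdf 0 (2 * s) x.
Proof.
apply: le_trans (normal_pdf_moment x); rewrite ler_wpM2r ?normal_pdf_ge0//.
rewrite -(real_normK (num_real x)); have := sqr_ge0 (`|x| - 1).
by rewrite sqrrB expr1n mulr1; have := sqr_ge0 `|x|; lra.
Qed.

Lemma integrable_absx_phi : mu.-integrable setT (EFin \o (fun x => `|x| * phi x)).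
Proof.
apply: (@le_integrable _ _ _ mu setT measurableT _
   (EFin \o (fun x => normal_decay_cst * normal_pdf 0 (2 * s) x))).
- by apply/measurable_EFinP/measurable_funM => //; exact: measurable_normal_pdf.
- move=> x _ /=; rewrite lee_fin ger0_norm ?mulr_ge0 ?normal_pdf_ge0//.
  by rewrite (le_trans (normal_pdf_decay x))// ler_norm.
- have -> : (EFin \o (fun x => normal_decay_cst * normal_pdf 0 (2 * s) x)) =
     (fun x => normal_decay_cst%:E * (EFin \o normal_pdf 0 (2 * s)) x)%E.
    by apply/funext => x; rewrite /= EFinM.
  by apply: integrableZl => //; exact: integrable_normal_pdf.
Qed.

Lemma is_derive_sin_affine (t c x : R) :
  is_derive x (1 : R) (fun x => sin (t * x + c)) (t * cos (t * x + c)).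
Proof.
have di : is_derive x (1 : R) (fun x : R => t * x + c) t.
  have -> : (fun x : R => t * x + c) = (t *: (@id R)) + cst c.
    by apply/funext => y.
  by apply: is_derive_eq; rewrite /GRing.scale/= mulr1 addr0.
by apply: (is_derive_eq (@is_derive1_comp R sin _ x _ _ (is_derive_sin _) di)); rewrite mulrC.
Qed.

Lemma is_derive_cos_affine (t c x : R) :
  is_derive x (1 : R) (fun x => cos (t * x + c)) (- (t * sin (t * x + c))).
Proof.
have di : is_derive x (1 : R) (fun x : R => t * x + c) t.
  have -> : (fun x : R => t * x + c) = (t *: (@id R)) + cst c.
    by apply/funext => y.
  by apply: is_derive_eq; rewrite /GRing.scale/= mulr1 addr0.
by apply: (is_derive_eq (@is_derive1_comp R cos _ x _ _ (is_derive_cos _) di));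
  rewrite mulrC mulrN.
Qed.

Lemma continuous_cos_affine (t c : R) : continuous (fun x => cos (t * x + c)).
Proof.
move=> x; apply: differentiable_continuous; apply/derivable1_diffP.
by have [] := is_derive_cos_affine t c x.
Qed.

Lemma continuous_sin_affine (t c : R) : continuous (fun x => sin (t * x + c)).
Proof.
move=> x; apply: differentiable_continuous; apply/derivable1_diffP.
by have [] := is_derive_sin_affine t c x.
Qed.

Lemma measurable_cos_affine (t c : R) : measurable_fun setT (fun x => cos (t * x + c)).
Proof. by apply: continuous_measurable_fun; exact: continuous_cos_affine. Qed.

Lemma measurable_sin_affine (t c : R) : measurable_fun setT (fun x => sin (t * x + c)).
Proof. by apply: continuous_measurable_fun; exact: continuous_sin_affine. Qed.

End NormalDensity.

Lemma is_derive_sumr (R : realType) (J : Type) (s : seq J) (F : J -> R -> R)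
    (F' : J -> R) (t : R) : (forall j, is_derive t (1 : R) (F j) (F' j)) ->
  is_derive t (1 : R) (fun t => \sum_(j <- s) F j t) (\sum_(j <- s) F' j).
Proof.
move=> dF; elim: s => [|j s IH].
  rewrite big_nil; under eq_fun do rewrite big_nil.
  exact: is_derive_cst.
rewrite big_cons; under eq_fun do rewrite big_cons.
exact: (is_deriveD (dF j) IH).
Qed.

Lemma mean_value (R : realType) (f f' : R -> R) :
  (forall x, is_derive x (1 : R) f (f' x)) ->
  forall x y, exists2 z, `|z - x| <= `|y - x| & f y - f x = f' z * (y - x).
Proof.
move=> df x y.
have cf a b : {within `[a, b], continuous f}.
  by apply: derivable_within_continuous => t _; have [] := df t.
have [xy|yx|->] := ltgtP x y; last by exists y; rewrite ?subrr ?normr0 ?mulr0.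
  have [z] := MVT xy (fun t _ => df t) (cf x y).
  rewrite in_itv/= => /andP[xz zy] E; exists z => //.
  by rewrite !ger0_norm ?subr_ge0 ?lerD2r ?ltW// (lt_trans xz).
have [z] := MVT yx (fun t _ => df t) (cf y x).
rewrite in_itv/= => /andP[yz zx] E; exists z => //.
  by rewrite !ler0_norm ?subr_le0 ?lerN2 ?lerD2r ?ltW// (lt_trans yz).
by rewrite -[LHS]opprB E -mulrN opprB.
Qed.

Lemma taylor1_lipschitz (R : realType) (f f' : R -> R) :
  (forall x, is_derive x (1 : R) f (f' x)) ->
  (forall x y, `|f' y - f' x| <= `|y - x|) ->
  forall x y, `|f y - f x - f' x * (y - x)| <= (y - x) ^+ 2.
Proof.
move=> df Lf x y; have [z zx ->] := mean_value df x y.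
rewrite -mulrBl normrM -[leRHS](real_normK (num_real _)) expr2 ler_wpM2r//.
exact: le_trans (Lf x z) zx.
Qed.

Section SinAffine.
Context {R : realType}.
Variables (t c : R).
Hypotheses (t0 : 0 <= t) (t1 : t <= 1).

(** The derivative is [t ^+ 2]-Lipschitz and [t <= 1]; this supplies [phi_taylor] for the Stein
    bound. *)
Lemma sin_affine_taylor (x y : R) :
  `|sin (t * y + c) - sin (t * x + c) - t * cos (t * x + c) * (y - x)| <= (y - x) ^+ 2.
Proof.
apply: (@taylor1_lipschitz R (fun x => sin (t * x + c)) (fun x => t * cos (t * x + c))).
  exact: is_derive_sin_affine.
move=> a b; rewrite -mulrBr normrM ger0_norm//.
have [z _ ->] := mean_value (fun x => is_derive_cos_affine t c x) a b.
rewrite normrM normrN normrM (ger0_norm t0) !mulrA ler_piMl//.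
rewrite mulr_ile1 ?mulr_ge0// ?mulr_ile1//.
exact: sin_max.
Qed.

End SinAffine.

(** * Approximate characteristic functions on the cube *)

Section FiniteCharfun.
Context {R : realType} {I : finType}.
Variable pr : I -> R.
Hypothesis pr01 : forall k, 0 < pr k < 1.
Local Notation cube := {ffun I -> bool}.
Local Notation Ex := (Ex pr).
Variables (Q : nat) (S eta : R).
Hypotheses (S0 : 0 <= S) (eta0 : 0 < eta) (eta1 : eta <= 1).
Variables (d : nat) (q : 'I_d -> nat) (F : 'I_d -> cube -> R) (v : 'I_d -> R).
Hypothesis Fc : forall j, fourth_moment_close pr Q S eta (q j) (F j).
Let W x := \sum_j v j * F j x.

(** The phase [c] lets real cosines carry the whole characteristic function: [c = 0] gives its real
    part and [c = - pi / 2] its imaginary part. The error is that of Stein's method plus the cost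
    [b] of replacing the variance of [W] by [s2]. *)
Lemma charfun_finite (c s2 b : R) : 0 <= s2 ->
  `|Ex (fun x => W x ^+ 2) - s2| <= b ->
  `|Ex (fun x => cos (W x + c)) - expR (- (s2 / 2)) * cos c| <= Kst Q S v * eta + b.
Proof.
move=> s20 Wb.
pose u t := Ex (fun x => cos (t * W x + c)).
pose u' t := - Ex (fun x => W x * sin (t * W x + c)).
have du t : is_derive t (1 : R) u (u' t).
  rewrite /u' -ExN; apply: is_derive_sumr => x.
  have -> : (fun t => (\prod_k wt pr k (x k)) * cos (t * W x + c)) =
     (\prod_k wt pr k (x k)) *: (fun t => cos (W x * t + c)).
    by apply/funext => r; rewrite /GRing.scale/= mulrC [W x * r]mulrC mulrC.
  have h := @is_deriveZ _ _ _ _ (\prod_k wt pr k (x k)) _ _ _ (is_derive_cos_affine (W x) c t).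
  by apply: (is_derive_eq h); rewrite /GRing.scale/= [W x * t]mulrC.
have := @ode_bound R u u' s2 (Kst Q S v * eta + b) s20 du.
have -> : u 1 = Ex (fun x => cos (W x + c)).
  by apply: eq_Ex => x; rewrite mul1r.
have -> : u 0 = cos c.
  by rewrite /u; under eq_Ex do rewrite mul0r add0r; rewrite Ex_cst.
apply => t /andP[/ltW t0 /ltW t1].
have phi1 (x : R) : `|t * cos (t * x + c)| <= 1.
  by rewrite normrM ger0_norm// mulr_ile1// cos_max.
have := stein_bound pr01 S0 eta0 eta1 v Fc phi1 (sin_affine_taylor c t0 t1).
rewrite -/W (_ : Ex (fun x => t * cos (t * W x + c)) = t * u t); last by rewrite -ExZ.
move=> h.
have ut1 : `|u t| <= 1.
  rewrite (le_trans (ler_norm_Ex pr01 _))// -[leRHS](Ex_cst pr 1).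
  by apply: (ler_Ex pr01) => x; exact: cos_max.
have -> : u' t + s2 * t * u t =
   - (Ex (fun x => W x * sin (t * W x + c)) - Ex (fun x => W x ^+ 2) * (t * u t))
   - (Ex (fun x => W x ^+ 2) - s2) * (t * u t) by rewrite /u'; ring.
rewrite (le_trans (ler_normB _ _))// normrN lerD//.
rewrite normrM -[leRHS]mulr1; apply: ler_pM => //.
by rewrite normrM ger0_norm// mulr_ile1.
Qed.

End FiniteCharfun.

(** Integration over [[-(n + 1), n + 1]] leaves boundary terms of order [C / (n + 1)], and dominated
    convergence passes to the whole line. This is the vanishing boundary term of Gaussian
    integration by parts. *)
Lemma integral_derivative_eq0 (R : realType) (F f : R -> R) (C : R) :
  (forall x, is_derive x (1 : R) F (f x)) -> continuous f ->
  (@lebesgue_measure R).-integrable setT (EFin \o f) ->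
  (forall x, `|x| * `|F x| <= C) ->
  (\int[@lebesgue_measure R]_x (f x)%:E = 0)%E.
Proof.
move=> dF cf intf FC.
pose D (n : nat) : set R := `[- n.+1%:R, n.+1%:R]%classic.
pose f_ n := (EFin \o f) \_ (D n).
have mf : measurable_fun setT (EFin \o f) by exact: (measurable_int lebesgue_measure).
have lim x : f_ n x @[n --> \oo] --> (EFin \o f) x.
  apply: cvg_near_cst; near=> n; rewrite /f_ patchE ifT//.
  rewrite inE /D /= in_itv/= -ler_norml.
  rewrite (@le_trans _ _ n%:R)//; last by rewrite ler_nat.
  by near: n; exact: nbhs_infty_ger.
have mf_ n : measurable_fun setT (f_ n).
  have mD : measurable (D n) by rewrite /D; exact: measurable_itv.
  by apply/(measurable_restrictT _ mD); exact: measurable_funTS.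
have dom x n : setT x -> (`|f_ n x| <= (abse \o (EFin \o f)) x)%E.
  by move=> _; rewrite /f_ patchE; case: ifP => // _; rewrite abse0 /= lee_fin.
have [|||||_ _ cv] := @dominated_convergence _ _ _ (@lebesgue_measure R) setT measurableT
  f_ (EFin \o f) (abse \o (EFin \o f)).
- exact: mf_.
- exact: mf.
- by apply: aeW => x _; exact: lim.
- exact: integrable_abse.
- by apply: aeW => x n _; exact: dom.
have FD n : (\int[@lebesgue_measure R]_x f_ n x)%E = (F n.+1%:R - F (- n.+1%:R))%:E.
  rewrite -integral_mkcond.
  have lt : - n.+1%:R < n.+1%:R :> R by rewrite -subr_gt0 opprK addr_gt0.
  have cF x : {for x, continuous F}.
    by apply: differentiable_continuous; apply/derivable1_diffP; have [] := dF x.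
  rewrite (@continuous_FTC2 _ f F)//.
  - exact: continuous_subspaceT.
  - split.
    + by move=> x _; have [] := dF x.
    + by apply: cvg_at_right_filter; exact: cF.
    + by apply: cvg_at_left_filter; exact: cF.
  - by move=> x _; rewrite derive1E; have [_ ->] := dF x.
have C0 : 0 <= C by apply: le_trans (FC 0); rewrite mulr_ge0.
have z : (fun n => (F n.+1%:R - F (- n.+1%:R))%:E) @ \oo --> (0 : \bar R)%E.
  apply/cvg_EFin; first exact: nearW.
  apply/norm_cvg0P.
  apply: (@squeeze_cvgr _ _ _ _ (cst 0) (fun n => (2 * C) * (n.+1%:R)^-1)).
  - apply: nearW => n; rewrite normr_ge0/= ler_pdivlMr//.
    have h1 := FC n.+1%:R; rewrite (ger0_norm (ler0n R _)) in h1.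
    have h2 := FC (- n.+1%:R); rewrite normrN (ger0_norm (ler0n R _)) in h2.
    have := ler_normB (F n.+1%:R) (F (- n.+1%:R)).
    move=> /(ler_wpM2r (ler0n R n.+1)) => h; lra.
  - exact: cvg_cst.
  - rewrite -[X in _ --> X](mulr0 (2 * C)); apply: cvgMr.
    exact: cvg_harmonic.
rewrite (eq_cvg _ _ FD) in cv; exact: (cvg_unique (@ereal_hausdorff R) cv z).
Unshelve. all: end_near. Qed.

Section NormalStein.
Context {R : realType}.
Variable s : R.
Hypothesis s0 : 0 < s.
Local Notation mu := (@lebesgue_measure R).
Local Notation phi := (normal_pdf 0 s).

Lemma integrable_bdd_phi (h : R -> R) (M : R) : measurable_fun setT h ->
  (forall x, `|h x| <= M) -> mu.-integrable setT (EFin \o (fun x => h x * phi x)).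
Proof.
move=> mh hM; apply: (@integrable_bddM _ _ R mu h phi M) => //; exact: integrable_normal_pdf.
Qed.

Lemma integrable_x_bdd_phi (h : R -> R) (M : R) : measurable_fun setT h ->
  (forall x, `|h x| <= M) -> mu.-integrable setT (EFin \o (fun x => h x * (x * phi x))).
Proof.
move=> mh hM; apply: (@integrable_bddM _ _ R mu h (fun x => x * phi x) M) => //.
apply: (@le_integrable _ _ _ mu setT measurableT _ (EFin \o (fun x => `|x| * phi x))).
- by apply/measurable_EFinP/measurable_funM => //; exact: measurable_normal_pdf.
- by move=> x _ /=; rewrite lee_fin !normrM normr_id.
- exact: integrable_absx_phi.
Qed.

(** The function [sin (t x + c) * phi x] has a derivative of integral zero, and
    [phi' = - x phi / s^2]. *)
Lemma normal_stein (t c : R) :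
  \int[mu]_x (sin (t * x + c) * (x * phi x)) =
  t * s ^+ 2 * \int[mu]_x (cos (t * x + c) * phi x).
Proof.
have sn0 : s != 0 by rewrite gt_eqF.
pose F x := sin (t * x + c) * phi x.
pose f x := t * (cos (t * x + c) * phi x) - s ^- 2 * (sin (t * x + c) * (x * phi x)).
have dF x : is_derive x (1 : R) F (f x).
  have h := @is_deriveM _ _ (fun x => sin (t * x + c)) phi x 1 _ _
     (is_derive_sin_affine t c x) (is_derive_normal_pdf s0 x).
  by apply: (is_derive_eq h); rewrite /f /GRing.scale/=; field.
have i1 := integrable_bdd_phi (measurable_cos_affine t c) (fun x => cos_max (t * x + c)).
have i2 := integrable_x_bdd_phi (measurable_sin_affine t c) (fun x => sin_max (t * x + c)).
have j1 : mu.-integrable setT (EFin \o (fun x => t * (cos (t * x + c) * phi x))).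
  have := integrableZl measurableT t i1.
  by apply: eq_integrable => // x _; rewrite /= EFinM.
have j2 : mu.-integrable setT (EFin \o (fun x => s ^- 2 * (sin (t * x + c) * (x * phi x)))).
  have := integrableZl measurableT (s ^- 2) i2.
  by apply: eq_integrable => // x _; rewrite /= EFinM.
have cphi x : {for x, continuous phi} by apply: continuous_normal_pdf.
have cf : continuous f.
  move=> x; apply: (@cvgB _ R^o); apply: (@cvgM R); (try exact: cvg_cst); apply: (@cvgM R).
  - exact: continuous_cos_affine.
  - exact: cphi.
  - exact: continuous_sin_affine.
  - by apply: (@cvgM R); [exact: cvg_id|exact: cphi].
have int0 : (\int[mu]_x (f x)%:E = 0)%E.
  apply: (@integral_derivative_eq0 _ F f (normal_decay_cst s * normal_peak (2 * s))) => //.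
    have := integrableB measurableT j1 j2.
    by apply: eq_integrable => // x _; rewrite /f /= EFinB.
  move=> x; rewrite /F normrM (ger0_norm (normal_pdf_ge0 _ _ _)).
  apply: (@le_trans _ _ (`|x| * phi x)).
    by rewrite ler_wpM2l// ler_piMl ?normal_pdf_ge0// sin_max.
  apply: le_trans (normal_pdf_decay s0 x) _; apply: ler_wpM2l.
    by rewrite /normal_decay_cst divr_ge0 ?normal_peak_ge0// mulr_ge0 ?normal_peak_ge0// addr_ge0// mulr_ge0// sqr_ge0.
  by apply: normal_pdf_ub; rewrite mulf_neq0.
have : \int[mu]_x f x = 0 by rewrite /Rintegral int0.
rewrite /f RintegralB// !RintegralZl// => /eqP; rewrite subr_eq0 => /eqP E.
have s2 : s ^+ 2 != 0 by rewrite expf_neq0.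
by rewrite -[in RHS]mulrA [in RHS]mulrCA E mulVKf.
Qed.

End NormalStein.

Section NormalCharacteristicFunction.
Context {R : realType}.
Variable s : R.
Hypothesis s0 : 0 < s.
Local Notation mu := (@lebesgue_measure R).
Local Notation phi := (normal_pdf 0 s).

Lemma is_derive_normal_cos (c t : R) :
  is_derive t (1 : R) (fun t => \int[mu]_x (cos (t * x + c) * phi x))
    (- (t * s ^+ 2 * \int[mu]_x (cos (t * x + c) * phi x))).
Proof.
pose f (t x : R) := cos (t * x + c) * phi x.
have df (t' x : R) : is_derive t' (1 : R) (f ^~ x) (- (sin (t' * x + c) * (x * phi x))).
  have -> : f ^~ x = phi x *: (fun t => cos (x * t + c)).
    by apply/funext => y; rewrite /f /GRing.scale/= mulrC [x * y]mulrC.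
  have h := @is_deriveZ _ _ _ _ (phi x) _ _ _ (is_derive_cos_affine x c t').
  by apply: (is_derive_eq h); rewrite /GRing.scale/= [x * t']mulrC; ring.
have It : (`]t - 1, t + 1[%classic : set R) t.
  by rewrite /= in_itv/=; apply/andP; split; lra.
have intf t' : (`]t - 1, t + 1[%classic : set R) t' -> mu.-integrable setT (EFin \o f t').
  move=> _; apply: (@integrable_bdd_phi R s (fun x => cos (t' * x + c)) 1).
    exact: measurable_cos_affine.
  by move=> x; exact: cos_max.
have der t' x : (`]t - 1, t + 1[%classic : set R) t' -> setT x -> derivable (f ^~ x) t' 1.
  by move=> _ _; have [] := df t' x.
have G0 x : 0 <= `|x| * phi x by rewrite mulr_ge0// normal_pdf_ge0.
have Gub t' x : (`]t - 1, t + 1[%classic : set R) t' -> setT x ->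
    `|partial1of2 f t' x| <= `|x| * phi x.
  move=> _ _; rewrite partial1of2E; have [_ ->] := df t' x.
  rewrite normrN !normrM (ger0_norm (normal_pdf_ge0 _ _ _)).
  by rewrite ler_piMl// sin_max.
have D := derivable_under_integral measurableT It intf der G0 (integrable_absx_phi s0) Gub.
have E := differentiation_under_integral measurableT It intf der G0 (integrable_absx_phi s0) Gub.
apply: DeriveDef; first exact: D.
rewrite -derive1E E -(normal_stein s0).
transitivity (\int[mu]_x ((-1) * (sin (t * x + c) * (x * phi x)))).
  apply: eq_Rintegral => x _; rewrite partial1of2E; have [_ ->] := df t x.
  by rewrite mulN1r.
rewrite RintegralZl ?mulN1r//.
apply: (@integrable_x_bdd_phi R s s0 (fun x => sin (t * x + c)) 1).
  exact: measurable_sin_affine.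
by move=> x; exact: sin_max.
Qed.

(** For the Gaussian law the differential equation is exact, so [ode_bound] applies with
    [delta = 0]. *)
Lemma normal_cos (c : R) :
  \int[mu]_x (cos (x + c) * phi x) = expR (- (s ^+ 2 / 2)) * cos c.
Proof.
have := @ode_bound R _ _ (s ^+ 2) 0 (sqr_ge0 s) (is_derive_normal_cos c).
have h t : 0 < t < 1 -> `|- (t * s ^+ 2 * \int[mu]_x (cos (t * x + c) * phi x)) +
   s ^+ 2 * t * \int[mu]_x (cos (t * x + c) * phi x)| <= 0.
  by move=> _; rewrite [s ^+ 2 * t]mulrC addNr normr0.
move=> /(_ h); rewrite normr_le0 subr_eq0 => /eqP.
under eq_Rintegral do rewrite mul1r.
move=> ->; congr (_ * _).
under eq_Rintegral do rewrite mul0r add0r.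
rewrite RintegralZl//; last exact: integrable_normal_pdf.
by rewrite /Rintegral integral_normal_pdf mulr1.
Qed.

Lemma integral_normal_prob (h : R -> R) (M : R) : measurable_fun setT h ->
  (forall x, `|h x| <= M) ->
  (\int[normal_prob 0 s]_x (h x)%:E = \int[mu]_x (h x * phi x)%:E)%E.
Proof.
move=> mh hM.
have ih : (normal_prob 0 s).-integrable setT (EFin \o h).
  apply: measurable_bounded_integrable => //.
    by rewrite (le_lt_trans (probability_le1 _ _))// ltry.
  by exists M; split; [exact: num_real|move=> y My x _; exact: le_trans (hM x) (ltW My)].
under [RHS]eq_integral do rewrite EFinM.
rewrite -(Radon_Nikodym_change_of_variables (normal_prob_dominates 0 s))//=.
apply: ae_eq_integral => //.
- apply: emeasurable_funM => //; first exact/measurable_EFinP.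
  apply: (measurable_int mu).
  by apply: Radon_Nikodym_integrable; exact: normal_prob_dominates.
- apply: emeasurable_funM; first exact/measurable_EFinP.
  by apply/measurable_EFinP; exact: measurable_normal_pdf.
- apply: ae_eqe_mul2l => /=.
  rewrite Radon_NikodymE//=; first exact: normal_prob_dominates.
  move=> abmu; case: cid => /= g [h1 h2 h3].
  apply: integral_ae_eq => //=.
  + by apply/measurable_EFinP; exact: measurable_normal_pdf.
  + by move=> E E01 mE; rewrite -h3.
Qed.

End NormalCharacteristicFunction.

Lemma centered_normal_cos d (T : measurableType d) (R : realType)
    (P : probability T R) (W : T -> R) (v c : R) : 0 <= v ->
  measurable_fun setT W ->
  (forall B, measurable B -> P [set w | B (W w)] = centered_normal v B) ->
  \int[P]_w cos (W w + c) = expR (- (v / 2)) * cos c.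
Proof.
move=> v0 mW PW.
have mc : measurable_fun setT (fun x : R => cos (x + c)).
  by have := measurable_cos_affine 1 c; under eq_fun do rewrite mul1r.
have bc (x : R) : `|cos (x + c)| <= 1 by exact: cos_max.
have mW' : measurable_fun setT (W : T -> measurableTypeR R) by exact: mW.
have E : (\int[P]_w (cos (W w + c))%:E =
    \int[pushforward P (W : T -> measurableTypeR R)]_x (cos (x + c))%:E)%E.
  rewrite integral_pushforward//; first exact/measurable_EFinP.
  rewrite preimage_setT.
  apply: measurable_bounded_integrable => //.
  - by rewrite (le_lt_trans (probability_le1 _ _))// ltry.
  - exact: (measurableT_comp mc).
  - by exists 1; split; [exact: num_real|move=> y My x _; exact: le_trans (bc _) (ltW My)].
rewrite /Rintegral E.
have [v00|vn0] := eqVneq v 0.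
  rewrite (eq_measure_integral (dirac (0 : measurableTypeR R))); last first.
    by move=> A mA _; have := PW A mA; rewrite /centered_normal v00 eqxx.
  rewrite integral_dirac//; last exact/measurable_EFinP.
  by rewrite diracT mul1e/= add0r v00 mul0r oppr0 expR0 mul1r.
have s0 : 0 < Num.sqrt v by rewrite sqrtr_gt0 lt_neqAle eq_sym vn0.
transitivity (fine (\int[normal_prob 0 (Num.sqrt v)]_x (cos (x + c))%:E)).
  congr fine; apply: eq_measure_integral => A mA _.
  by have := PW A mA; rewrite /centered_normal (negPf vn0).
rewrite (integral_normal_prob _ mc bc); have := normal_cos s0 c; rewrite /Rintegral => ->.
by rewrite sqr_sqrtr.
Qed.

(** * Convergence in distribution from trigonometric polynomials *)

Section Trigonometric.
Context {R : realType} {m : nat}.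
Local Notation V := 'cV[R]_m.
Implicit Types (f g h : V -> R) (v x y : V).

Definition dotp v x : R := \sum_j v j 0 * x j 0.

(** The phase makes sines available, so that the class is an algebra ([trigpM]) with constants. *)
Inductive trigp : (V -> R) -> Prop :=
| trigp_cos v c : trigp (fun x => cos (dotp v x + c))
| trigpD f g : trigp f -> trigp g -> trigp (fun x => f x + g x)
| trigpZ a f : trigp f -> trigp (fun x => a * f x).

Lemma dotpD v w x : dotp (v + w) x = dotp v x + dotp w x.
Proof. by rewrite -big_split; apply: eq_bigr => j _; rewrite mxE mulrDl. Qed.

Lemma dotpN v x : dotp (- v) x = - dotp v x.
Proof. by rewrite -sumrN; apply: eq_bigr => j _; rewrite mxE mulNr. Qed.

Lemma trigpM f g : trigp f -> trigp g -> trigp (fun x => f x * g x).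
Proof.
elim=> [v c|f1 f2 _ IH1 _ IH2|a f1 _ IH] tg.
- elim: tg => [w e|g1 g2 _ IH1 _ IH2|a g1 _ IH].
  + have -> : (fun x => cos (dotp v x + c) * cos (dotp w x + e)) =
      (fun x => 2^-1 * (cos (dotp (v + w) x + (c + e)) + cos (dotp (v - w) x + (c - e)))).
      apply/funext => x; rewrite !dotpD dotpN.
      rewrite [dotp v x + dotp w x + _]addrACA.
      rewrite [dotp v x - dotp w x + _]addrACA -opprD.
      move: (dotp v x + c) (dotp w x + e) => a b; rewrite cosD cosB.
      by field.
    exact/trigpZ/trigpD/trigp_cos/trigp_cos.
  + by under eq_fun do rewrite mulrDr; exact: trigpD.
  + by under eq_fun do rewrite mulrCA; exact: trigpZ.
- by under eq_fun do rewrite mulrDl; exact: trigpD (IH1 tg) (IH2 tg).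
- by under eq_fun do rewrite -mulrA; exact: trigpZ (IH tg).
Qed.

Lemma trigp_cst a : trigp (fun=> a).
Proof.
have -> : (fun=> a) = (fun x : V => a * cos (dotp 0 x + 0)).
  apply/funext => x; rewrite addr0 /dotp big1 ?cos0 ?mulr1// => j _.
  by rewrite mxE mul0r.
exact/trigpZ/trigp_cos.
Qed.

Lemma trigp_bounded f : trigp f -> exists2 B, 0 < B & forall x, `|f x| <= B.
Proof.
elim=> [v c|f1 f2 _ [B1 B10 h1] _ [B2 B20 h2]|a f1 _ [B B0 h]].
- by exists 1 => // x; exact: cos_max.
- exists (B1 + B2); first exact: addr_gt0.
  by move=> x; rewrite (le_trans (ler_normD _ _))// lerD.
- exists (`|a| * B + 1); first by rewrite ltr_wpDl// mulr_ge0// ltW.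
  by move=> x; rewrite normrM ler_wpDr// ler_wpM2l.
Qed.

Lemma continuous_dotp v : continuous (dotp v).
Proof.
change (continuous (fun x : V => \sum_j v j 0 * x j 0)).
apply: continuous_big; first exact: add_continuous.
move=> j _ x; apply: (@continuousM R V (fun=> v j 0) (fun x => x j 0)).
  exact: cst_continuous.
exact: coord_continuous.
Qed.

Lemma continuous_trigp f : trigp f -> continuous f.
Proof.
elim=> [v c|f1 f2 _ h1 _ h2|a f1 _ h] x.
- apply: (@continuous_comp _ _ _ (fun x => dotp v x + c) (@cos R)).
    apply: (@continuousD R R^o V (dotp v) (fun=> c)); last exact: cst_continuous.
    exact: (@continuous_dotp v x).
  exact: continuous_cos.
- by apply: (@continuousD R R^o V f1 f2); [exact: h1|exact: h2].
- by apply: (@continuousM R V (fun=> a) f1); [exact: cst_continuous|exact: h].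
Qed.

(* Newton-type iteration for [|x| = sqrt (x ^ 2)], as a polynomial in [x]. *)
Fixpoint abs_iter (k : nat) (x : R) : R :=
  if k is k'.+1 then abs_iter k' x + (x ^+ 2 - abs_iter k' x ^+ 2) / 2 else 0.

(** With [a = |x|] and iterate [p], one step multiplies the error [a - p] by
    [1 - (a + p) / 2 <= 1 - a / 2]. The invariant survives since [(1 - a / 2) * (1 + (k + 1) * a /
    2) <= 1 + k * a / 2]; it yields a rate in [1 / k] that is uniform near 0. *)
Lemma abs_iterP k (x : R) : `|x| <= 1 ->
  0 <= abs_iter k x <= `|x| /\ (`|x| - abs_iter k x) * (1 + k%:R * `|x| / 2) <= `|x|.
Proof.
elim: k => [|k IH] x1 /=; first by rewrite lexx normr_ge0 subr0 mul0r mul0r addr0 mulr1.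
have {IH} := IH x1; rewrite -[x ^+ 2](real_normK (num_real x)).
set p := abs_iter k x; move: (`|x|) (normr_ge0 x) x1 => a a0 a1 [/andP[p0 pa] H].
have e1 : a - (p + (a ^+ 2 - p ^+ 2) / 2) = (a - p) * (1 - (a + p) / 2) by field.
have ap : 0 <= a - p by rewrite subr_ge0.
have fac : 0 <= 1 - (a + p) / 2 by lra.
split.
  rewrite -[_ <= a]subr_ge0 e1 mulr_ge0// andbT addr_ge0// divr_ge0// subr_ge0.
  by rewrite lerXn2r.
rewrite e1; apply: le_trans H; rewrite -mulrA ler_wpM2l//.
have k0 : 0 <= k%:R :> R by [].
have kk : k.+1%:R = k%:R + 1 :> R by rewrite -natr1.
apply: (@le_trans _ _ ((1 - a / 2) * (1 + k.+1%:R * a / 2))).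
  by rewrite ler_wpM2r; [|rewrite addr_ge0// divr_ge0// mulr_ge0|lra].
rewrite kk -subr_ge0.
have -> : 1 + k%:R * a / 2 - (1 - a / 2) * (1 + (k%:R + 1) * a / 2) = (k%:R + 1) * a ^+ 2 / 4.
  by field.
by rewrite divr_ge0// mulr_ge0// ?sqr_ge0// addr_ge0.
Qed.

Lemma abs_iter_close k (x : R) : `|x| <= 1 -> (0 < k)%N ->
  `| `|x| - abs_iter k x | <= 2 / k%:R.
Proof.
move=> x1 k0; have [/andP[p0 pa] H] := abs_iterP k x1.
have kR : 0 < k%:R :> R by rewrite ltr0n.
rewrite ger0_norm ?subr_ge0// ler_pdivlMr//.
have [x0|xn0] := eqVneq `|x| 0.
  by rewrite x0 in pa *; rewrite (@le_trans _ _ 0)// pmulr_lle0// subr_le0.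
have x0 : 0 < `|x| by rewrite lt_neqAle eq_sym xn0/=.
rewrite -(ler_pM2l x0).
have : 0 <= `|x| - abs_iter k x by rewrite subr_ge0.
move: H; set z := _ - _ => H z0.
by have := mulr_ge0 z0 (ltW x0); rewrite mulrDr mulr1 in H; lra.
Qed.

Lemma trigp_abs_iter k f : trigp f -> trigp (fun x => abs_iter k (f x)).
Proof.
move=> tf; elim: k => [|k IH] /=; first exact: trigp_cst.
apply: trigpD => //; under eq_fun do rewrite mulrC expr2 expr2 -mulN1r.
by apply: trigpZ; apply: trigpD; [exact: trigpM|exact/trigpZ/trigpM].
Qed.

(** Approximation is uniform on the whole space, not just on compact sets, so expectations are
    compared without a tail term. *)
Definition tapprox f := forall e, 0 < e -> exists2 g, trigp g & forall x, `|f x - g x| <= e.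

Lemma trigp_tapprox f : trigp f -> tapprox f.
Proof. by move=> tf e e0; exists f => // x; rewrite subrr normr0 ltW. Qed.

Lemma tapproxD f g : tapprox f -> tapprox g -> tapprox (fun x => f x + g x).
Proof.
move=> tf tg e e0; have e20 : 0 < e / 2 by rewrite divr_gt0.
have [f1 tf1 h1] := tf _ e20; have [g1 tg1 h2] := tg _ e20.
exists (fun x => f1 x + g1 x); first exact: trigpD.
move=> x; rewrite opprD addrACA (le_trans (ler_normD _ _))//.
by rewrite [leRHS]splitr lerD.
Qed.

Lemma tapproxZ a f : tapprox f -> tapprox (fun x => a * f x).
Proof.
move=> tf e e0; have a0 : 0 < `|a| + 1 by rewrite ltr_wpDl.
have [g tg h] := tf _ (divr_gt0 e0 a0).
exists (fun x => a * g x); first exact: trigpZ.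
move=> x; rewrite -mulrBr normrM.
have := h x; rewrite ler_pdivlMr// => H; apply: le_trans H.
by rewrite mulrC ler_wpM2l// lerDl.
Qed.

Lemma tapprox_abs f : tapprox f -> tapprox (fun x => `|f x|).
Proof.
move=> tf e e0; have e20 : 0 < e / 2 by rewrite divr_gt0.
have [g tg h] := tf _ e20; have [B B0 gB] := trigp_bounded tg.
(* With this [k] the error [B * (2 / k)] of the rescaled iteration is at most [e / 2]. *)
pose k := (Num.truncn (4 * B / e)).+1.
have kR : 0 < k%:R :> R by rewrite ltr0n.
exists (fun x => B * abs_iter k (B^-1 * g x)).
  by apply: trigpZ; apply: trigp_abs_iter; exact: trigpZ.
move=> x; have -> : `|f x| - B * abs_iter k (B^-1 * g x) =
   (`|f x| - `|g x|) + B * (`|B^-1 * g x| - abs_iter k (B^-1 * g x)).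
  rewrite mulrBr normrM (gtr0_norm (_ : 0 < B^-1)) ?invr_gt0// mulVKf ?gt_eqF//.
  ring.
rewrite (le_trans (ler_normD _ _))// [leRHS]splitr lerD//.
  by rewrite (le_trans (ler_dist_dist _ _)).
rewrite normrM gtr0_norm//.
apply: (@le_trans _ _ (B * (2 / k%:R))).
  rewrite ler_wpM2l ?(ltW B0)// abs_iter_close//.
  by rewrite normrM (gtr0_norm (_ : 0 < B^-1)) ?invr_gt0// ler_pdivrMl// mulr1.
rewrite mulrA ler_pdivrMr//.
have : 4 * B / e <= k%:R by rewrite ltW// /k; apply: truncnS_gt.
by rewrite ler_pdivrMr//; lra.
Qed.

Lemma tapprox_max f g : tapprox f -> tapprox g -> tapprox (fun x => Num.max (f x) (g x)).
Proof.
move=> tf tg; under eq_fun do rewrite maxr_absE mulrC.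
apply: tapproxZ; apply: tapproxD; first exact: tapproxD.
apply: tapprox_abs; under eq_fun do rewrite -mulN1r.
by apply: tapproxD => //; exact: tapproxZ.
Qed.

Lemma tapprox_foldr_max (I : Type) (s : seq I) (a : R) (F : I -> V -> R) :
  (forall i, tapprox (F i)) ->
  tapprox (fun x => foldr (fun i z => Num.max (F i x) z) a s).
Proof.
move=> tF; elim: s => [|i s IH] /=; first exact/trigp_tapprox/trigp_cst.
exact: tapprox_max.
Qed.

End Trigonometric.

Section Approximation.
Context {R : realType} {m : nat}.
Local Notation V := 'cV[R]_m.
Implicit Types (f g h : V -> R) (v x y : V).

Definition cube (L : R) : set V := [set x | forall j, `|x j 0| <= L].

Lemma continuous_trmx : continuous (fun v : 'rV[R]_m => v^T).
Proof.
move=> x A /nbhs_ballP[e /= e0 xA].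
apply: (filterS _ (nbhsx_ballx x e e0)) => y xy; apply: xA; split=> // i j.
by rewrite !mxE; exact: xy.2.
Qed.

Lemma compact_cube L : compact (cube L).
Proof.
have -> : cube L = (fun v : 'rV[R]_m => v^T) @`
    [set v : 'rV[R]_m | forall i, (fun=> `[(- L), L]%classic) i (v ord0 i)].
  apply/seteqP; split => [x xL|_ [v vL <-] j].
    exists x^T; last by rewrite trmxK.
    by move=> i; rewrite /= in_itv/= -ler_norml mxE.
  by have := vL j; rewrite /= in_itv/= -ler_norml mxE.
apply: continuous_compact; first exact/continuous_subspaceT/continuous_trmx.
apply: (@rV_compact R m (fun=> `[(- L), L]%classic)) => i.
exact: segment_compact.
Qed.

(* A trigonometric substitute for the squared distance to [y]. *)
Definition cosdist (L : R) y x : R := \sum_j (1 - cos (L^-1 * (x j 0 - y j 0))).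

Lemma cosdist_ge0 L y x : 0 <= cosdist L y x.
Proof. by apply: sumr_ge0 => j _; rewrite subr_ge0 cos_le1. Qed.

Lemma cosdist_self L y : cosdist L y y = 0.
Proof. by rewrite /cosdist big1// => j _; rewrite subrr mulr0 cos0 subrr. Qed.

Lemma trigp_sum (F : 'I_m -> V -> R) : (forall j, trigp (F j)) ->
  trigp (fun x => \sum_j F j x).
Proof.
move=> tF; elim: (index_enum _) => [|i s IH].
  by under eq_fun do rewrite big_nil; exact: trigp_cst.
by under eq_fun do rewrite big_cons; exact: trigpD.
Qed.

Lemma trigp_cosdist L y : trigp (cosdist L y).
Proof.
apply: trigp_sum => j; apply: trigpD; first exact: trigp_cst.
have -> : (fun x => - cos (L^-1 * (x j 0 - y j 0))) =
   (fun x => -1 * cos (dotp (\col_i (if i == j then L^-1 else 0)) x + - (L^-1 * y j 0))).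
  apply/funext => x; rewrite mulN1r /dotp (bigD1 j)//= mxE eqxx big1 ?addr0 ?mulrBr//.
  by move=> i /negPf ij; rewrite mxE ij mul0r.
exact/trigpZ/trigp_cos.
Qed.

(** Dividing by [L] keeps the moduli of the coordinate differences in [[0, 2]], hence in [[0, pi]],
    where the cosine decreases: inside the cube, periodicity is invisible. *)
Lemma cosdist_lower L delta x y : 0 < L -> 0 < delta -> delta <= L ->
  cube L x -> cube L y -> (exists j, delta <= `|x j 0 - y j 0|) ->
  1 - cos (delta / L) <= cosdist L y x.
Proof.
move=> L0 d0 dL xL yL [j dj]; rewrite /cosdist (bigD1 j)//= ler_wpDr//.
  by apply: sumr_ge0 => i _; rewrite subr_ge0 cos_le1.
rewrite lerD2l lerN2 -[cos (_ * _)]cos_norm normrM gtr0_norm ?invr_gt0// mulrC.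
have pi2 := pi_ge2 R.
have dL1 : delta / L <= 1 by rewrite ler_pdivrMr// mul1r.
have dL0 : 0 <= delta / L by rewrite divr_ge0// ltW.
have b2 : `|x j 0 - y j 0| / L <= 2.
  rewrite ler_pdivrMr//; have := ler_normB (x j 0) (y j 0).
  by have := xL j; have := yL j; lra.
have b1 : delta / L <= `|x j 0 - y j 0| / L by rewrite ler_wpM2r// invr_ge0 ltW.
have [->//|ne] := eqVneq (delta / L) (`|x j 0 - y j 0| / L).
rewrite ltW// ltr_cos ?in_itv/= ?lt_neqAle ?ne ?b1//; apply/andP; split; lra.
Qed.

Lemma cos_small_lt1 (t : R) : 0 < t -> t <= 1 -> cos t < 1.
Proof.
move=> t0 t1; have pi2 := pi_ge2 R.
by rewrite -[X in _ < X]cos0 ltr_cos ?in_itv/=//; apply/andP; split; lra.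
Qed.

(* By compactness of the cube, [g] is there a finite maximum of functions
   [x |-> g y - C y * cosdist L y x], up to [e]; [tapprox] is stable under maxima. *)
Lemma tapprox_cube g M L e : continuous g -> 0 < M -> (forall x, `|g x| <= M) ->
  0 < L -> 0 < e ->
  exists f, [/\ tapprox f, forall x, `|f x| <= M &
                forall x, cube L x -> `|f x - g x| <= e].
Proof.
move=> cg M0 gM L0 e0.
have exC y : exists C, 0 <= C /\ (cube L y ->
    forall x, cube L x -> g y - C * cosdist L y x <= g x + e).
  have /cvgrPdist_le/(_ _ e0) : g x @[x --> y] --> g y by exact: cg.
  move=> /nbhs_ballP[r /= r0 hr].
  pose delta := Num.min (r / 2) L.
  have r20 : 0 < r / 2 by rewrite divr_gt0.
  have d0 : 0 < delta by rewrite lt_min r20.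
  have dL : delta <= L by rewrite ge_min lexx orbT.
  have dr : delta < r by rewrite gt_min; apply/orP; left; lra.
  have c1 : 0 < 1 - cos (delta / L).
    rewrite subr_gt0 cos_small_lt1 ?divr_gt0// ler_pdivrMr// mul1r//.
  (* Once some coordinate is at distance at least [delta] from that of [y], the penalty reaches
     [2 * M], the largest possible oscillation of [g]. *)
  exists (2 * M / (1 - cos (delta / L))); split.
    by rewrite divr_ge0 ?mulr_ge0 ?ltW.
  move=> yL x xL; have [near_y|far] := pselect (forall j, `|x j 0 - y j 0| < r).
    have /hr : ball y r x.
      by split=> // i j; rewrite /ball/= (ord1 j) distrC.
    rewrite ler_norml => /andP[_ h].
    have := cosdist_ge0 L y x => c0.
    have : 0 <= 2 * M / (1 - cos (delta / L)) * cosdist L y x.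
      by rewrite mulr_ge0// divr_ge0 ?mulr_ge0 ?ltW.
    lra.
  have : 1 - cos (delta / L) <= cosdist L y x.
    apply: cosdist_lower => //; apply: contrapT => nex; apply: far => j.
    rewrite ltNge; apply/negP => rj; apply: nex; exists j.
    by rewrite (le_trans (ltW dr)).
  move=> h; have : 2 * M <= 2 * M / (1 - cos (delta / L)) * cosdist L y x.
    by rewrite mulrAC ler_pdivlMr// ler_wpM2l// mulr_ge0// ltW.
  have := gM y; have := gM x; rewrite !ler_norml => /andP[? ?] /andP[? ?]; lra.
have [C HC] := choice exC.
pose F y x := g y - C y * cosdist L y x.
have tF y : trigp (F y).
  rewrite /F; under eq_fun do rewrite -mulNr.
  by apply: trigpD; [exact: trigp_cst|exact/trigpZ/trigp_cosdist].
pose U y := [set x | g x - e < F y x].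
have oU y : cube L y -> open (U y).
  move=> _; have -> : U y = (fun x => F y x - g x) @^-1` [set z | - e < z].
    by apply/seteqP; split => x /=; rewrite /U/=; lra.
  apply: open_comp; last exact: open_gt.
  move=> x _; apply: (@continuousB R R^o V (F y) g); last exact: cg.
  exact: (continuous_trigp (tF y)).
have cov : cube L `<=` \bigcup_(y in cube L) U y.
  by move=> x xL; exists x => //; rewrite /U/= /F cosdist_self mulr0 subr0 gtrBl.
have := @compact_cover V; move=> /(congr1 (fun P => P (cube L))) cc.
have : cover_compact (cube L) by rewrite -cc; exact: compact_cube.
move=> /(_ _ _ _ oU cov)[D DL covD].
pose s := enum_fset D.
(* The base value [- M] bounds the maximum from below everywhere, while every [F y] is at most
   [g y <= M]; the bound by [M] thus holds outside the cube too. *)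
exists (fun x => foldr (fun y z => Num.max (F y x) z) (- M) s); split.
- by apply: tapprox_foldr_max => y; exact: trigp_tapprox.
- move=> x; rewrite ler_norml; apply/andP; split.
    by elim: (s) => //= y s' IH; rewrite le_max IH orbT.
  elim: (s) => /= [|y s' IH]; first by rewrite (@le_trans _ _ 0)// ?oppr_le0 ltW.
  rewrite ge_max IH andbT /F.
  have := mulr_ge0 (HC y).1 (cosdist_ge0 L y x); have := gM y.
  by rewrite ler_norml => /andP[? ?]; lra.
- move=> x xL; rewrite ler_norml; apply/andP; split; last first.
    have : forall y, y \in s -> cube L y by move=> y ys; exact: set_mem (DL y ys).
    elim: (s) => /= [_|y s' IH h].
      by have := gM x; rewrite ler_norml => /andP[? ?]; lra.
    have IHs : foldr (fun y z => Num.max (F y x) z) (- M) s' - g x <= e.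
      by apply: IH => z zs; apply: h; rewrite inE zs orbT.
    rewrite lerBlDr ge_max -!lerBlDr IHs andbT lerBlDr addrC; apply: (HC y).2 => //; apply: h; exact: mem_head.
  have [y yD Uy] := covD _ xL.
  have : y \in s by [].
  elim: (s) => //= z s' IH; rewrite inE => /orP[/eqP <-|/IH h].
    have : F y x <= Num.max (F y x) (foldr (fun y z => Num.max (F y x) z) (- M) s').
      by rewrite le_max lexx.
    by move: Uy; rewrite /U/=; lra.
  apply: le_trans h _; rewrite lerD2r le_max lexx orbT//.
Qed.

End Approximation.

(** * Measurability, tails and the continuity theorem *)

Lemma bounded_integrable d (T : measurableType d) (R : realType)
    (P : probability T R) (h : T -> R) (M : R) :
  measurable_fun setT h -> (forall x, `|h x| <= M) ->
  P.-integrable setT (EFin \o h).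
Proof.
move=> mh hM; apply: measurable_bounded_integrable => //.
  by rewrite (le_lt_trans (probability_le1 _ _))// ltry.
by exists M; split; [exact: num_real|move=> y My x _; exact: le_trans (hM x) (ltW My)].
Qed.

Lemma measurable_norm_gt d (T : measurableType d) (R : realType) (X : T -> R) (L : R) :
  measurable_fun setT X -> measurable [set w | L < `|X w|].
Proof.
move=> mX; rewrite (_ : [set _ | _] = setT `&` (fun w => `|X w|) @^-1` `]L, +oo[%classic).
  have mN : measurable_fun setT (fun w => `|X w|) by exact: measurableT_comp.
  exact: (mN measurableT).
by rewrite setTI; apply/seteqP; split => w /=; rewrite in_itv/= andbT.
Qed.

Lemma RV_tail d (T : measurableType d) (R : realType) (P : probability T R)
    (X : T -> R) (e : R) : measurable_fun setT X -> 0 < e ->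
  exists2 L, 0 < L & (P [set w | (L < `|X w|)%R] <= e%:E)%E.
Proof.
move=> mX e0; pose A (n : nat) := [set w | n%:R < `|X w|].
have mA n : measurable (A n) by exact: measurable_norm_gt.
have A0 : \bigcap_n A n = set0.
  apply/seteqP; split => // w Aw.
  have := Aw (Num.truncn `|X w|).+1 I; rewrite /A/= => h.
  by have := truncnS_gt `|X w|; rewrite ltNge ltW.
have cv : P (A n) @[n --> \oo] --> 0%E.
  rewrite -(measure0 P) -A0; apply: nonincreasing_cvg_mu => //.
  - by rewrite (le_lt_trans (probability_le1 _ _))// ltry.
  - by rewrite A0.
  - apply/nonincreasing_seqP => n; apply/subsetPset => w; rewrite /A/=.
    by apply: le_lt_trans; rewrite ler_nat.
have /fine_cvgP[_ /cvgrPdist_le/(_ _ e0)[N _ hN]] := cv.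
exists N.+1%:R => //; have := hN N.+1 (leqnSn N).
rewrite /= sub0r normrN ger0_norm ?fine_ge0//.
by rewrite -lee_fin fineK// fin_num_measure.
Qed.

Lemma probability_Rintegral_cst d (T : measurableType d) (R : realType)
    (P : probability T R) (a : R) : \int[P]_w a = a.
Proof.
rewrite Rintegral_cst// [X in fine X](_ : _ = 1%E) ?mulr1//.
exact: probability_setT.
Qed.

Section Levy.
Context {R : realType} {m : nat}.
Local Notation V := 'cV[R]_m.
Implicit Types (f g h : V -> R) (v x y : V).

Section OneVector.
Context d (T : measurableType d) (P : probability T R).
Variable X : 'I_m -> {RV P >-> R}.
Local Notation rv := (random_vector X).

Lemma measurable_trigp f : trigp f -> measurable_fun setT (f \o rv).
Proof.
elim=> [v c|f1 f2 _ h1 _ h2|a f1 _ h].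
- rewrite (_ : _ \o _ = (fun w => cos (1 * (\sum_j v j 0 * X j w) + c))); last first.
    by apply/funext => w; rewrite /= mul1r; congr (cos (_ + _));
      apply: eq_bigr => j _; rewrite mxE.
  apply: (measurableT_comp (measurable_cos_affine 1 c)).
  by apply: measurable_sum => j; apply: measurable_funM.
- exact: measurable_funD.
- exact: measurable_funM.
Qed.

Lemma measurable_rv_limit (f : V -> R) (g_ : nat -> V -> R) :
  (forall n, measurable_fun setT (g_ n \o rv)) ->
  (forall x, g_ n x @[n --> \oo] --> f x) -> measurable_fun setT (f \o rv).
Proof.
move=> mg cg; apply: (measurable_fun_cvg mg) => w _ /=; exact: cg.
Qed.

Lemma measurable_tapprox f : tapprox f -> measurable_fun setT (f \o rv).
Proof.
move=> tf.
have /choice[g_ gP] (n : nat) : exists g, trigp g /\ forall x, `|f x - g x| <= n.+1%:R^-1.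
  by have [|g tg h] := tf n.+1%:R^-1; [rewrite invr_gt0|exists g].
apply: (@measurable_rv_limit _ g_) => [n|x]; first exact/measurable_trigp/(gP n).1.
apply/cvgrPdist_le => e e0; near=> n.
rewrite (le_trans ((gP n).2 x))// invf_ple ?posrE// -[_^-1]/(_^-1).
rewrite (@le_trans _ _ n%:R) ?ler_nat//; near: n; exact: nbhs_infty_ger.
Unshelve. all: end_near. Qed.

(** Approximants on growing cubes converge pointwise to [g], which reduces the claim to cosines of
    linear combinations of the components. *)
Lemma measurable_continuous g M : continuous g -> 0 < M -> (forall x, `|g x| <= M) ->
  measurable_fun setT (g \o rv).
Proof.
move=> cg M0 gM.
have /choice[g_ gP] (n : nat) : exists h, [/\ tapprox h, forall x, `|h x| <= M &
    forall x, cube n.+1%:R x -> `|h x - g x| <= n.+1%:R^-1].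
  by apply: tapprox_cube; rewrite ?invr_gt0.
apply: (@measurable_rv_limit _ g_) => [n|x].
  by have [+ _ _] := gP n; exact: measurable_tapprox.
apply/cvgrPdist_le => e e0; near=> n.
have xn : cube n.+1%:R x.
  move=> j; apply: (@le_trans _ _ (\sum_i `|x i 0|)).
    by rewrite (bigD1 j)//= lerDl; apply: sumr_ge0.
  rewrite (@le_trans _ _ n%:R) ?ler_nat//; near: n; exact: nbhs_infty_ger.
rewrite distrC; have [_ _ h] := gP n; rewrite (le_trans (h x xn))//.
rewrite invf_ple ?posrE//.
rewrite (@le_trans _ _ n%:R) ?ler_nat//; near: n; exact: nbhs_infty_ger.
Unshelve. all: end_near. Qed.

(** Pointwise, the difference is at most [e] plus [2 * M] times the number of components exceeding
    [L]; integration is a union bound over [m] components. *)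
Lemma tail_diff g f (M e L t : R) : 0 < M -> 0 <= e ->
  (forall x, `|g x| <= M) -> (forall x, `|f x| <= M) ->
  measurable_fun setT (g \o rv) -> measurable_fun setT (f \o rv) ->
  (forall x, cube L x -> `|f x - g x| <= e) ->
  (forall j, (P [set w | (L < `|X j w|)%R] <= t%:E)%E) ->
  `|\int[P]_w g (rv w) - \int[P]_w f (rv w)| <= e + 2 * M * (m%:R * t).
Proof.
move=> M0 e0 gM fM mg mf fg tail.
have ig := bounded_integrable P mg (fun w => gM (rv w)).
have if' := bounded_integrable P mf (fun w => fM (rv w)).
rewrite -RintegralB//.
pose A j := [set w | L < `|X j w|].
have mA j : measurable (A j) by exact: measurable_norm_gt.
pose S w : R := \sum_j \1_(A j) w.
pose b w : R := e + 2 * M * S w.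
have ind0 j w : (0 <= \1_(A j) w :> R) by rewrite indicE ler0n.
have ind1 j w : (`|\1_(A j) w| <= 1 :> R) by rewrite indicE; case: (_ \in _); rewrite ?normr1 ?normr0.
have iind j : P.-integrable setT (EFin \o (\1_(A j) : T -> R)).
  by apply: bounded_integrable (ind1 j); exact: measurable_indic.
have isum : P.-integrable setT (EFin \o S).
  have -> : (EFin \o S) = (fun w => \sum_j (EFin \o (\1_(A j) : T -> R)) w)%E.
    by apply/funext => w /=; rewrite sumEFin.
  by apply: integrable_sum => // j _; exact: iind.
have iS : P.-integrable setT (EFin \o (fun w => 2 * M * S w)).
  have := integrableZl measurableT (2 * M) isum.
  by apply: eq_integrable => // w _; rewrite /= EFinM.
have ie : P.-integrable setT (EFin \o (fun=> e)).
  by apply: (bounded_integrable P (M := `|e|)).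
have ib : P.-integrable setT (EFin \o b).
  have := integrableD measurableT ie iS.
  by apply: eq_integrable => // w _; rewrite /= EFinD.
have mgf : measurable_fun setT (fun w => g (rv w) - f (rv w)) by exact: measurable_funB mg mf.
have igf : P.-integrable setT (EFin \o (fun w => g (rv w) - f (rv w))).
  apply: (bounded_integrable P mgf (M := M + M)) => w.
  by rewrite (le_trans (ler_normB _ _))// lerD.
apply: le_trans (le_normr_Rintegral _ igf) _ => //.
apply: (@le_trans _ _ (\int[P]_w b w)).
  apply: le_Rintegral => //; first exact: (integrable_norm igf).
  move=> w _; have [inL|/existsNP[j /negP]] := pselect (cube L (rv w)).
    rewrite distrC (le_trans (fg _ inL))// /b lerDl; apply: mulr_ge0.
      by rewrite mulr_ge0// ltW.
    by apply: sumr_ge0 => j _.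
  rewrite mxE -ltNge => Lj.
  apply: (@le_trans _ _ (2 * M)).
    by rewrite (le_trans (ler_normB _ _))// mulr2n mulrDl mul1r lerD.
  rewrite /b ler_wpDl// ler_peMr ?mulr_ge0 ?(ltW M0)//.
  rewrite /S (bigD1 j)//= indicE mem_set// lerDl.
  by apply: sumr_ge0 => i _.
rewrite /b RintegralD//.
rewrite probability_Rintegral_cst lerD2l RintegralZl//.
rewrite ler_wpM2l ?mulr_ge0 ?(ltW M0)//.
rewrite /Rintegral -lee_fin fineK ?integrable_fin_num//.
under eq_integral do rewrite -sumEFin.
rewrite integral_sum//.
have -> : (m%:R * t)%:E = (\sum_(j < m) t%:E)%E.
  by rewrite sumEFin sumr_const card_ord mulr_natl.
apply: lee_sum => j _; rewrite integral_indic//= setIT; exact: tail.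
Qed.

End OneVector.

Section Convergence.
Context d (T : measurableType d) (P : probability T R) d' (T' : measurableType d')
  (P' : probability T' R).
Variables (F : nat -> 'I_m -> {RV P >-> R}) (Z : 'I_m -> {RV P' >-> R}).
Hypothesis cos_cvg : forall v c,
  \int[P]_w cos (dotp v (random_vector (F n) w) + c) @[n --> \oo] -->
  \int[P']_w cos (dotp v (random_vector Z w) + c).
Hypothesis tight : forall e, 0 < e -> exists L,
  \forall n \near \oo, forall j, (P [set w | (L < `|F n j w|)%R] <= e%:E)%E.

Lemma trigp_cvg f : trigp f ->
  \int[P]_w f (random_vector (F n) w) @[n --> \oo] --> \int[P']_w f (random_vector Z w).
Proof.
elim=> [v c|f1 f2 t1 h1 t2 h2|a f1 t1 h].
- exact: cos_cvg.
- have [B1 _ b1] := trigp_bounded t1; have [B2 _ b2] := trigp_bounded t2.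
  have i1 n := bounded_integrable P (measurable_trigp (F n) t1) (fun w => b1 _).
  have i2 n := bounded_integrable P (measurable_trigp (F n) t2) (fun w => b2 _).
  have i1' := bounded_integrable P' (measurable_trigp Z t1) (fun w => b1 _).
  have i2' := bounded_integrable P' (measurable_trigp Z t2) (fun w => b2 _).
  rewrite (eq_cvg _ _ (fun n => RintegralD measurableT (i1 n) (i2 n))).
  by rewrite (RintegralD measurableT i1' i2'); exact: (@cvgD _ R^o).
- have [B1 _ b1] := trigp_bounded t1.
  have i1 n := bounded_integrable P (measurable_trigp (F n) t1) (fun w => b1 _).
  have i1' := bounded_integrable P' (measurable_trigp Z t1) (fun w => b1 _).
  rewrite (eq_cvg _ _ (fun n => RintegralZl a measurableT (i1 n))).
  rewrite (RintegralZl a measurableT i1').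
  by apply: (@cvgM R) => //; exact: cvg_cst.
Qed.

Lemma levy_continuity : cvg_in_distribution P P' F Z.
Proof.
move=> g cg [M0 gM0]; pose M := `|M0| + 1.
have M_gt0 : 0 < M by rewrite ltr_wpDl.
have gM x : `|g x| <= M by rewrite (le_trans (gM0 x))// ler_wpDr// ler_norm.
have mgF n : measurable_fun setT (g \o random_vector (F n)).
  exact: (measurable_continuous _ cg M_gt0 gM).
have mgZ : measurable_fun setT (g \o random_vector Z).
  exact: (measurable_continuous _ cg M_gt0 gM).
have EF n : ('E_P[g \o random_vector (F n)] =
    (\int[P]_w g (random_vector (F n) w))%:E)%E.
  rewrite unlock /Rintegral fineK// integrable_fin_num//.
  by apply: (bounded_integrable P (mgF n) (M := M)) => w; exact: gM.
have EZ : ('E_P'[g \o random_vector Z] = (\int[P']_w g (random_vector Z w))%:E)%E.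
  rewrite unlock /Rintegral fineK// integrable_fin_num//.
  by apply: (bounded_integrable P' mgZ (M := M)) => w; exact: gM.
rewrite EZ; under eq_fun do rewrite EF.
apply/cvg_EFin; first exact: nearW.
apply/cvgrPdist_le => e e0.
(* Budget: for each of the two laws, passing from [g] to the trigonometric [h] costs [3 * e1] (cube,
   tails, uniform approximation), and convergence for [h] costs [e1], in total [7 * e1]. The factor
   [m.+1] in [t] keeps the divisor nonzero when [m = 0]. *)
pose e1 := e / 8.
pose t := e / (16 * M * m.+1%:R).
have e10 : 0 < e1 by rewrite divr_gt0.
have t0 : 0 < t by rewrite divr_gt0// !mulr_gt0.
have [L1 tF] := tight t0.
have /choice[LZ hLZ] (j : 'I_m) : exists L, 0 < L /\ (P' [set w | (L < `|Z j w|)%R] <= t%:E)%E.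
  by have [L L0 h] := RV_tail P' (measurable_funPT (Z j)) t0; exists L.
pose L := `|L1| + \sum_j LZ j + 1.
have sum0 : 0 <= \sum_j LZ j by apply: sumr_ge0 => j _; exact/ltW/(hLZ j).1.
have L0 : 0 < L by rewrite ltr_wpDl// addr_ge0.
have mono d0 (T0 : measurableType d0) (Q : probability T0 R) (Y : {RV Q >-> R}) (l : R) :
    l <= L -> (Q [set w | (l < `|Y w|)%R] <= t%:E)%E -> (Q [set w | (L < `|Y w|)%R] <= t%:E)%E.
  move=> lL; apply: le_trans; apply: le_measure; rewrite ?inE.
  - exact: measurable_norm_gt.
  - exact: measurable_norm_gt.
  - by move=> w /=; apply: le_lt_trans.
have [f [tf fM fg]] := tapprox_cube cg M_gt0 gM L0 e10.
have [h th hf] := tf _ e10.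
have mt : 2 * M * (m%:R * t) <= e1.
  have -> : e1 = 2 * M * (m.+1%:R * t).
    have : m.+1%:R != 0 :> R by rewrite pnatr_eq0.
    rewrite /e1 /t; move: (m.+1%:R : R) => k k0.
    by field; rewrite k0 gt_eqF.
  by rewrite ler_wpM2l ?mulr_ge0 ?(ltW M_gt0)// ler_wpM2r ?(ltW t0)// ler_nat.
have close d0 (T0 : measurableType d0) (Q : probability T0 R) (Y : 'I_m -> {RV Q >-> R}) :
    (forall j, (Q [set w | (L < `|Y j w|)%R] <= t%:E)%E) ->
    `|\int[Q]_w g (random_vector Y w) - \int[Q]_w h (random_vector Y w)| <= 3 * e1.
  move=> tY.
  have mg := measurable_continuous Y cg M_gt0 gM.
  have mf := measurable_tapprox Y tf.
  have mh := measurable_trigp Y th.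
  have [B _ hB] := trigp_bounded th.
  have i1 := bounded_integrable Q mf (fun w => fM _).
  have i2 := bounded_integrable Q mh (fun w => hB _).
  have := tail_diff M_gt0 (ltW e10) gM fM mg mf fg tY.
  have : `|\int[Q]_w f (random_vector Y w) - \int[Q]_w h (random_vector Y w)| <= e1.
    rewrite -RintegralB//.
    have ifh : Q.-integrable setT (EFin \o (fun w => f (random_vector Y w) - h (random_vector Y w))).
      apply: (bounded_integrable Q (M := M + B)); first exact: measurable_funB mf mh.
      by move=> w; rewrite (le_trans (ler_normB _ _))// lerD.
    apply: le_trans (le_normr_Rintegral _ ifh) _ => //.
    have -> : e1 = \int[Q]_w e1 by rewrite probability_Rintegral_cst.
    apply: le_Rintegral => //; first exact: (integrable_norm ifh).
    by apply: (bounded_integrable Q (M := `|e1|)).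
  move=> h1 h2.
  have -> : \int[Q]_w g (random_vector Y w) - \int[Q]_w h (random_vector Y w) =
    (\int[Q]_w g (random_vector Y w) - \int[Q]_w f (random_vector Y w)) +
    (\int[Q]_w f (random_vector Y w) - \int[Q]_w h (random_vector Y w)) by ring.
  apply: le_trans (ler_normD _ _) _; lra.
have closeZ := close _ _ _ Z (fun j => mono _ _ _ _ _ _ (hLZ j).2).
have /cvgrPdist_le/(_ _ e10) ch := trigp_cvg th.
near=> n.
have closeF : `|\int[P]_w g (random_vector (F n) w) - \int[P]_w h (random_vector (F n) w)| <= 3 * e1.
  apply: close => j; apply: (mono _ _ _ _ L1).
    by rewrite /L -addrA ler_wpDr ?ler_norm// addr_ge0.
  move: j; near: n; exact: tF.
have hn : `|\int[P']_w h (random_vector Z w) - \int[P]_w h (random_vector (F n) w)| <= e1.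
  by near: n; exact: ch.
have {}closeZ : `|\int[P']_w g (random_vector Z w) - \int[P']_w h (random_vector Z w)| <= 3 * e1.
  apply: closeZ => j; rewrite /L (bigD1 j)//=.
  have : 0 <= \sum_(i < m | i != j) LZ i by apply: sumr_ge0 => i _; exact/ltW/(hLZ i).1.
  have := normr_ge0 L1; lra.
move: closeZ closeF hn => /=.
move: (\int[P']_w g _) (\int[P]_w g _) (\int[P']_w h _) (\int[P]_w h _) => a b c r.
by rewrite /e1 !ler_norml => /andP[? ?] /andP[? ?] /andP[? ?]; apply/andP; split; lra.
Unshelve. all: end_near. Qed.

End Convergence.

End Levy.

(** * Multiple integrals and their finite approximations *)

Section Bits.
Context d (T : measurableType d) (R : realType) (P : probability T R).
Variables (p : nat -> R) (X : nat -> {RV P >-> R}).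
Hypothesis rX : rademacher_seq P p X.

(** The bit [false] stands for every value other than 1; almost surely this value is -1, see
    [normalised_bits]. *)
Definition bits N (w : T) : {ffun 'I_N -> bool} := [ffun k : 'I_N => X k w == 1].

Lemma prN01 N (k : 'I_N) : 0 < prN p k < 1.
Proof. by case: rX => _ h _ _; exact: h. Qed.

Lemma measurable_level k (b : bool) :
  measurable (X k @^-1` (if b then [set (1 : R)] else ~` [set (1 : R)])).
Proof.
have mX : measurable_fun setT (X k) by exact: measurable_funPT.
rewrite -[X in measurable X]setTI; apply: mX => //.
by case: b; [|apply: measurableC].
Qed.

Lemma P_level k (b : bool) :
  P (X k @^-1` (if b then [set (1 : R)] else ~` [set (1 : R)])) =
  (if b then p k else 1 - p k)%:E.
Proof.
have [_ _ P1 _] := rX; case: b => /=; first exact: P1.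
rewrite -preimage_setC probability_setC; last exact: (measurable_level k true).
by have := P1 k; rewrite /preimage/= => ->.
Qed.

Lemma P_bits N (x : {ffun 'I_N -> bool}) :
  measurable [set w | bits N w = x] /\
  P [set w | bits N w = x] = (\prod_k wt (@prN R p N) k (x k))%:E.
Proof.
(* The default [true] beyond [N] is never read, since [J] contains only indices below [N]. *)
pose b k := if insub k is Some i then x i else true.
pose B k : set R := if b k then [set 1] else ~` [set 1].
pose J := seq_fset tt (iota 0 N).
have JE k : (k \in J) = (k < N)%N by rewrite seq_fsetE mem_iota.
have -> : [set w | bits N w = x] = \bigcap_(k in [set` J]) (X k @^-1` B k).
  apply/seteqP; split => w /=.
    move=> xE k /=; rewrite JE => kN; rewrite /B /b insubT/= -xE ffunE/=.
    by case: eqP.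
  move=> h; apply/ffunP => i; rewrite ffunE.
  have := h (val i); rewrite /= JE ltn_ord => /(_ isT).
  by rewrite /B /b valK; case: (x i) => /= [->|/eqP/negPf]; rewrite ?eqxx.
split.
  apply: fin_bigcap_measurable => [|k _]; first exact: finite_fset.
  exact: measurable_level.
have [ind _ _ _] := rX.
rewrite ind; last by move=> k; rewrite /B; case: (b k); [|apply: measurableC].
rewrite (perm_big _ (seq_fset_perm tt _)) undup_id ?iota_uniq//=.
have -> : iota 0 N = index_iota 0 N by rewrite /index_iota subn0.
rewrite big_mkord -prodEFin; apply: eq_bigr => i _.
by rewrite P_level /b valK /wt /prN.
Qed.

Lemma bits_indic N (H : {ffun 'I_N -> bool} -> R) w :
  H (bits N w) = \sum_x H x * \1_[set w | bits N w = x] w.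
Proof.
rewrite (bigD1 (bits N w))//= indicE mem_set// mulr1 big1 ?addr0// => x xw.
by rewrite indicE memNset ?mulr0//= => e; rewrite e eqxx in xw.
Qed.

Lemma measurable_bits N (H : {ffun 'I_N -> bool} -> R) :
  measurable_fun setT (fun w => H (bits N w)).
Proof.
under eq_fun do rewrite bits_indic.
apply: measurable_sum => x; apply: measurable_funM => //.
by apply: measurable_indic; exact: (P_bits x).1.
Qed.

Lemma integrable_bits N (H : {ffun 'I_N -> bool} -> R) :
  P.-integrable setT (EFin \o (fun w => H (bits N w))).
Proof.
apply: (bounded_integrable P (M := \sum_x `|H x|)); first exact: measurable_bits.
move=> w; rewrite (bigD1 (bits N w))//= lerDl.
by apply: sumr_ge0.
Qed.

Lemma integral_bits N (H : {ffun 'I_N -> bool} -> R) :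
  \int[P]_w H (bits N w) = Ex (@prN R p N) H.
Proof.
have mA x := (@P_bits N x).1; have PA x := (@P_bits N x).2.
have i1 x : P.-integrable setT (EFin \o (\1_[set w | bits N w = x] : T -> R)).
  exact: integrable_indic.
under eq_Rintegral do rewrite bits_indic.
transitivity (\sum_x H x * fine (P [set w | bits N w = x])).
  rewrite /Rintegral.
  under eq_integral do rewrite -sumEFin.
  rewrite integral_sum//; last first.
    move=> x; have := integrableZl measurableT (H x) (i1 x).
    by apply: eq_integrable => // w _; rewrite /= EFinM.
  have -> : (\sum_x \int[P]_w (H x * \1_[set w | bits N w = x] w)%:E =
      \sum_x (H x * fine (P [set w | bits N w = x]))%:E)%E.
    apply: eq_bigr => x _; under eq_integral do rewrite EFinM.
    rewrite integralZl//; last exact: i1.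
    by rewrite integral_indic// setIT EFinM fineK// fin_num_measure.
  by rewrite sumEFin.
by apply: eq_bigr => x _; rewrite PA /= mulrC.
Qed.

Lemma normalised_bits : {ae P, forall w, forall k,
  normalised p X k w = ((if X k w == 1 then 1 else -1) - p k + (1 - p k)) /
     (2 * Num.sqrt (p k * (1 - p k)))}.
Proof.
apply: ae_foralln => k; have [_ p01 P1 PN1] := rX.
have mX : measurable_fun setT (X k) by exact: measurable_funPT.
pose A := [set w | X k w = 1] `|` [set w | X k w = -1].
have m1 : measurable [set w | X k w = 1] by exact: (measurable_level k true).
have mN1 : measurable [set w | X k w = -1].
  by rewrite -[X in measurable X]setTI; apply: (mX measurableT [set -1]).
have mA : measurable A by exact: measurableU.
have PA : P A = 1%E.
  rewrite measureU//.
    transitivity ((p k)%:E + (1 - p k)%:E)%E; last by rewrite -EFinD addrC subrK.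
    by congr (_ + _)%E; [exact: P1|exact: PN1].
  apply/seteqP; split => // w [/= -> /eqP]; rewrite -subr_eq0 opprK -(natrD _ 1 1).
  by rewrite pnatr_eq0.
exists (~` A); split; first exact: measurableC.
  by transitivity (1 - P A)%E; [exact: probability_setC|rewrite PA subee].
move=> w /=; apply: contra_not; rewrite /normalised => -[] /= ->; rewrite ?eqxx//.
rewrite ifF//; apply/negbTE; rewrite eq_sym -subr_eq0 opprK -(natrD _ 1 1).
by rewrite pnatr_eq0.
Qed.

End Bits.

Section SquareIntegrable.
Context d (T : measurableType d) (R : realType) (P : probability T R).
Implicit Types f g : T -> R.

Definition sqint f := measurable_fun setT f /\
  P.-integrable setT (EFin \o (fun w => f w ^+ 2)).

Lemma sqint_mul f g : sqint f -> sqint g ->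
  P.-integrable setT (EFin \o (fun w => f w * g w)).
Proof.
move=> [mf f2] [mg g2].
have fg2 := integrableD measurableT f2 g2.
apply: (le_integrable measurableT _ _ fg2).
  by apply/measurable_EFinP; exact: measurable_funM.
move=> w _ /=; rewrite -?EFinD lee_fin normrM [leRHS]ger0_norm ?addr_ge0 ?sqr_ge0//.
rewrite -(real_normK (num_real (f w))) -(real_normK (num_real (g w))).
have := sqr_ge0 (`|f w| - `|g w|); rewrite sqrrB.
have := sqr_ge0 `|f w|; have := sqr_ge0 `|g w|; lra.
Qed.

(** Cauchy-Schwarz with a free weight: if the square integral of [g] is at most [t ^+ 2], the bound
    is linear in [t]. *)
Lemma sqint_amgm f g (t : R) : 0 < t -> sqint f -> sqint g ->
  `|\int[P]_w (f w * g w)| <=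
  2^-1 * (t * \int[P]_w f w ^+ 2 + (\int[P]_w g w ^+ 2) / t).
Proof.
move=> t0 sf sg; have ifg := sqint_mul sf sg.
have [mf f2] := sf; have [mg g2] := sg.
apply: le_trans (le_normr_Rintegral _ ifg) _ => //.
have i1 : P.-integrable setT (EFin \o (fun w => t * f w ^+ 2)).
  have := integrableZl measurableT t f2.
  by apply: eq_integrable => // w _; rewrite /= EFinM.
have i2 : P.-integrable setT (EFin \o (fun w => t^-1 * g w ^+ 2)).
  have := integrableZl measurableT (t^-1) g2.
  by apply: eq_integrable => // w _; rewrite /= EFinM.
have i3 : P.-integrable setT (EFin \o (fun w => t * f w ^+ 2 + t^-1 * g w ^+ 2)).
  have := integrableD measurableT i1 i2.
  by apply: eq_integrable => // w _; rewrite /= EFinD.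
have i4 : P.-integrable setT (EFin \o (fun w => 2^-1 * (t * f w ^+ 2 + t^-1 * g w ^+ 2))).
  have := integrableZl measurableT (2^-1) i3.
  by apply: eq_integrable => // w _; rewrite /= EFinM.
have -> : 2^-1 * (t * \int[P]_w f w ^+ 2 + (\int[P]_w g w ^+ 2) / t) =
   \int[P]_w (2^-1 * (t * f w ^+ 2 + t^-1 * g w ^+ 2)).
  by rewrite RintegralZl// RintegralD// !RintegralZl// [t^-1 * _]mulrC.
apply: le_Rintegral => //; first exact: (integrable_norm ifg).
move=> w _; rewrite normrM.
rewrite -(real_normK (num_real (f w))) -(real_normK (num_real (g w))).
move: (`|f w|) (`|g w|) => a b.
rewrite -(ler_pM2l t0).
have -> : t * (2^-1 * (t * a ^+ 2 + t^-1 * b ^+ 2)) = 2^-1 * ((t * a) ^+ 2 + b ^+ 2).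
  by field; rewrite gt_eqF.
have := sqr_ge0 (t * a - b); rewrite sqrrB; lra.
Qed.

Lemma sqintD f g : sqint f -> sqint g -> sqint (fun w => f w + g w).
Proof.
move=> sf sg; have [mf f2] := sf; have [mg g2] := sg; split; first exact: measurable_funD.
have i1 := sqint_mul sf sg.
have := integrableD measurableT (integrableD measurableT f2 g2) (integrableZl measurableT 2 i1).
apply: eq_integrable => // w _; rewrite /= -EFinM -!EFinD; congr EFin; ring.
Qed.

Lemma sqintZ (a : R) f : sqint f -> sqint (fun w => a * f w).
Proof.
move=> [mf f2]; split; first exact: measurable_funM.
have := integrableZl measurableT (a ^+ 2) f2.
by apply: eq_integrable => // w _; rewrite /= -EFinM exprMn.
Qed.

Lemma sqintB f g : sqint f -> sqint g -> sqint (fun w => f w - g w).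
Proof.
move=> sf sg; have := sqintD sf (sqintZ (-1) sg).
by under eq_fun do rewrite mulN1r.
Qed.

Lemma sqint1 : sqint (fun=> 1).
Proof.
split => //; apply: (bounded_integrable P (M := 1)) => // w.
by rewrite expr1n normr1.
Qed.

Lemma sqint_integrable f : sqint f -> P.-integrable setT (EFin \o f).
Proof.
move=> sf; have := sqint_mul sqint1 sf.
by apply: eq_integrable => // w _; rewrite /= mul1r.
Qed.

Lemma sqint_norm_le f (t : R) : 0 < t -> sqint f -> \int[P]_w f w ^+ 2 <= t ^+ 2 ->
  \int[P]_w `|f w| <= t.
Proof.
move=> t0 sf ft; have [mf f2] := sf.
have sn : sqint (fun w => `|f w|).
  split; first exact: measurableT_comp.
  by apply: eq_integrable f2 => // w _; rewrite /= (real_normK (num_real _)).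
have := sqint_amgm t0 sqint1 sn.
have -> : \int[P]_w (1 * `|f w|) = \int[P]_w `|f w|.
  by apply: eq_Rintegral => w _; rewrite mul1r.
have -> : \int[P]_w `|f w| ^+ 2 = \int[P]_w f w ^+ 2.
  by apply: eq_Rintegral => w _; rewrite (real_normK (num_real _)).
have -> : \int[P]_w (1 : R) ^+ 2 = 1 by rewrite probability_Rintegral_cst expr1n.
rewrite ger0_norm; last exact: Rintegral_ge0.
have : (\int[P]_w f w ^+ 2) / t <= t by rewrite ler_pdivrMr// -expr2.
lra.
Qed.

End SquareIntegrable.

Section Approximants.
Context d (T : measurableType d) (R : realType) (P : probability T R).
Variables (p : nat -> R) (X : nat -> {RV P >-> R}).
Hypothesis rX : rademacher_seq P p X.
Variables (q : nat) (f : q.-tuple nat -> R) (G : {RV P >-> R}).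
Hypothesis q0 : (0 < q)%N.
Hypothesis fK : kernel0 f.
Hypothesis hG : is_multiple_integral P (normalised p X) f G.

Let p01 : forall k, 0 < p k < 1. Proof. by case: rX. Qed.

Definition box_integral N (w : T) : R := QN p f (bits X N w).

Lemma measurable_normalised k : measurable_fun setT (normalised p X k).
Proof.
rewrite /normalised; apply: measurable_funM => //.
by apply: measurable_funD => //; apply: measurable_funB.
Qed.

Definition boxf N : {fset q.-tuple nat} := seq_fset tt [seq natt i | i <- enum {: q.-tuple 'I_N}].

Lemma big_boxf N (g : q.-tuple nat -> R) : \sum_(i <- boxf N) g i = \sum_(i : q.-tuple 'I_N) g (natt i).
Proof.
rewrite (perm_big _ (seq_fset_perm tt _)) undup_id/=; last first.
  by rewrite map_inj_uniq ?enum_uniq//; exact: natt_inj.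
by rewrite big_map big_enum.
Qed.

Lemma mem_boxf N (t : q.-tuple nat) : (t \in boxf N) = [forall l, (tnth t l < N)%N].
Proof.
rewrite seq_fsetE; apply/mapP/forallP => [[i _ ->] l|h].
  by rewrite tnth_natt ltn_ord.
exists [tuple Ordinal (h l) | l < q]; first by rewrite mem_enum.
by apply: eq_from_tnth => l; rewrite tnth_natt tnth_mktuple.
Qed.

Lemma fsubset_boxf (A : {fset q.-tuple nat}) :
  exists N0, forall N, (N0 <= N)%N -> (A `<=` boxf N)%fset.
Proof.
exists (\max_(t <- A) \max_(k <- (t : seq nat)) k).+1 => N hN.
apply/fsubsetP => t tA; rewrite mem_boxf; apply/forallP => l.
apply: leq_trans hN; rewrite ltnS.
apply: (@leq_trans (\max_(k <- (t : seq nat)) k)%N).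
  by apply: leq_bigmax_seq => //; exact: mem_tnth.
exact: (@leq_bigmax_seq _ _ xpredT (fun t : q.-tuple nat => \max_(k <- (t : seq nat)) k)%N).
Qed.

Lemma Qw_ae N : {ae P, forall w, \sum_(i <- boxf N) f i * \prod_(k < q) normalised p X (tnth i k) w
   = box_integral N w}.
Proof.
apply: filterS (normalised_bits rX) => w hw; rewrite big_boxf /box_integral /QN.
apply: eq_bigr => i _; congr (_ * _); apply: eq_bigr => l _.
by rewrite hw tnth_natt /yv /prN ffunE.
Qed.

(** Boxes are cofinal among the finite sets of tuples ([fsubset_boxf]), so unconditional convergence
    holds along them. Taking [e <= 1] ensures [e ^+ 2 <= delta]. *)
Lemma L2_approx (delta : R) : 0 < delta -> exists N0, forall N, (N0 <= N)%N ->
  (\int[P]_w ((G w - box_integral N w) ^+ 2)%:E <= delta%:E)%E.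
Proof.
move=> d0; pose e := Num.min 1 delta.
have e0 : 0 < e by rewrite lt_min ltr01.
have ed : e ^+ 2 <= delta.
  have e1 : e <= 1 by rewrite ge_min lexx.
  have ed : e <= delta by rewrite ge_min lexx orbT.
  by rewrite (le_trans _ ed)// expr2 ler_piMr// ltW.
have FT : ProperFilter (@summability.totally (q.-tuple nat)).
  exact: summability.totally_filter.
have /fine_cvgP[Gfin /cvgrPdist_le/(_ _ e0) Ge] := hG.
have [A _ hA] := filterI Gfin Ge.
have [N0 hN0] := fsubset_boxf A; exists N0 => N NN0.
have [] := hA _ (hN0 N NN0); rewrite /= sub0r normrN => Lfin Le.
set h := fun w => (G w - \sum_(i <- boxf N) f i * \prod_(k < q) normalised p X (tnth i k) w).
have -> : (\int[P]_w ((G w - box_integral N w) ^+ 2)%:E = \int[P]_w ((h w) ^+ 2)%:E)%E.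
  have mS : measurable_fun setT (fun w => \sum_(i <- boxf N) f i * \prod_(k < q) normalised p X (tnth i k) w).
    apply: measurable_sum => i; apply: measurable_funM => //.
    by apply: measurable_prod => l _; exact: measurable_normalised.
  apply: ae_eq_integral => //.
  - apply/measurable_EFinP; apply: measurable_funX; apply: measurable_funB => //.
    exact: (measurable_bits rX (QN p f (N:=N))).
  - by apply/measurable_EFinP; apply: measurable_funX; apply: measurable_funB.
  - by apply: filterS (Qw_ae N) => w E _; rewrite /h E.
have := @powR_Lnorm _ _ _ P (EFin \o h) 2.
rewrite pnatr_eq0 => /(_ isT).
have -> : (\int[P]_x (`|(EFin \o h) x| `^ 2) = \int[P]_w ((h w) ^+ 2)%:E)%E.
  apply: eq_integral => w _; rewrite /= (@powR_mulrn _ _ 2)//.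
  by rewrite (real_normK (num_real _)).
move=> <-; rewrite -(fineK Lfin) poweR_EFin lee_fin.
rewrite (@powR_mulrn _ _ 2) ?fine_ge0 ?Lnorm_ge0//.
apply: le_trans ed; rewrite lerXn2r ?nnegrE ?fine_ge0 ?Lnorm_ge0 ?(ltW e0)//.
by rewrite (le_trans _ Le)// ler_norm.
Qed.

End Approximants.

Section ApproximantMoments.
Context d (T : measurableType d) (R : realType) (P : probability T R).
Variables (p : nat -> R) (X : nat -> {RV P >-> R}).
Hypothesis rX : rademacher_seq P p X.

Let p01 : forall k, 0 < p k < 1. Proof. by case: rX. Qed.

Lemma sqint_bits N (H : {ffun 'I_N -> bool} -> R) : sqint P (fun w => H (bits X N w)).
Proof.
by split; [exact: (measurable_bits rX)|exact: (integrable_bits rX (fun x => H x ^+ 2))].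
Qed.

Variables (q : nat) (f : q.-tuple nat -> R) (G : {RV P >-> R}).
Hypothesis q0 : (0 < q)%N.
Hypothesis fK : kernel0 f.
Hypothesis hG : is_multiple_integral P (normalised p X) f G.
Local Notation Qw := (box_integral p X f).

Lemma sqint_Qw N : sqint P (Qw N). Proof. exact: sqint_bits. Qed.

Lemma measurable_diff N : measurable_fun setT (fun w => G w - Qw N w).
Proof. by apply: measurable_funB => //; have [] := sqint_Qw N. Qed.

Lemma sqint_G : sqint P G.
Proof.
have [N0 hN] := L2_approx rX hG ltr01.
have sD : sqint P (fun w => G w - Qw N0 w).
  split; first exact: measurable_diff.
  apply/integrableP; split.
    by apply/measurable_EFinP; apply: measurable_funX; exact: measurable_diff.
  under eq_integral do rewrite /= ger0_norm ?sqr_ge0//.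
  exact: le_lt_trans (hN N0 (leqnn _)) (ltry 1).
have := sqintD sD (sqint_Qw N0).
by under eq_fun do rewrite subrK.
Qed.

Lemma sqint_diff N : sqint P (fun w => G w - Qw N w).
Proof. exact: sqintB sqint_G (sqint_Qw N). Qed.

Lemma L2_approxR (delta : R) : 0 < delta -> exists N0, forall N, (N0 <= N)%N ->
  \int[P]_w (G w - Qw N w) ^+ 2 <= delta.
Proof.
move=> d0; have [N0 hN] := L2_approx rX hG d0; exists N0 => N /hN h.
have [_ i] := sqint_diff N.
by rewrite -lee_fin /Rintegral fineK// (integrable_fin_num measurableT).
Qed.

Lemma Qw_trunc n N w : (n <= N)%N -> Qw n w = QN_trunc p f n (bits X N w).
Proof.
move=> nN.
pose g (t : q.-tuple nat) := f t * \prod_(l < q)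
   (((if X (tnth t l) w == 1 then 1 else -1) - p (tnth t l) + (1 - p (tnth t l))) /
    (2 * Num.sqrt (p (tnth t l) * (1 - p (tnth t l))))).
have gE M (i : q.-tuple 'I_M) : f (natt i) *
    \prod_(l < q) yv (@prN R p M) (tnth i l) (bits X M w (tnth i l)) = g (natt i).
  by congr (_ * _); apply: eq_bigr => l _; rewrite tnth_natt /yv /prN ffunE.
rewrite /box_integral /QN /QN_trunc; under eq_bigr do rewrite gE.
under [RHS]eq_bigr do rewrite gE.
rewrite -(big_boxf n g).
transitivity (\sum_(t <- boxf q N | [forall l, (tnth t l < n)%N]) g t).
  rewrite -[RHS]big_filter; apply: perm_big; apply: uniq_perm.
  - exact: fset_uniq.
  - by rewrite filter_uniq// fset_uniq.
  move=> t; rewrite mem_filter !mem_boxf.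
  case: forallP => //= h; apply/esym/forallP => l.
  exact: leq_trans (h l) nN.
rewrite big_mkcond big_boxf [RHS]big_mkcond; apply: eq_bigr => i _.
by under [X in if X then _ else _]eq_forallb do rewrite tnth_natt.
Qed.

(** In effect [Qw n] is the conditional expectation of [G] given the first [n] variables. With
    [Qw N], [n <= N], in place of [G] this is [Ex_QN_trunc]; letting [Qw N] approach [G] bounds the
    difference of the two sides by [K * t] for every [t > 0]. *)
Lemma integral_Qw_pow n a : \int[P]_w (Qw n w ^+ a * G w) = \int[P]_w Qw n w ^+ a.+1.
Proof.
pose A w := Qw n w ^+ a.
have sA : sqint P A by exact: (sqint_bits (fun x => QN p f x ^+ a)).
pose K := 2^-1 * (1 + \int[P]_w A w ^+ 2).
have K0 : 0 < K.
  rewrite mulr_gt0 ?invr_gt0// ltr_wpDr//; apply: Rintegral_ge0 => w _; exact: sqr_ge0.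
have main t : 0 < t -> `|\int[P]_w (A w * G w) - \int[P]_w Qw n w ^+ a.+1| <= K * t.
  move=> t0; have t20 : 0 < t ^+ 2 by rewrite exprn_gt0.
  have [N0 hN] := L2_approxR t20.
  pose N := maxn n N0.
  have nN : (n <= N)%N by rewrite leq_maxl.
  have E : \int[P]_w (A w * Qw N w) = \int[P]_w Qw n w ^+ a.+1.
    transitivity (\int[P]_w (QN_trunc p f n (bits X N w) ^+ a * QN p f (bits X N w))).
      by apply: eq_Rintegral => w _; rewrite /A (Qw_trunc _ nN).
    rewrite (integral_bits rX (fun x => QN_trunc p f n x ^+ a * QN p f x)).
    rewrite (Ex_QN_trunc fK)//.
    rewrite -(integral_bits rX (fun x => QN_trunc p f n x ^+ a.+1)).
    by apply: eq_Rintegral => w _; rewrite (Qw_trunc _ nN).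
  have -> : \int[P]_w (A w * G w) - \int[P]_w Qw n w ^+ a.+1 =
     \int[P]_w (A w * (G w - Qw N w)).
    rewrite -E -RintegralB//; [|exact: sqint_mul sA sqint_G|exact: sqint_mul sA (sqint_Qw N)].
    by apply: eq_Rintegral => w _; rewrite mulrBr.
  apply: le_trans (sqint_amgm t0 sA (sqint_diff N)) _.
  rewrite /K -mulrA ler_wpM2l ?invr_ge0// mulrDl mul1r addrC [t * _]mulrC lerD2r.
  by rewrite ler_pdivrMr// -expr2; apply: hN; rewrite leq_maxr.
apply/eqP; rewrite -subr_eq0 -normr_le0; apply/ler_addgt0Pr => e e0.
rewrite add0r; have := main (e / K) (divr_gt0 e0 K0).
by rewrite mulrCA mulfV ?gt_eqF// mulr1.
Qed.

Lemma Ex_QN N : Ex (@prN R p N) (QN p f (N:=N)) = 0.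
Proof.
apply/eqP; rewrite -cf0; apply/negP => /negP nz.
have := homog_QN fK p01 nz; rewrite cards0 => q00.
by move: q0; rewrite -q00.
Qed.

Lemma integral_G : \int[P]_w G w = 0.
Proof.
have := integral_Qw_pow 0 0.
under eq_Rintegral do rewrite expr0 mul1r.
move=> ->; under eq_Rintegral do rewrite expr1.
by rewrite (integral_bits rX (QN p f (N:=0))) Ex_QN.
Qed.

Lemma Ex_QN_sqr N : Ex (@prN R p N) (fun x => QN p f x ^+ 2) <= \int[P]_w G w ^+ 2.
Proof.
have E : Ex (@prN R p N) (fun x => QN p f x ^+ 2) = \int[P]_w Qw N w ^+ 2.
  by rewrite -(integral_bits rX).
have := sqint_amgm ltr01 (sqint_Qw N) sqint_G.
have := integral_Qw_pow N 1; under eq_Rintegral do rewrite expr1.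
move=> ->; rewrite E mul1r divr1 => h.
have := ler_norm (\int[P]_w Qw N w ^+ 2); lra.
Qed.

(** Jensen's inequality for this conditional expectation, obtained from Young's inequality
    [Q^3 G <= 3/4 Q^4 + 1/4 G^4] and [integral_Qw_pow]. The right side may be infinite. *)
Lemma Ex_QN_pow4 N : ((Ex (@prN R p N) (fun x => QN p f x ^+ 4))%:E <=
  \int[P]_w (G w ^+ 4)%:E)%E.
Proof.
have E : Ex (@prN R p N) (fun x => QN p f x ^+ 4) = \int[P]_w Qw N w ^+ 4.
  by rewrite -(integral_bits rX).
have mG : measurable_fun setT (G : T -> R) by [].
have mG4 : measurable_fun setT (fun w => G w ^+ 4) by exact: measurable_funX.
have [->|fin] := eqVneq (\int[P]_w (G w ^+ 4)%:E)%E +oo%E; first exact: leey.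
have p4 (x : R) : 0 <= x ^+ 4 by exact: exprn_even_ge0.
have i4 : P.-integrable setT (EFin \o (fun w => G w ^+ 4)).
  apply/integrableP; split; first exact/measurable_EFinP.
  under eq_integral do rewrite /= ger0_norm//.
  by rewrite ltey.
have iQ4 : P.-integrable setT (EFin \o (fun w => Qw N w ^+ 4)).
  exact: (integrable_bits rX (fun x => QN p f x ^+ 4)).
have sQ3 : sqint P (fun w => Qw N w ^+ 3) by exact: (sqint_bits (fun x => QN p f x ^+ 3)).
have iQ3G := sqint_mul sQ3 sqint_G.
have iq : P.-integrable setT (EFin \o (fun w => 3 / 4 * Qw N w ^+ 4)).
  have := integrableZl measurableT (3 / 4) iQ4.
  by apply: eq_integrable => // w _; rewrite /= EFinM.
have ig : P.-integrable setT (EFin \o (fun w => 4^-1 * G w ^+ 4)).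
  have := integrableZl measurableT (4^-1) i4.
  by apply: eq_integrable => // w _; rewrite /= EFinM.
have iqg : P.-integrable setT (EFin \o (fun w => 3 / 4 * Qw N w ^+ 4 + 4^-1 * G w ^+ 4)).
  have := integrableD measurableT iq ig.
  by apply: eq_integrable => // w _; rewrite /= EFinD.
have G4E : (\int[P]_w (G w ^+ 4)%:E)%E = (\int[P]_w G w ^+ 4)%:E.
  by rewrite /Rintegral fineK// (integrable_fin_num measurableT).
rewrite G4E lee_fin E.
have : \int[P]_w (Qw N w ^+ 3 * G w) <= \int[P]_w (3 / 4 * Qw N w ^+ 4 + 4^-1 * G w ^+ 4).
  apply: le_Rintegral => // w _; move: (Qw N w) (G w) => a b.
  have : 0 <= (a - b) ^+ 2 * (2 * a ^+ 2 + (a + b) ^+ 2).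
    by rewrite mulr_ge0 ?sqr_ge0// addr_ge0 ?sqr_ge0// mulr_ge0// sqr_ge0.
  have -> : (a - b) ^+ 2 * (2 * a ^+ 2 + (a + b) ^+ 2) =
     4 * (3 / 4 * a ^+ 4 + 4^-1 * b ^+ 4 - a ^+ 3 * b) by field.
  lra.
rewrite integral_Qw_pow RintegralD// !RintegralZl//; lra.
Qed.

End ApproximantMoments.

(** * Quantitative estimate for one vector of multiple integrals *)

Section Estimate.
Context d0 (T : measurableType d0) (R : realType) (P : probability T R).
Variables (p : nat -> R) (X : nat -> {RV P >-> R}).
Hypothesis rX : rademacher_seq P p X.
Let p01 : forall k, 0 < p k < 1. Proof. by case: rX. Qed.

Variables (d : nat) (q : 'I_d -> nat) (f : forall j : 'I_d, (q j).-tuple nat -> R).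
Arguments f : clear implicits.
Variables (F : 'I_d -> {RV P >-> R}).
Hypothesis q0 : forall j, (0 < q j)%N.
Hypothesis fK : forall j, kernel0 (f j).
Hypothesis hF : forall j, is_multiple_integral P (normalised p X) (f j) (F j).

Lemma sqint_F j : sqint P (F j).
Proof. exact: (sqint_G rX (hF j)). Qed.

Lemma covariance_Rintegral i j : covariance P (F i) (F j) = (\int[P]_w (F i w * F j w))%:E.
Proof.
have E0 k : fine 'E_P[F k] = 0.
  rewrite unlock; exact: (integral_G rX (q0 k) (fK k) (hF k)).
rewrite unlock !E0 unlock /Rintegral fineK; last first.
  by apply: (integrable_fin_num measurableT); exact: sqint_mul (sqint_F i) (sqint_F j).
by apply: eq_integral => w _ /=; rewrite !fctE /= !subr0.
Qed.

Lemma cross_close N i j (t : R) : 0 < t ->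
  \int[P]_w (F i w - box_integral p X (f i) N w) ^+ 2 <= t ^+ 2 ->
  \int[P]_w (F j w - box_integral p X (f j) N w) ^+ 2 <= t ^+ 2 ->
  `|Ex (@prN R p N) (fun x => QN p (f i) x * QN p (f j) x) - \int[P]_w (F i w * F j w)|
  <= t * (1 + 2^-1 * \int[P]_w F i w ^+ 2 + 2^-1 * \int[P]_w F j w ^+ 2).
Proof.
move=> t0 hi hj.
have sFi := sqint_F i; have sFj := sqint_F j.
have sQ k : sqint P (box_integral p X (f k) N) by exact: (sqint_Qw rX).
have sD k : sqint P (fun w => F k w - box_integral p X (f k) N w) by exact: sqintB (sqint_F k) (sQ k).
have i1 := sqint_mul (sQ i) (sD j); have i2 := sqint_mul sFj (sD i).
have -> : Ex (@prN R p N) (fun x => QN p (f i) x * QN p (f j) x) - \int[P]_w (F i w * F j w) =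
   - (\int[P]_w (box_integral p X (f i) N w * (F j w - box_integral p X (f j) N w)) +
      \int[P]_w (F j w * (F i w - box_integral p X (f i) N w))).
  rewrite -(integral_bits rX (fun x => QN p (f i) x * QN p (f j) x)).
  rewrite -RintegralD// -[LHS]opprB; congr (- _).
  rewrite -RintegralB//; [|exact: sqint_mul|exact: sqint_mul (sQ i) (sQ j)].
  by apply: eq_Rintegral => w _; rewrite /box_integral; ring.
have hk (x : R) : x <= t ^+ 2 -> x / t <= t by rewrite ler_pdivrMr// -expr2.
have a1 := sqint_amgm t0 (sQ i) (sD j); have a2 := sqint_amgm t0 sFj (sD i).
have b1 := hk _ hi; have b2 := hk _ hj.
have e1 : t * \int[P]_w box_integral p X (f i) N w ^+ 2 <= t * \int[P]_w F i w ^+ 2.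
  rewrite ler_wpM2l ?(ltW t0)//.
  have := Ex_QN_sqr rX (fK i) (hF i) N.
  by rewrite -(integral_bits rX (fun x => QN p (f i) x ^+ 2)).
rewrite normrN; apply: le_trans (ler_normD _ _) _; lra.
Qed.

Variables (Sigma : 'M[R]_d) (v : 'cV[R]_d) (Q : nat) (S eta : R).
Hypotheses (qQ : forall j, (q j <= Q)%N) (S1 : 1 <= S).
Hypothesis Sigma_diag : forall j, 0 <= Sigma j j.
Hypothesis SigmaS : forall j, Sigma j j + 1 <= S.
Hypotheses (eta0 : 0 < eta) (eta1 : eta <= 1).
Hypothesis Fcov : forall i j,
  `|\int[P]_w (F i w * F j w) - Sigma i j| <= eta ^+ 4 / (24 * S).
Hypothesis F4 : forall j,
  (\int[P]_w (F j w ^+ 4)%:E <= (3 * Sigma j j ^+ 2 + eta ^+ 4 / 2)%:E)%E.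
Hypothesis Finfl : forall j,
  (max_influence (f j) <= (eta ^+ 4 / ((q j)`!%:R * (q j)%:R))%:E)%E.
Hypothesis Sigma_ge0 : 0 <= (v^T *m Sigma *m v) 0 0.

Let vv j := v j 0.

(** The summands pay, in order, for Stein's method, for replacing the covariances by [Sigma], and
    for truncating the indices. The absolute value makes nonnegativity immediate. *)
Definition Kcos : R := `|Kst Q S vv| + (\sum_j `|vv j|) ^+ 2 + \sum_j `|vv j|.

Lemma quad_formE : (v^T *m Sigma *m v) 0 0 = \sum_j vv j * \sum_i vv i * Sigma j i.
Proof.
rewrite mxE; under eq_bigr do rewrite mxE mulr_suml.
rewrite exchange_big; apply: eq_bigr => j _; rewrite mulr_sumr; apply: eq_bigr => i _.
by rewrite mxE /vv; ring.
Qed.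

Lemma cos_estimate (c : R) :
  `|\int[P]_w cos (dotp v (random_vector F w) + c) -
    expR (- ((v^T *m Sigma *m v) 0 0 / 2)) * cos c| <= Kcos * eta.
Proof.
have S0 : 0 < S by exact: lt_le_trans S1.
(* Truncated covariances will be within [2 * tau] of [Sigma]. With diagonal values at most [S],
   three times the difference of squares is at most [12 * tau * S = eta ^+ 4 / 2], the half of the
   tolerance that [F4] leaves free. *)
pose tau := eta ^+ 4 / (24 * S).
have e40 : 0 < eta ^+ 4 by rewrite exprn_gt0.
have tau0 : 0 < tau by rewrite divr_gt0// mulr_gt0.
have tauS : tau * S = eta ^+ 4 / 24 by rewrite /tau; field; rewrite gt_eqF.
have e4e : eta ^+ 4 <= eta by rewrite -[leRHS]expr1 ler_wiXn2l// ltW.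
have tau_eta : 24 * tau <= eta.
  have : tau * 1 <= tau * S by rewrite ler_wpM2l// ltW.
  by rewrite tauS; lra.
(* By [cross_close], an L2 truncation error [t] changes covariances by at most
   [t * (1 + S) = tau]. *)
pose t := tau / (1 + S).
have S10 : 0 < 1 + S by rewrite addr_gt0.
have t0 : 0 < t by rewrite divr_gt0.
have tt : t * (1 + S) = tau by rewrite /t divfK// gt_eqF.
have t_eta : t <= eta.
  have : t * 1 <= t * (1 + S) by rewrite ler_wpM2l ?(ltW t0)// lerDl ltW.
  by rewrite tt; lra.
have t20 : 0 < t ^+ 2 by rewrite exprn_gt0.
have /choice[N_ hN_] (j : 'I_d) := L2_approxR rX (hF j) t20.
pose N := (\sum_j N_ j)%N.
have hN j : \int[P]_w (F j w - box_integral p X (f j) N w) ^+ 2 <= t ^+ 2.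
  by apply: hN_; rewrite /N (bigD1 j)//= leq_addr.
have F2S j : \int[P]_w F j w ^+ 2 <= S.
  have -> : \int[P]_w F j w ^+ 2 = \int[P]_w (F j w * F j w).
    by apply: eq_Rintegral => w _; rewrite expr2.
  have := Fcov j j; have := SigmaS j; rewrite -/tau ler_norml => hS /andP[_ hF2].
  have key (a b s e S' : R) : 24 * a <= e -> e <= 1 -> 0 < a -> s + 1 <= S' ->
    b - s <= a -> b <= S' by lra.
  exact: (key _ _ _ _ _ tau_eta eta1 tau0 hS hF2).
have crossSigma i j : `|Ex (@prN R p N) (fun x => QN p (f i) x * QN p (f j) x) - Sigma i j| <= 2 * tau.
  have h1 := cross_close t0 (hN i) (hN j); have h2 := Fcov i j.
  have h3 : t * (1 + 2^-1 * \int[P]_w F i w ^+ 2 + 2^-1 * \int[P]_w F j w ^+ 2) <= tau.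
    rewrite -tt ler_wpM2l ?(ltW t0)//.
    by have := F2S i; have := F2S j; lra.
  have -> : Ex (@prN R p N) (fun x => QN p (f i) x * QN p (f j) x) - Sigma i j =
    (Ex (@prN R p N) (fun x => QN p (f i) x * QN p (f j) x) - \int[P]_w (F i w * F j w)) +
    (\int[P]_w (F i w * F j w) - Sigma i j) by rewrite addrA subrK.
  apply: le_trans (ler_normD _ _) _; rewrite -/tau in h2; lra.
have Q2S j : Ex (@prN R p N) (fun x => QN p (f j) x ^+ 2) <= S.
  exact: le_trans (Ex_QN_sqr rX (fK j) (hF j) N) (F2S j).
have pN01 k := prN01 rX (N := N) k.
have close j : fourth_moment_close (@prN R p N) Q S eta (q j) (QN p (f j) (N := N)).
  split.
  - by rewrite q0 qQ.
  - exact: (homog_QN (fK j) p01).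
  - exact: Q2S.
  - have h4 := le_trans (Ex_QN_pow4 rX (fK j) (hF j) N) (F4 j).
    rewrite lee_fin in h4; apply: le_trans h4 _.
    have := crossSigma j j; rewrite (mul_self (QN p (f j) (N:=N))).
    have := Q2S j; have := Ex_sqr_ge0 pN01 (QN p (f j) (N:=N)).
    set a := Ex _ _ => a0 aS aSig.
    have Sig : Sigma j j <= S by have := SigmaS j; lra.
    have : Sigma j j ^+ 2 - a ^+ 2 <= 4 * (tau * S).
      rewrite subr_sqr.
      apply: le_trans (ler_norm _) _; rewrite normrM distrC.
      rewrite (ger0_norm (addr_ge0 (Sigma_diag j) a0)).
      have -> : 4 * (tau * S) = 2 * tau * (2 * S) by ring.
      by apply: ler_pM => //; [rewrite addr_ge0|lra].
    by rewrite tauS; lra.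
  - move=> k; apply: le_trans (infl_QN (q0 j) (fK j) p01 (Finfl j) k) _.
    rewrite mulrC divfK// mulf_neq0// pnatr_eq0 -?lt0n ?fact_gt0//.
have Wb : `|Ex (@prN R p N) (fun x => (\sum_j vv j * QN p (f j) x) ^+ 2) -
    (v^T *m Sigma *m v) 0 0| <= (\sum_j `|vv j|) ^+ 2 * eta.
  have -> : Ex (@prN R p N) (fun x => (\sum_j vv j * QN p (f j) x) ^+ 2) =
     \sum_j vv j * \sum_i vv i * Ex (@prN R p N) (fun x => QN p (f j) x * QN p (f i) x).
    transitivity (Ex (@prN R p N) (fun x => \sum_j vv j * (\sum_i vv i * (QN p (f j) x * QN p (f i) x)))).
      apply: eq_Ex => x; rewrite expr2 mulr_suml; apply: eq_bigr => j _.
      rewrite -mulrA; congr (_ * _); rewrite mulr_sumr; apply: eq_bigr => i _; ring.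
    rewrite Ex_sumI; apply: eq_bigr => j _; rewrite ExZ; congr (_ * _).
    by rewrite Ex_sumI; apply: eq_bigr => i _; rewrite ExZ.
  rewrite quad_formE -sumrB expr2 -mulrA mulr_suml.
  apply: le_trans (ler_norm_sum _ _ _) _; apply: ler_sum => j _.
  rewrite -mulrBr normrM ler_wpM2l// -sumrB mulr_suml.
  apply: le_trans (ler_norm_sum _ _ _) _; apply: ler_sum => i _.
  rewrite -mulrBr normrM ler_wpM2l//; apply: le_trans (crossSigma j i) _; lra.
have := charfun_finite pN01 (ltW S0) eta0 eta1 close c Sigma_ge0 Wb.
pose W (x : {ffun 'I_N -> bool}) := \sum_j vv j * QN p (f j) x.
rewrite -(integral_bits rX (fun x => cos (W x + c))).
set z := expR _ * _ => h.
have sD j : sqint P (fun w => F j w - box_integral p X (f j) N w).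
  exact: sqintB (sqint_F j) (sqint_Qw rX (f j) N).
have mX : measurable_fun setT (fun w => dotp v (random_vector F w)).
  rewrite /dotp; apply: measurable_sum => j; apply: measurable_funM => //.
  have -> : (fun w => random_vector F w j 0) = F j by apply/funext => w; rewrite mxE.
  exact: measurable_funPT.
have mcos1 : measurable_fun setT (fun w => cos (dotp v (random_vector F w) + c)).
  rewrite (_ : (fun w => _) = (fun x => cos (1 * x + c)) \o
      (fun w => dotp v (random_vector F w))); last first.
    by apply/funext => w /=; rewrite mul1r.
  exact: measurableT_comp (measurable_cos_affine 1 c) mX.
have i1 := bounded_integrable P mcos1 (fun w => cos_max _).
have i2 := integrable_bits rX (fun x => cos (W x + c)).
have iabs j : P.-integrable setT (EFin \o (fun w => `|F j w - box_integral p X (f j) N w|)).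
  exact: (integrable_norm (sqint_integrable (sD j))).
pose g j w := `|vv j| * `|F j w - box_integral p X (f j) N w|.
have ivabs j : P.-integrable setT (EFin \o g j).
  have := integrableZl measurableT (`|vv j|) (iabs j).
  by apply: eq_integrable => // w _; rewrite /= EFinM.
have isum : P.-integrable setT (EFin \o (fun w => \sum_j g j w)).
  have -> : (EFin \o (fun w => \sum_j g j w)) = (fun w => \sum_j (EFin \o g j) w)%E.
    by apply/funext => w /=; rewrite sumEFin.
  by apply: integrable_sum => // j _; exact: ivabs.
have diff : `|\int[P]_w cos (dotp v (random_vector F w) + c) -
    \int[P]_w cos (W (bits X N w) + c)| <= (\sum_j `|vv j|) * eta.
  rewrite -RintegralB//.
  have idiff : P.-integrable setT (EFin \o (fun w => cos (dotp v (random_vector F w) + c) -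
     cos (W (bits X N w) + c))).
    have := integrableB measurableT i1 i2.
    by apply: eq_integrable => // w _; rewrite /= EFinB.
  apply: le_trans (le_normr_Rintegral _ idiff) _ => //.
  apply: (@le_trans _ _ (\int[P]_w (\sum_j g j w))).
    apply: le_Rintegral => //; first exact: (integrable_norm idiff).
    move=> w _; have [y _ E] := mean_value (@is_derive_cos R)
      (W (bits X N w) + c) (dotp v (random_vector F w) + c).
    rewrite E normrM normrN.
    apply: (@le_trans _ _ `|dotp v (random_vector F w) - W (bits X N w)|).
      rewrite opprD addrACA subrr addr0 ler_piMl// sin_max//.
    rewrite /dotp /W -sumrB; apply: le_trans (ler_norm_sum _ _ _) _.
    by apply: ler_sum => j _; rewrite mxE -mulrBr normrM.
  have -> : \int[P]_w (\sum_j g j w) = \sum_j `|vv j| * \int[P]_w `|F j w - box_integral p X (f j) N w|.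
    rewrite {1}/Rintegral; under eq_integral do rewrite -sumEFin.
    rewrite integral_sum//.
    rewrite -sum_fine => [|j _]; last exact: (integrable_fin_num measurableT (ivabs j)).
    by apply: eq_bigr => j _; rewrite -RintegralZl.
  rewrite mulr_suml; apply: ler_sum => j _; rewrite ler_wpM2l//.
  exact: le_trans (sqint_norm_le t0 (sD j) (hN j)) t_eta.
have -> : \int[P]_w cos (dotp v (random_vector F w) + c) - z =
  (\int[P]_w cos (dotp v (random_vector F w) + c) - \int[P]_w cos (W (bits X N w) + c)) +
  (\int[P]_w cos (W (bits X N w) + c) - z) by rewrite addrA subrK.
apply: le_trans (ler_normD _ _) _; rewrite /Kcos !mulrDl [leRHS]addrC lerD//.
apply: le_trans h _; rewrite lerD2r ler_wpM2r ?(ltW eta0)//.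
exact: ler_norm.
Qed.

End Estimate.

(** * The limit theorem *)

Lemma le_hs_norm (R : realType) m (A : 'M[R]_m) i j : `|A i j| <= hs_norm A.
Proof.
rewrite -sqrtr_sqr ler_wsqrtr// (bigD1 i)//= (bigD1 j)//= -addrA lerDl.
by rewrite addr_ge0// ?sumr_ge0// => k _; rewrite ?sqr_ge0// sumr_ge0// => l _; rewrite sqr_ge0.
Qed.

Lemma nonneg_definite_diag (R : realType) m (S : 'M[R]_m) j :
  nonneg_definite S -> 0 <= S j j.
Proof.
by move=> /(_ (delta_mx j 0)); rewrite trmx_delta -rowE -colE !mxE.
Qed.

Lemma max_influence_ge0 (R : realType) n (f : n.-tuple nat -> R) :
  (0 <= max_influence f)%E.
Proof.
apply: (@le_trans _ _ (\esum_(i in [set i : n.-tuple nat | last 0%N i = 0%N]) (f i ^+ 2)%:E)%E).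
  by apply: esum_ge0 => i _; rewrite lee_fin sqr_ge0.
by apply: ereal_sup_ubound; exists 0%N.
Qed.

Lemma variance_tail d (T : measurableType d) (R : realType) (P : probability T R)
    (X : {RV P >-> R}) (B e : R) : 0 < e -> 0 <= B ->
  fine 'E_P[X] = 0 -> ('V_P[X] <= B%:E)%E ->
  (P [set w | (B / e + 1 < `|X w|)%R] <= e%:E)%E.
Proof.
(* For [L = B / e + 1], Chebyshev gives [B / L^2]; the added 1 ensures [L <= L^2], and [B / e <= L]
   finishes. *)
move=> e0 B0 X0 VB; have L1 : 1 <= B / e + 1 by rewrite lerDr divr_ge0// ltW.
have L0 : 0 < B / e + 1 by exact: lt_le_trans L1.
have mX : measurable_fun setT (fun w => `|X w|) by exact: measurableT_comp.
apply: (@le_trans _ _ (P [set w | (B / e + 1 <= `|X w|)%R])).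
  apply: le_measure; rewrite ?inE.
  - by apply: measurable_norm_gt; exact: measurable_funPT.
  - rewrite (_ : [set _ | _] = setT `&` (fun w => `|X w|) @^-1` `[B / e + 1, +oo[%classic).
      exact: mX.
    by rewrite setTI; apply/seteqP; split => w /=; rewrite in_itv/= andbT.
  - by move=> w /= /ltW.
have := chebyshev X L0; rewrite X0; under eq_set do rewrite subr0.
move=> /le_trans; apply; apply: (@le_trans _ _ ((B / e + 1) ^- 2 * B)%:E).
  by rewrite EFinM lee_wpmul2l// lee_fin invr_ge0 exprn_ge0// ltW.
rewrite lee_fin mulrC ler_pdivrMr ?exprn_gt0// -ler_pdivrMl// mulrC.
by rewrite (@le_trans _ _ (B / e + 1)) ?lerDl// expr2 ler_peMl// ltW.
Qed.

Theorem theorem1p1 (R : realType) (disp : measure_display)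
    (Omega : measurableType disp) (P : probability Omega R)
    (p : nat -> R) (X : nat -> {RV P >-> R})
    (d : nat) (q : 'I_d -> nat)
    (f : nat -> forall j : 'I_d, (q j).-tuple nat -> R)
    (F : nat -> 'I_d -> {RV P >-> R})
    (Sigma : 'M[R]_d) :
  rademacher_seq P p X ->
  (2 <= d)%N ->
  (forall j, (1 <= q j)%N) ->
  (forall i j : 'I_d, (i <= j)%N -> (q i <= q j)%N) ->
  (forall n j, kernel0 (f n j)) ->
  (forall n j, is_multiple_integral P (normalised p X) (f n j) (F n j)) ->
  Sigma^T = Sigma ->
  nonneg_definite Sigma ->
  hs_norm (covariance_mx P (F n) - Sigma) @[n --> \oo] --> 0 ->
  (\sum_(j < d) max_influence (f n j))%E @[n --> \oo] --> 0%E ->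
  (forall j, ('E_P[(fun w => F n j w ^+ 4)%R])%E @[n --> \oo]
               --> (3 * Sigma j j ^+ 2)%:E) ->
  forall (disp' : measure_display) (Omega' : measurableType disp')
    (P' : probability Omega' R) (Z : 'I_d -> {RV P' >-> R}),
    gaussian_vector P' Sigma Z -> cvg_in_distribution P P' F Z.
Proof.
move=> rX _ q0 _ fK hF _ Sigma_nnd cov_cvg infl_cvg F4_cvg disp' Omega' P' Z Zgauss.
pose s (n : nat) i j := \int[P]_w (F n i w * F n j w).
have covE n i j : covariance P (F n i) (F n j) = (s n i j)%:E.
  exact: (covariance_Rintegral rX q0 (fK n) (hF n)).
have s_cvg (t : R) : 0 < t -> \forall n \near \oo, forall i j, `|s n i j - Sigma i j| <= t.
  move=> t0; have /cvgrPdist_le/(_ _ t0) := cov_cvg; apply: filterS => n.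
  rewrite sub0r normrN => h i j; apply: le_trans h; apply: le_trans (ler_norm _).
  by have := le_hs_norm (covariance_mx P (F n) - Sigma) i j; rewrite !mxE covE.
have Sigma_diag j : 0 <= Sigma j j by exact: nonneg_definite_diag.
apply: levy_continuity => [v c|e e0].
  have -> : \int[P']_w cos (dotp v (random_vector Z w) + c) =
      expR (- ((v^T *m Sigma *m v) 0 0 / 2)) * cos c.
    have mZ : measurable_fun setT (fun w => \sum_j v j 0 * Z j w).
      by apply: measurable_sum => j; exact: measurable_funM.
    rewrite -(centered_normal_cos c (Sigma_nnd v) mZ (Zgauss v)).
    apply: eq_Rintegral => w _; congr (cos (_ + c)).
    by apply: eq_bigr => j _; rewrite mxE.
  (* The sums bound all degrees and all diagonal entries at once; [Q], [S] and hence [K] do not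
     depend on [n]. *)
  pose Q := (\sum_j q j)%N; pose S := \sum_j Sigma j j + 1.
  have SigmaS j : Sigma j j + 1 <= S.
    by rewrite lerD2r (bigD1 j)//= lerDl sumr_ge0.
  have S1 : 1 <= S by rewrite lerDr sumr_ge0.
  have qQ j : (q j <= Q)%N by rewrite /Q (bigD1 j)//= leq_addr.
  pose K := Kcos v Q S.
  have K0 : 0 <= K by rewrite !addr_ge0 ?sqr_ge0 ?sumr_ge0.
  apply/cvgrPdist_le => e e0.
  pose eta := Num.min 1 (e / (K + 1)).
  have K1 : 0 < K + 1 by rewrite ltr_wpDl.
  have eta0 : 0 < eta by rewrite lt_min ltr01 divr_gt0.
  have eta1 : eta <= 1 by rewrite ge_min lexx.
  have etaK : K * eta <= e.
    apply: (@le_trans _ _ ((K + 1) * eta)); first by rewrite ler_wpM2r ?(ltW eta0)// lerDl.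
    by rewrite mulrC -ler_pdivlMr// ge_min lexx orbT.
  have e40 : 0 < eta ^+ 4 by rewrite exprn_gt0.
  near=> n; rewrite distrC; apply: le_trans etaK.
  apply: (cos_estimate rX q0 (fK n) (hF n) qQ S1 Sigma_diag SigmaS eta0 eta1).
  - near: n; apply: s_cvg; rewrite divr_gt0// mulr_gt0//; exact: lt_le_trans S1.
  - near: n; apply: filter_forall => j.
    have e20 : 0 < eta ^+ 4 / 2 by rewrite divr_gt0.
    have /fine_cvgP[fin4 /cvgrPdist_le/(_ _ e20)] := F4_cvg j.
    move: fin4; apply: filterS2 => k fin4 h.
    have -> : (\int[P]_w (F k j w ^+ 4)%:E = 'E_P[(fun w => F k j w ^+ 4)%R])%E by rewrite unlock.
    rewrite -(fineK fin4) lee_fin -lerBlDl; apply: le_trans h.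
    by rewrite /= distrC ler_norm.
  - near: n; apply: filter_forall => j.
    have e20 : 0 < eta ^+ 4 / ((q j)`!%:R * (q j)%:R).
      by rewrite divr_gt0// mulr_gt0// ltr0n ?fact_gt0 ?q0.
    have /fine_cvgP[fin /cvgrPdist_le/(_ _ e20)] := infl_cvg.
    move: fin; apply: filterS2 => k fin h.
    apply: (@le_trans _ _ (\sum_(j < d) max_influence (f k j))%E).
      by rewrite (bigD1 j)//= leeDl// sume_ge0// => i _; exact: max_influence_ge0.
    rewrite -(fineK fin) lee_fin; apply: le_trans h.
    by rewrite /= sub0r normrN ler_norm.
  - exact: Sigma_nnd.
(* Tightness: once the covariances are within 1 of [Sigma], all variances are at most [B], and
   Chebyshev gives a common level. *)
pose B := \sum_j Sigma j j + 1.
have B0 : 0 <= B by rewrite addr_ge0// sumr_ge0.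
exists (B / e + 1); have := s_cvg 1 ltr01; apply: filterS => n sn j.
apply: variance_tail => //.
  by rewrite unlock; exact: (integral_G rX (q0 j) (fK n j) (hF n j)).
rewrite /variance covE lee_fin.
apply: (@le_trans _ _ (Sigma j j + 1)); last first.
  by rewrite lerD2r (bigD1 j)//= lerDl sumr_ge0.
by have := sn j j; rewrite ler_norml lerBlDl => /andP[_].
Unshelve. all: end_near. Qed.
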